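(* Let $d$ be a constant positive integer. For every $\delta>0$ there is a deterministic algorithm which, given a set $S$ of $n$ points in $\mathbb{R}^d$ and a point $y\in\mathbb{R}^d$, finds $d$ points of $S$ such that the Euclidean distance from $y$ to the affine hyperplane spanned by these $d$ points is the smallest among all such choices of $d$ points of $S$, in time $O(n^{d-1+\delta})$.
   Context: This is the nearest induced hyperplane problem (the exact version, no approximation).
   Formalization: For d = 1 the formal theorem assumes δ ≥ 1: with d = 1 and δ < 1 the claimed time O(n^δ) is sublinear, and no algorithm can find the nearest of n unordered reals without reading all of them. *)

(* Defs.v *)
From HB Require Import structures.
From mathcomp Require Import all_boot all_order all_algebra.
From mathcomp Require Import all_classical all_reals all_analysis.
Set Implicit Arguments.
Unset Strict Implicit.
Unset Printing Implicit Defensive.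
Import Order.TTheory GRing.Theory Num.Theory.
Import numFieldNormedType.Exports.
Local Open Scope classical_set_scope.
Local Open Scope ring_scope.

Section Geometry.
Variables (R : realType) (d : nat).
Implicit Types (y z : 'rV[R]_d) (H : set 'rV[R]_d).

(* The library norm on 'rV[R]_d is the sup norm, hence this definition. *)
Definition euclid_dist y z : R := Num.sqrt (\sum_(j < d) (y 0 j - z 0 j) ^+ 2).

Definition dist_to_set y H : R := inf [set euclid_dist y z | z in H].

Definition affine_hull k (q : 'I_k -> 'rV[R]_d) : set 'rV[R]_d :=
  [set z | exists w : 'I_k -> R,
     \sum_(i < k) w i = 1 /\ z = \sum_(i < k) w i *: q i].

Definition is_hyperplane H : Prop :=
  exists (a : 'rV[R]_d) (b : R),
    a != 0 /\ H = [set z | \sum_(j < d) a 0 j * z 0 j = b].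

Variable n : nat.
Implicit Types (p : 'I_n -> 'rV[R]_d) (s : 'I_d -> 'I_n).

(* d affinely dependent points span no hyperplane and are not a candidate. *)
Definition induces_hyperplane p s : Prop :=
  injective s /\ is_hyperplane (affine_hull (p \o s)).

Definition nearest_induced_hyperplane p y s : Prop :=
  induces_hyperplane p s /\
  forall s', induces_hyperplane p s' ->
    dist_to_set y (affine_hull (p \o s))
      <= dist_to_set y (affine_hull (p \o s')).

End Geometry.

(* A real RAM: an array of natural numbers (used for counters and addresses)
   and an array of exact reals, both with indirect addressing.  Each
   instruction costs one unit.  There is no floor function nor any other
   conversion from reals to naturals, no multiplication of naturals, and the
   only real constants in a program are integers.  Program labels are positions
   in the instruction sequence; a jump outside the program halts. *)
Inductive instr : Type :=
  | NConst of nat & nat          (* N[i] := c           *)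
  | NAdd of nat & nat & nat      (* N[i] := N[j] + N[k] *)
  | NSub of nat & nat & nat      (* N[i] := N[j] - N[k], truncated *)
  | NLoad of nat & nat           (* N[i] := N[N[j]]     *)
  | NStore of nat & nat          (* N[N[i]] := N[j]     *)
  | RConst of nat & int          (* X[i] := c           *)
  | RAdd of nat & nat & nat      (* X[i] := X[j] + X[k] *)
  | RSub of nat & nat & nat      (* X[i] := X[j] - X[k] *)
  | RMul of nat & nat & nat      (* X[i] := X[j] * X[k] *)
  | RDiv of nat & nat & nat      (* X[i] := X[j] / X[k], with x / 0 = 0 *)
  | RLoad of nat & nat           (* X[i] := X[N[j]]     *)
  | RStore of nat & nat          (* X[N[i]] := X[j]     *)
  | Jump of nat                  (* goto l              *)
  | NJumpLt of nat & nat & nat   (* if N[i] < N[j] goto l *)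
  | RJumpLt of nat & nat & nat.  (* if X[i] < X[j] goto l *)

Definition program := seq instr.

Section Machine.
Variable R : realType.

Record state := State { pc : nat; nmem : nat -> nat; xmem : nat -> R }.

Definition exec_instr (c : instr) (st : state) : state :=
  let: State l N X := st in
  match c with
  | NConst i v => State l.+1 [eta N with i |-> v] X
  | NAdd i j k => State l.+1 [eta N with i |-> (N j + N k)%N] X
  | NSub i j k => State l.+1 [eta N with i |-> (N j - N k)%N] X
  | NLoad i j => State l.+1 [eta N with i |-> N (N j)] X
  | NStore i j => State l.+1 [eta N with N i |-> N j] X
  | RConst i v => State l.+1 N [eta X with i |-> v%:~R]
  | RAdd i j k => State l.+1 N [eta X with i |-> X j + X k]
  | RSub i j k => State l.+1 N [eta X with i |-> X j - X k]
  | RMul i j k => State l.+1 N [eta X with i |-> X j * X k]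
  | RDiv i j k => State l.+1 N [eta X with i |-> X j / X k]
  | RLoad i j => State l.+1 N [eta X with i |-> X (N j)]
  | RStore i j => State l.+1 N [eta X with N i |-> X j]
  | Jump l' => State l' N X
  | NJumpLt i j l' => State (if (N i < N j)%N then l' else l.+1) N X
  | RJumpLt i j l' => State (if X i < X j then l' else l.+1) N X
  end.

Definition halted (P : program) (st : state) : bool := (size P <= pc st)%N.

(* Halted states are fixed by step. *)
Definition step (P : program) (st : state) : state :=
  if onth P (pc st) is Some c then exec_instr c st else st.

Definition coords d (v : 'rV[R]_d) : seq R := [seq v 0 j | j <- enum 'I_d].

(* Initially N[0] = n, and X holds the coordinates of p_0, ..., p_(n-1)
   followed by those of y, contiguously from cell 0; all other cells are 0. *)
Definition init_state n d (p : 'I_n -> 'rV[R]_d) (y : 'rV[R]_d) : state :=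
  State 0%N [eta (fun=> 0%N) with 0%N |-> n]
    (nth 0 (flatten [seq coords (p i) | i <- enum 'I_n] ++ coords y)).

(* The d points found are reported through their indices in N[0], ..., N[d-1]. *)
Definition outputs n d (st : state) (s : 'I_d -> 'I_n) : Prop :=
  forall i : 'I_d, nmem st i = s i.

(* The set S of n points is given by an arbitrary injective enumeration p.  The
   machine must halt within T n steps on every input; a solution is demanded
   whenever some d points of S span a hyperplane. *)
Definition solves_nearest_hyperplane (d : nat) (P : program) (T : nat -> nat) :
    Prop :=
  forall (n : nat) (p : 'I_n -> 'rV[R]_d) (y : 'rV[R]_d), injective p ->
    let st := iter (T n) (step P) (init_state p y) in
    halted P st /\
    ((exists s, induces_hyperplane p s) ->
     exists s, outputs st s /\ nearest_induced_hyperplane p y s).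

End Machine.

(* Main.v *)
(* Translate the query point to the origin.  A d-tuple of points spans the
   hyperplane <a, z> = b, and minimizing the distance means maximizing
   |a|^2 / b^2.  Fix d - 2 of the points and let the last two vary.  Dually, the
   remaining points become lines in a plane, a pair (i, k) becomes the vertex
   a / b where two lines cross, and we look for the vertex farthest from the
   origin.  If the lines j and l separate i from k in the cyclic order of slopes,
   then the vertex (i, k) lies inside a segment between two vertices on i or two
   vertices on k, unless j or l passes through it; by strict convexity of the norm
   a farthest vertex is therefore found among pairs adjacent in slope order.
   Sorting the points for every (d - 2)-tuple takes O(n^(d - 1) log n) steps.
   Hyperplanes through the query point (b = 0) are vertices at infinity; an
   adjacent pair detects them because the slopes of their lines coincide. *)
From HB Require Import structures.
Require Import Defs.
From mathcomp Require Import all_boot all_order all_algebra.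
From mathcomp Require Import all_classical all_reals all_analysis.
From mathcomp Require Import perm zify ring lra.
Set Implicit Arguments.
Unset Strict Implicit.
Unset Printing Implicit Defensive.
Import Order.TTheory GRing.Theory Num.Theory.
Import numFieldNormedType.Exports.
Local Open Scope classical_set_scope.
Local Open Scope ring_scope.

(** * Structured programs for the machine *)

Inductive test : Type := NLt of nat & nat | XLt of nat & nat.

Inductive com : Type :=
  | CSkip
  | CInstr of instr
  | CSeq of com & com
  | CIf of test & com & com
  | CWhile of test & com.

Definition is_jump (c : instr) : bool :=
  match c with Jump _ | NJumpLt _ _ _ | RJumpLt _ _ _ => true | _ => false end.

Definition jump_if (b : test) (l : nat) : instr :=
  match b with NLt i j => NJumpLt i j l | XLt i j => RJumpLt i j l end.

Fixpoint csize (c : com) : nat :=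
  match c with
  | CSkip => 0
  | CInstr _ => 1
  | CSeq c1 c2 => csize c1 + csize c2
  | CIf _ c1 c2 => (csize c1 + csize c2).+2
  | CWhile _ c => (csize c).+3
  end.

Fixpoint compile (c : com) (l : nat) : program :=
  match c with
  | CSkip => [::]
  | CInstr i => [:: i]
  | CSeq c1 c2 => compile c1 l ++ compile c2 (l + csize c1)
  | CIf b c1 c2 =>
      jump_if b (l + csize c2).+2 :: compile c2 l.+1
        ++ Jump (l + csize c2 + csize c1).+2 :: compile c1 (l + csize c2).+2
  | CWhile b c =>
      [:: jump_if b l.+2, Jump (l + csize c).+3 & compile c l.+2 ++ [:: Jump l]]
  end.

Lemma size_compile c l : size (compile c l) = csize c.
Proof.
elim: c l => [|i|c1 IH1 c2 IH2|b c1 IH1 c2 IH2|b c IH] l //=.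
- by rewrite size_cat IH1 IH2.
- by rewrite size_cat /= IH1 IH2; lia.
- by rewrite size_cat /= IH; lia.
Qed.

Section Triples.
Variable R : realType.
Implicit Types (N : nat -> nat) (X : nat -> R).

Definition mem_pred := (nat -> nat) -> (nat -> R) -> Prop.

Definition test_holds (b : test) N X : bool :=
  match b with NLt i j => (N i < N j)%N | XLt i j => X i < X j end.

Definition tri (c : com) N X (t : nat) (Q : mem_pred) : Prop :=
  forall P1 P2 : program, exists k N' X',
    [/\ (k <= t)%N,
        iter k (step (P1 ++ compile c (size P1) ++ P2)) (State (size P1) N X)
          = State (size P1 + csize c) N' X'
      & Q N' X'].

Lemma step_at (P1 P2 : program) i N X :
  step (P1 ++ i :: P2) (State (size P1) N X)
    = exec_instr i (State (size P1) N X).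
Proof. by rewrite /step /= onth_cat ltnn subnn. Qed.

Lemma step_at_eq (P P1 P2 : program) l i N X :
  P = P1 ++ i :: P2 -> l = size P1 ->
  step P (State l N X) = exec_instr i (State l N X).
Proof. by move=> -> ->; apply: step_at. Qed.

Lemma exec_jump_if b l l' N X :
  exec_instr (jump_if b l') (State l N X)
    = State (if test_holds b N X then l' else l.+1) N X.
Proof. by case: b. Qed.

Lemma tri_weaken c N X t t' (Q Q' : mem_pred) :
  tri c N X t Q -> (t <= t')%N -> (forall N' X', Q N' X' -> Q' N' X') ->
  tri c N X t' Q'.
Proof.
move=> H le_t QQ' P1 P2; have [k [N' [X' [le_k E HQ]]]] := H P1 P2.
by exists k, N', X'; split; [apply: leq_trans le_t | | apply: QQ'].
Qed.

Lemma tri_skip N X (Q : mem_pred) : Q N X -> tri CSkip N X 0 Q.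
Proof. by move=> HQ P1 P2; exists 0%N, N, X; rewrite addn0. Qed.

Lemma tri_instr i N X (Q : mem_pred) : ~~ is_jump i ->
  (let st := exec_instr i (State 0 N X) in Q (nmem st) (xmem st)) ->
  tri (CInstr i) N X 1 Q.
Proof.
move=> ni HQ P1 P2; exists 1%N.
exists (nmem (exec_instr i (State 0 N X))), (xmem (exec_instr i (State 0 N X))).
split=> //=; rewrite step_at addn1.
by case: i ni {HQ}.
Qed.

Lemma tri_seq c1 c2 N X t1 t2 (Q : mem_pred) :
  tri c1 N X t1 (fun N' X' => tri c2 N' X' t2 Q) ->
  tri (CSeq c1 c2) N X (t1 + t2) Q.
Proof.
move=> H P1 P2 /=.
have [k1 [N1 [X1 [le1 E1 H2]]]] := H P1 (compile c2 (size P1 + csize c1) ++ P2).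
have [k2 [N2 [X2 [le2 E2 HQ]]]] := H2 (P1 ++ compile c1 (size P1)) P2.
exists (k2 + k1)%N, N2, X2; split=> //; first by rewrite addnC leq_add.
rewrite iterD -!catA E1.
by move: E2; rewrite size_cat size_compile -!catA addnA.
Qed.

Lemma tri_if b c1 c2 N X t (Q : mem_pred) :
  (if test_holds b N X then tri c1 N X t Q else tri c2 N X t Q) ->
  tri (CIf b c1 c2) N X t.+2 Q.
Proof.
move=> H P1 P2 /=; set l := size P1.
set j0 := jump_if _ _; set j1 := Jump _.
have sl : l.+1 = size (P1 ++ [:: j0]) by rewrite size_cat /= addn1.
set s2 := csize c2; set s1 := csize c1.
have sl2 : (l + s2).+2 = size (P1 ++ j0 :: compile c2 l.+1 ++ [:: j1]).
  by rewrite size_cat /= size_cat /= size_compile; lia.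
have E0 : step (P1 ++ (j0 :: compile c2 l.+1 ++ j1 :: compile c1 (l + s2).+2) ++ P2)
    (State l N X) = State (if test_holds b N X then (l + s2).+2 else l.+1) N X.
  by rewrite (@step_at_eq _ P1 (compile c2 l.+1 ++ j1 :: compile c1 (l + s2).+2 ++ P2) l j0)
    ?exec_jump_if // /= -catA.
case: ifP H E0 => _ H E0.
  have [k [N' [X' [le_k E HQ]]]] := H (P1 ++ j0 :: compile c2 l.+1 ++ [:: j1]) P2.
  exists k.+1, N', X'; split=> //; first by rewrite ltnS leqW.
  rewrite iterSr E0; move: E; rewrite -sl2 !(cat_cons, cat0s, =^~ catA).
  by move=> ->; congr State; rewrite -/s1 -/s2; lia.
have [k [N' [X' [le_k E HQ]]]] := H (P1 ++ [:: j0]) (j1 :: compile c1 (l + s2).+2 ++ P2).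
exists k.+2, N', X'; split=> //.
rewrite iterS iterSr E0; move: E; rewrite -sl !(cat_cons, cat0s, =^~ catA) => ->.
rewrite (@step_at_eq _ (P1 ++ j0 :: compile c2 l.+1) (compile c1 (l + s2).+2 ++ P2) _ j1).
- by rewrite /=; congr State; rewrite -/s1 -/s2; lia.
- by rewrite !(cat_cons, cat0s, =^~ catA).
- by rewrite size_cat /= size_compile; lia.
Qed.

(* I t is the loop invariant when t time units are left; paying for the tests
   makes t decrease, which gives termination. *)
Lemma tri_while b c (I : nat -> mem_pred) (Q : mem_pred) :
  (forall t N X, I t N X ->
     if test_holds b N X then
       exists t1 t2, (t1 + t2 + 2 <= t)%N /\ tri c N X t1 (I t2)
     else (2 <= t)%N /\ Q N X) ->
  forall t N X, I t N X -> tri (CWhile b c) N X t Q.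
Proof.
move=> H t; elim/ltn_ind: t => t IH N X It P1 P2 /=; set l := size P1.
set j0 := jump_if _ _; set j1 := Jump (l + _).+3; set s := csize c.
have sl : l.+2 = size (P1 ++ [:: j0; j1]) by rewrite size_cat /= addn2.
set P := P1 ++ _.
have E0 : step P (State l N X) = State (if test_holds b N X then l.+2 else l.+1) N X.
  by rewrite (@step_at_eq _ P1 (j1 :: compile c l.+2 ++ Jump l :: P2) l j0)
    ?exec_jump_if // /P !(cat_cons, cat0s, =^~ catA).
move: {H} (H _ _ _ It); case: ifP E0 => _ E0 H.
  have [t1 [t2 [le_t Ht]]] := H.
  have [k [N1 [X1 [le_k E I1]]]] := Ht (P1 ++ [:: j0; j1]) (Jump l :: P2).
  have lt_t : (t2 < t)%N by lia.
  have [k' [N' [X' [le_k' E' HQ]]]] := IH _ lt_t _ _ I1 P1 P2.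
  exists (k' + k.+2)%N, N', X'; split=> //; first by lia.
  rewrite iterD iterS iterSr E0.
  move: E; rewrite -sl !(cat_cons, cat0s, =^~ catA) -/P => E.
  have -> : iter k (step P) (State l.+2 N X) = State (l.+2 + s) N1 X1.
    by rewrite -E /P !(cat_cons, cat0s, =^~ catA).
  rewrite (@step_at_eq _ (P1 ++ [:: j0, j1 & compile c l.+2]) P2 _ (Jump l)) //.
  - by rewrite /P !(cat_cons, cat0s, =^~ catA).
  - by rewrite size_cat /= size_compile; lia.
have [le2 HQ] := H.
exists 2%N, N, X; split=> //.
rewrite iterS [iter 1 _ _]E0.
rewrite (@step_at_eq _ (P1 ++ [:: j0]) (compile c l.+2 ++ Jump l :: P2) _ j1).
- by rewrite /=; congr State; rewrite -/s; lia.
- by rewrite /P !(cat_cons, cat0s, =^~ catA).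
- by rewrite size_cat /=; lia.
Qed.

End Triples.

(** * A language with registers and two arrays *)

Inductive expr : Type :=
  | EVar of nat
  | EInt of int
  | EAdd of expr & expr
  | ESub of expr & expr
  | EMul of expr & expr
  | EDiv of expr & expr.

Inductive hcom : Type :=
  | HSkip
  | HConst of nat & nat
  | HAdd of nat & nat & nat
  | HSub of nat & nat & nat
  | HLd of bool & nat & nat
  | HSt of bool & nat & nat
  | HIn of nat & nat
  | HExp of nat & expr
  | HSeq of hcom & hcom
  | HIf of test & hcom & hcom
  | HWhile of test & hcom.

Definition upd T (f : nat -> T) (i : nat) (v : T) : nat -> T :=
  fun j => if j == i then v else f j.

Fixpoint ebound (e : expr) : nat :=
  match e with
  | EVar i => i.+1
  | EInt _ => 1
  | EAdd e1 e2 | ESub e1 e2 | EMul e1 e2 | EDiv e1 e2 =>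
      maxn (ebound e1) (ebound e2).+1
  end.

Definition tbound (b : test) : nat :=
  match b with NLt i j | XLt i j => maxn i.+1 j.+1 end.

Fixpoint bound (c : hcom) : nat :=
  match c with
  | HSkip => 0
  | HConst i _ => i.+1
  | HAdd i j k | HSub i j k => maxn i.+1 (maxn j.+1 k.+1)
  | HLd _ i j | HSt _ i j | HIn i j => maxn i.+1 j.+1
  | HExp i e => maxn 2 (maxn i.+1 (ebound e))
  | HSeq c1 c2 => maxn (bound c1) (bound c2)
  | HIf b c1 c2 => maxn (tbound b) (maxn (bound c1) (bound c2))
  | HWhile b c => maxn (tbound b) (bound c)
  end.

Fixpoint ecomp (e : expr) (k : nat) : com :=
  let bin o e1 e2 :=
    CSeq (ecomp e1 k) (CSeq (ecomp e2 k.+1) (CInstr (o k k k.+1))) in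
  match e with
  | EVar i => CSeq (CInstr (RConst k 0)) (CInstr (RAdd k k i))
  | EInt z => CInstr (RConst k z)
  | EAdd e1 e2 => bin RAdd e1 e2
  | ESub e1 e2 => bin RSub e1 e2
  | EMul e1 e2 => bin RMul e1 e2
  | EDiv e1 e2 => bin RDiv e1 e2
  end.

(* Memory layout: the cells below B are the registers.  N[B] and N[B+2] are
   scratch, N[B+1] is the address of the input, and the two arrays of naturals
   are interleaved from N[B+3].  Expressions are evaluated in X[B..2B). *)
Definition addr_code (B : nat) (a : bool) (i : nat) : com :=
  CSeq (CInstr (NAdd B i i))
    (CSeq (CInstr (NConst B.+2 (B.+3 + a))) (CInstr (NAdd B B B.+2))).

Fixpoint lower (B : nat) (c : hcom) : com :=
  match c with
  | HSkip => CSkip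
  | HConst i v => CInstr (NConst i v)
  | HAdd i j k => CInstr (NAdd i j k)
  | HSub i j k => CInstr (NSub i j k)
  | HLd a i j => CSeq (addr_code B a j) (CInstr (NLoad i B))
  | HSt a i j => CSeq (addr_code B a i) (CInstr (NStore B j))
  | HIn i j => CSeq (CInstr (NAdd B j B.+1)) (CInstr (RLoad i B))
  | HExp i e => CSeq (ecomp e B)
                  (CSeq (CInstr (RConst B.+1 0)) (CInstr (RAdd i B B.+1)))
  | HSeq c1 c2 => CSeq (lower B c1) (lower B c2)
  | HIf b c1 c2 => CIf b (lower B c1) (lower B c2)
  | HWhile b c => CWhile b (lower B c)
  end.

Fixpoint ecost (e : expr) : nat :=
  match e with
  | EVar _ => 2
  | EInt _ => 1
  | EAdd e1 e2 | ESub e1 e2 | EMul e1 e2 | EDiv e1 e2 => ecost e1 + (ecost e2 + 1)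
  end.

Fixpoint hcost (c : hcom) : nat :=
  match c with
  | HSkip => 0
  | HConst _ _ | HAdd _ _ _ | HSub _ _ _ => 1
  | HLd _ _ _ | HSt _ _ _ => 4
  | HIn _ _ => 2
  | HExp _ e => ecost e + 2
  | HSeq c1 c2 => hcost c1 + hcost c2
  | HIf _ c1 c2 => (maxn (hcost c1) (hcost c2)).+2
  | HWhile _ _ => 0
  end.

Fixpoint loopfree (c : hcom) : bool :=
  match c with
  | HSeq c1 c2 | HIf _ c1 c2 => loopfree c1 && loopfree c2
  | HWhile _ _ => false
  | _ => true
  end.

Section HighLevel.
Variable R : realType.
Variable inp : nat -> R.

Record hst := HS { nv : nat -> nat; xv : nat -> R; ar : bool -> nat -> nat }.

Implicit Types (h : hst) (Q : hst -> Prop).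

Fixpoint eval (X : nat -> R) (e : expr) : R :=
  match e with
  | EVar i => X i
  | EInt z => z%:~R
  | EAdd e1 e2 => eval X e1 + eval X e2
  | ESub e1 e2 => eval X e1 - eval X e2
  | EMul e1 e2 => eval X e1 * eval X e2
  | EDiv e1 e2 => eval X e1 / eval X e2
  end.

Definition setn h i v := HS (upd (nv h) i v) (xv h) (ar h).
Definition setx h i v := HS (nv h) (upd (xv h) i v) (ar h).
Definition seta h a i v :=
  HS (nv h) (xv h) (fun b => if b == a then upd (ar h b) i v else ar h b).

Fixpoint hexec (c : hcom) h : hst :=
  match c with
  | HConst i v => setn h i v
  | HAdd i j k => setn h i (nv h j + nv h k)
  | HSub i j k => setn h i (nv h j - nv h k)
  | HLd a i j => setn h i (ar h a (nv h j))
  | HSt a i j => seta h a (nv h i) (nv h j)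
  | HIn i j => setx h i (inp (nv h j))
  | HExp i e => setx h i (eval (xv h) e)
  | HSeq c1 c2 => hexec c2 (hexec c1 h)
  | HIf b c1 c2 => if test_holds b (nv h) (xv h) then hexec c1 h else hexec c2 h
  | HSkip | HWhile _ _ => h
  end.

Definition represents (B : nat) h (N : nat -> nat) (X : nat -> R) : Prop :=
  [/\ forall i, (i < B)%N -> N i = nv h i,
      forall i, (i < B)%N -> X i = xv h i,
      (B.*2 <= N B.+1)%N,
      forall i, X (N B.+1 + i)%N = inp i
    & forall (a : bool) k, N (B.+3 + a + k.*2)%N = ar h a k].

Definition htri (c : hcom) h (t : nat) Q : Prop :=
  forall B N X, (bound c <= B)%N -> represents B h N X ->
    tri (lower B c) N X t (fun N' X' => exists2 h', represents B h' N' X' & Q h').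

Lemma htri_weaken c h t t' Q Q' : htri c h t Q -> (t <= t')%N ->
  (forall h', Q h' -> Q' h') -> htri c h t' Q'.
Proof.
move=> H le_t QQ' B N X Bc r; apply: tri_weaken (H B N X Bc r) le_t _ => N' X'.
by move=> [h' r' /QQ']; exists h'.
Qed.

Lemma tri_ecomp e B k N X : (ebound e <= B)%N -> (B <= k)%N ->
  tri (ecomp e k) N X (ecost e) (fun N' X' =>
    [/\ N' = N, X' k = eval X e &
        forall i, ((i < k) || (k + ebound e <= i))%N -> X' i = X i]).
Proof.
elim: e k X => [i|z|e1 IH1 e2 IH2|e1 IH1 e2 IH2|e1 IH1 e2 IH2|e1 IH1 e2 IH2] k X /= be Bk.
- apply: (@tri_seq _ _ _ _ _ 1 1); apply: tri_instr => //=; apply: tri_instr => //=; split=> //.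
    by rewrite eqxx (_ : (i == k) = false) ?add0r //; lia.
  by move=> j hj; rewrite (_ : (j == k) = false) //; lia.
- apply: tri_instr => //=; split=> //; first by rewrite eqxx.
  by move=> j hj; rewrite (_ : (j == k) = false) //; lia.
all: move: be; rewrite geq_max => /andP[be1 be2].
all: apply: tri_seq; apply: tri_weaken (IH1 k X be1 Bk) (leqnn _) _ => N1 X1 [-> X1k X1o].
all: have Bk1 : (B <= k.+1)%N by apply: leqW.
all: have be2' : (ebound e2 <= B)%N by apply: ltnW.
all: apply: tri_seq; apply: tri_weaken (IH2 k.+1 X1 be2' Bk1) (leqnn _) _ => N2 X2 [-> X2k X2o].
all: have Ev : eval X1 e2 = eval X e2.
1,3,5,7: have : forall e, (ebound e <= k)%N -> eval X1 e = eval X e;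
   [elim=> //= [i hi|f1 F1 f2 F2|f1 F1 f2 F2|f1 F1 f2 F2|f1 F1 f2 F2];
      [by apply: X1o; rewrite hi | ..]; rewrite geq_max => /andP[h1 h2];
      rewrite F1 ?F2 //; exact: ltnW
   | by apply; apply: leq_trans Bk].
all: apply: tri_instr => //=; split=> //;
  [by rewrite eqxx X2k X2o ?ltnSn // X1k Ev
  | by move=> j hj; rewrite (_ : (j == k) = false) ?X2o ?X1o //; lia].
Qed.

Lemma tri_addr B (a : bool) i N X (Q : mem_pred R) : (i < B)%N ->
  (forall N', N' B = (B.+3 + a + (N i).*2)%N ->
     (forall j, j != B -> j != B.+2 -> N' j = N j) -> Q N' X) ->
  tri (addr_code B a i) N X 3 Q.
Proof.
move=> iB HQ; apply: (@tri_seq _ _ _ _ _ 1 2); apply: tri_instr => //=.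
apply: (@tri_seq _ _ _ _ _ 1 1); apply: tri_instr => //=; apply: tri_instr => //=.
apply: HQ => [|j nj nj2] /=.
  by rewrite !eqxx (_ : (B == B.+2) = false) //=; lia.
by rewrite (negbTE nj) (negbTE nj2).
Qed.

Lemma rel_test B b h N X : (tbound b <= B)%N -> represents B h N X ->
  test_holds b N X = test_holds b (nv h) (xv h).
Proof.
move=> bB [rN rX _ _ _]; case: b bB => i j /=; rewrite geq_max => /andP[iB jB].
  by rewrite !rN.
by rewrite !rX.
Qed.

Lemma htri_loopfree c h Q : loopfree c -> Q (hexec c h) -> htri c h (hcost c) Q.
Proof.
move=> lf HQ B N X Bc r.
suff H : tri (lower B c) N X (hcost c) (fun N' X' => represents B (hexec c h) N' X').
  by apply: tri_weaken H (leqnn _) _ => N' X' r'; exists (hexec c h).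
elim: c h N X lf Bc r {Q HQ} => [|i v|i j k|i j k|a i j|a i j|i j|i e|c1 IH1 c2 IH2|b c1 IH1 c2 IH2|//] h N X /= lf.
- by move=> _ r; apply: tri_skip.
- move=> iB [rN rX rB rI rA]; apply: tri_instr => //=; split=> //= [x xB|||b k].
  + by rewrite /upd; case: eqP => // _; apply: rN.
  + by case: eqP => [/eqP|_ //]; lia.
  + by move=> x; case: eqP => [/eqP|_ //]; lia.
  + by rewrite -rA (_ : (_ == i) = false) //; lia.
- rewrite !geq_max => /and3P[iB jB kB] [rN rX rB rI rA].
  apply: tri_instr => //=; split=> //= [x xB|||b l].
  + by rewrite /upd !rN.
  + by case: eqP => [/eqP|_ //]; lia.
  + by move=> x; case: eqP => [/eqP|_ //]; lia.
  + by rewrite -rA (_ : (_ == i) = false) //; lia.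
- rewrite !geq_max => /and3P[iB jB kB] [rN rX rB rI rA].
  apply: tri_instr => //=; split=> //= [x xB|||b l].
  + by rewrite /upd !rN.
  + by case: eqP => [/eqP|_ //]; lia.
  + by move=> x; case: eqP => [/eqP|_ //]; lia.
  + by rewrite -rA (_ : (_ == i) = false) //; lia.
- rewrite !geq_max => /andP[iB jB] [rN rX rB rI rA].
  apply: (@tri_seq _ _ _ _ _ 3 1); apply: tri_addr => // N' NB No.
  apply: tri_instr => //=; split=> //= [x xB|||b l].
  + rewrite /upd; case: eqP => // _; last by rewrite No ?rN //; lia.
    by rewrite NB No ?rA ?rN //; lia.
  + by case: eqP => [/eqP|_ //]; [lia | rewrite No //; lia].
  + by move=> x; case: eqP => [/eqP|_ //]; [lia | rewrite No ?rI //; lia].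
  + by rewrite -rA (_ : (_ == i) = false) ?No //; lia.
- rewrite !geq_max => /andP[iB jB] [rN rX rB rI rA].
  apply: (@tri_seq _ _ _ _ _ 3 1); apply: tri_addr => // N' NB No.
  apply: tri_instr => //=; rewrite NB; split=> //= [x xB|||b l].
  + by rewrite (_ : (x == _) = false) ?No ?rN //; lia.
  + by rewrite (_ : (_ == _) = false) ?No //; lia.
  + by move=> x; rewrite (_ : (_ == _) = false) ?No ?rI //; lia.
  + rewrite /upd; case: (eqVneq b a) => [->|nba].
      rewrite rN // -rA (_ : (_ == _) = (l == nv h i)); last by lia.
      have nj : (j != B) && (j != B.+2) by lia.
      have nl : (B.+3 + a + l.*2 != B) && (B.+3 + a + l.*2 != B.+2) by lia.
      case/andP: nj => ? ?; case/andP: nl => ? ?.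
      by case: eqP => // _; rewrite No // rN.
    have nl : (B.+3 + b + l.*2 != B) && (B.+3 + b + l.*2 != B.+2) by lia.
    case/andP: nl => ? ?; rewrite (_ : (_ == _) = false) ?No ?rA //.
    by move: nba; clear; case: a b => -[] //= _; lia.
- rewrite !geq_max => /andP[iB jB] [rN rX rB rI rA].
  apply: (@tri_seq _ _ _ _ _ 1 1); apply: tri_instr => //=; apply: tri_instr => //=.
  split=> //= [x xB|x xB|||b l].
  + by rewrite (_ : (_ == _) = false) ?rN //; lia.
  + by rewrite /upd (rX x) //= eqxx (addnC (N j)) rI rN.
  + by rewrite (_ : (_ == _) = false) //; lia.
  + move=> x; rewrite (_ : (B.+1 == B) = false); last by lia.
    by rewrite (_ : (_ == i) = false) ?rI //; lia.
  + by rewrite (_ : (_ == B) = false) ?rA //; lia.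
- rewrite !geq_max => /and3P[B2 iB eB] [rN rX rB rI rA].
  apply: tri_seq; apply: tri_weaken (tri_ecomp N X eB (leqnn B)) (leqnn _) _.
  move=> N1 X1 [-> X1B X1o].
  apply: (@tri_seq _ _ _ _ _ 1 1); apply: tri_instr => //=; apply: tri_instr => //=.
  have -> : (B == B.+1) = false by lia.
  rewrite eqxx addr0 X1B; split=> //= [x xB|].
  + rewrite /upd (_ : (x == B.+1) = false) ?X1o ?xB ?rX //; last by lia.
    case: eqP => // _; elim: e eB {X1B X1o} => //= e1 E1 e2 E2;
      by rewrite geq_max => /andP[h1 h2]; rewrite E1 ?E2 // ltnW.
  + move=> x; rewrite (_ : (_ == i) = false); last by lia.
    by rewrite (_ : (_ == B.+1) = false) ?X1o ?rI //; lia.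
- rewrite geq_max => /andP[B1 B2] r; case/andP: lf => lf1 lf2.
  apply: tri_seq; apply: tri_weaken (IH1 h N X lf1 B1 r) (leqnn _) _ => N' X' r'.
  exact: IH2.
- rewrite !geq_max => /and3P[bB B1 B2] r; case/andP: lf => lf1 lf2.
  apply: tri_if; rewrite (rel_test bB r); case Eb: (test_holds b _ _).
    by apply: tri_weaken (IH1 h N X lf1 B1 r) (leq_maxl _ _) _ => N' X'.
  by apply: tri_weaken (IH2 h N X lf2 B2 r) (leq_maxr _ _) _ => N' X'.
Qed.

Lemma htri_seq c1 c2 h t1 t2 Q :
  htri c1 h t1 (fun h' => htri c2 h' t2 Q) -> htri (HSeq c1 c2) h (t1 + t2) Q.
Proof.
move=> H B N X /=; rewrite geq_max => /andP[B1 B2] r.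
apply: tri_seq; apply: tri_weaken (H B N X B1 r) (leqnn _) _ => N' X' [h' r' H'].
exact: H'.
Qed.

Lemma htri_while b c (I : nat -> hst -> Prop) Q :
  (forall t h, I t h ->
     if test_holds b (nv h) (xv h) then
       exists t1 t2, (t1 + t2 + 2 <= t)%N /\ htri c h t1 (I t2)
     else (2 <= t)%N /\ Q h) ->
  forall t h, I t h -> htri (HWhile b c) h t Q.
Proof.
move=> H t h It B N X /=; rewrite geq_max => /andP[bB Bc] r.
apply: (@tri_while _ _ _ (fun t N X => exists2 h, represents B h N X & I t h)) => [|]; last by exists h.
move=> {r It} {}t {}N {}X [h' r It]; rewrite (rel_test bB r).
move: (H _ _ It); case: ifP => _.
  by move=> [t1 [t2 [le_t Ht]]]; exists t1, t2; split=> //; apply: Ht.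
by move=> [t2 HQ]; split=> //; exists h'.
Qed.

Definition for_ (i j one : nat) (c : hcom) : hcom :=
  HSeq (HConst i 0) (HWhile (NLt i j) (HSeq c (HAdd i i one))).

Lemma htri_for i j one c h m tc (I : nat -> hst -> Prop) Q :
  i != j -> i != one -> nv h j = m -> nv h one = 1%N ->
  I 0%N (setn h i 0) ->
  (forall k h', (k < m)%N -> I k h' -> nv h' i = k -> nv h' j = m -> nv h' one = 1%N ->
     htri c h' tc (fun h2 => [/\ nv h2 i = k, nv h2 j = m, nv h2 one = 1%N
                               & I k.+1 (setn h2 i k.+1)])) ->
  (forall h', nv h' i = m -> nv h' j = m -> nv h' one = 1%N -> I m h' -> Q h') ->
  htri (for_ i j one c) h (m * (tc + 3) + 3) Q.
Proof.
move=> nij nio hj ho I0 HI HQ.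
rewrite (_ : (m * (tc + 3) + 3 = 1 + (m * (tc + 3) + 2))%N); last by lia.
apply: htri_seq; apply: htri_loopfree => //=.
pose J t h' := exists k, [/\ (k <= m)%N, nv h' i = k, nv h' j = m, nv h' one = 1%N
   & I k h' /\ ((m - k) * (tc + 3) + 2 <= t)%N].
apply: (@htri_while _ _ J) => [t h' [k [km hi hj' ho' [Ik tk]]]|].
  rewrite /= hi hj'; case: ltnP => [lt|ge].
    exists (tc + 1)%N, ((m - k.+1) * (tc + 3) + 2)%N; split.
      by move: tk; rewrite -(subnSK lt) mulSn; lia.
    apply: htri_seq; apply: htri_weaken (HI k h' lt Ik hi hj' ho') (leqnn _) _.
    move=> h2 [h2i h2j h2o I2]; apply: htri_loopfree => //=.
    exists k.+1; rewrite /setn /= h2o h2i addn1; split=> //=.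
    - by rewrite /upd eqxx.
    - by rewrite /upd eq_sym (negbTE nij).
    - by rewrite /upd eq_sym (negbTE nio).
  have Ekm : k = m by lia.
  by rewrite Ekm in hi Ik; split; [lia | apply: HQ].
exists 0%N; split=> //=.
- by rewrite /upd eqxx.
- by rewrite /upd eq_sym (negbTE nij).
- by rewrite /upd eq_sym (negbTE nio).
- by split=> //; lia.
Qed.

End HighLevel.

(** * Distance to an induced hyperplane *)

Section Hyperplane.
Variables (R : realType) (d : nat).
Variables (q : 'I_d -> 'rV[R]_d) (y : 'rV[R]_d).
Local Open Scope classical_set_scope.

Definition hat (z : 'rV[R]_d) : 'rV[R]_(d + 1) := row_mx (z - y) (1 : 'rV_1).

Definition hatmx : 'M[R]_(d, d + 1) := \matrix_i hat (q i).

Definition plane_form (x : 'rV[R]_(d + 1)) : R := \det (col_mx hatmx x).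

Definition plane_coef (m : 'I_(d + 1)) : R := plane_form (delta_mx 0 m).

Lemma plane_formE x : plane_form x = \sum_m x 0 m * plane_coef m.
Proof.
have E z : plane_form z =
    \sum_m z 0 m * cofactor (col_mx hatmx 0) (rshift d ord0) m.
  rewrite /plane_form (expand_det_row _ (rshift d ord0)); apply: eq_bigr => m _.
  rewrite col_mxEd; congr (_ * ((-1) ^+ _ * \det _)); apply/matrixP => i j.
  rewrite !mxE; case: splitP => // l El.
  have : lift (rshift d ord0) i = rshift d l by apply: val_inj.
  by rewrite (ord1 l) => /eqP; rewrite eq_sym (negbTE (neq_lift _ _)).
rewrite E; apply: eq_bigr => m _; rewrite /plane_coef E (bigD1 m) //= big1.
  by rewrite !mxE !eqxx mul1r addr0.
by move=> j nj; rewrite mxE (negbTE nj) andbF mul0r.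
Qed.

Lemma hatmxE i j : hatmx i j = hat (q i) 0 j.
Proof. by rewrite mxE. Qed.

Lemma hatl z l : hat z 0 (lshift 1 l) = z 0 l - y 0 l.
Proof. by rewrite /hat row_mxEl !mxE. Qed.

Lemma hatr z l : hat z 0 (rshift d l) = 1.
Proof. by rewrite /hat row_mxEr mxE (ord1 l) eqxx. Qed.

Lemma hat_hull z (w : 'I_d -> R) : \sum_i w i = 1 -> z = \sum_i w i *: q i ->
  hat z = (\row_i w i) *m hatmx.
Proof.
move=> w1 ->; apply/rowP => j; rewrite [RHS]mxE.
case: (split_ordP j) => l ->.
  rewrite hatl summxE -[y 0 l]mul1r -w1 mulr_suml -sumrB; apply: eq_bigr => i _.
  by rewrite hatmxE hatl !mxE mulrBr.
rewrite hatr -w1; apply: eq_bigr => i _.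
by rewrite hatmxE hatr mxE mulr1.
Qed.

Lemma plane_form_dep (w : 'rV_d) : plane_form (w *m hatmx) = 0.
Proof.
apply/eqP/det0P; exists (row_mx w (- 1)).
  apply/eqP => /rowP /(_ (rshift d ord0)); rewrite row_mxEr !mxE eqxx.
  by move/eqP; rewrite oppr_eq0 oner_eq0.
by rewrite mul_row_col mulNmx mul1mx subrr.
Qed.

Lemma plane_form_hull z : affine_hull q z -> plane_form (hat z) = 0.
Proof. by move=> [w [w1 zE]]; rewrite (hat_hull w1 zE) plane_form_dep. Qed.

Lemma hull_plane_form x z : plane_form x != 0 -> plane_form (hat z) = 0 ->
  affine_hull q z.
Proof.
move=> nx /eqP /det0P[v v0]; rewrite -[v]hsubmxK mul_row_col.
set v1 := lsubmx v; set v2 := rsubmx v => E.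
have nv2 : v2 0 0 != 0.
  apply: contraNneq nx => v20; apply/det0P; exists (row_mx v1 0).
    apply: contraNneq v0 => v10; rewrite -[v]hsubmxK -/v1 -/v2.
    apply/eqP/rowP => j; case: (split_ordP j) => l ->.
      by move/rowP: v10 => /(_ (lshift 1 l)); rewrite !row_mxEl => ->; rewrite !mxE.
    by rewrite row_mxEr (ord1 l) v20 mxE.
  rewrite mul_row_col mul0mx addr0 -E (_ : v2 = 0) ?mul0mx ?addr0 //.
  by apply/rowP => j; rewrite (ord1 j) v20 mxE.
have {}E j : hat z 0 j = \sum_i (- (v2 0 0)^-1 * v1 0 i) * hat (q i) 0 j.
  have : (v1 *m hatmx + v2 *m hat z) 0 j = 0 by rewrite E mxE.
  rewrite mxE [X in _ + X]mxE big_ord1 => /eqP.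
  rewrite addr_eq0 mxE => /eqP E1.
  rewrite (eq_bigr (fun i => - (v2 0 0)^-1 * (v1 0 i * hatmx i j))).
    by rewrite -mulr_sumr E1; field.
  by move=> i _; rewrite hatmxE mulrA.
exists (fun i => - (v2 0 0)^-1 * v1 0 i).
have s1 : \sum_i - (v2 0 0)^-1 * v1 0 i = 1.
  have := E (rshift d ord0); rewrite hatr => ->.
  by apply: eq_bigr => i _; rewrite hatr mulr1.
split=> //; apply/rowP => j; have := E (lshift 1 j).
rewrite hatl summxE => H.
rewrite -[LHS](subrK (y 0 j)) H -[y 0 j in LHS]mul1r -s1 mulr_suml -big_split /=.
by apply: eq_bigr => i _; rewrite hatl !mxE; ring.
Qed.

Definition normal_sq : R := \sum_(m < d) plane_coef (lshift 1 m) ^+ 2.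
Definition offset : R := plane_coef (rshift d ord0).

Lemma plane_form_hat z :
  plane_form (hat z) =
    \sum_(m < d) plane_coef (lshift 1 m) * (z 0 m - y 0 m) + offset.
Proof.
rewrite plane_formE big_split_ord /= big_ord1 hatr mul1r.
by congr (_ + _); apply: eq_bigr => m _; rewrite hatl mulrC.
Qed.

Lemma sumsq_eq0 k (a : 'I_k -> R) : \sum_i a i ^+ 2 = 0 -> forall i, a i = 0.
Proof.
move=> /eqP; rewrite psumr_eq0 => [/allP H i|i _]; last exact: sqr_ge0.
by have := H i (mem_index_enum _); rewrite sqrf_eq0 => /eqP.
Qed.

Lemma mem_hull i : affine_hull q (q i).
Proof.
exists (fun j => (j == i)%:R); split.
  by rewrite (bigD1 i) //= eqxx big1 ?addr0 // => j /negbTE ->.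
rewrite (bigD1 i) //= eqxx scale1r big1 ?addr0 // => j /negbTE ->.
by rewrite scale0r.
Qed.

Lemma hatmx_row_free (a : 'rV[R]_d) (b : R) : a != 0 ->
  affine_hull q = [set z | \sum_(j < d) a 0 j * z 0 j = b] -> row_free hatmx.
Proof.
move=> na HE.
pose dot (u v : 'rV[R]_d) := \sum_j u 0 j * v 0 j.
have dotD u v w : dot u (v + w) = dot u v + dot u w.
  by rewrite /dot -big_split; apply: eq_bigr => j _; rewrite mxE mulrDr.
have dotZ u v (k : R) : dot u (k *: v) = k * dot u v.
  by rewrite /dot mulr_sumr; apply: eq_bigr => j _; rewrite mxE; ring.
have dotC u v : dot u v = dot v u.
  by rewrite /dot; apply: eq_bigr => j _; rewrite mulrC.
have dot0 u : dot u u = 0 -> u = 0.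
  move=> H; apply/rowP => j; rewrite mxE; apply: (@sumsq_eq0 _ (fun j => u 0 j)).
  by rewrite -[RHS]H; apply: eq_bigr => i _; rewrite expr2.
have aa : dot a a != 0 by apply: contra na => /eqP /dot0 ->.
pose c : 'rV[R]_(d + 1) := row_mx a (dot a y - b)%:M.
suff kc : (kermx hatmx^T <= c)%MS.
  have := leq_trans (mxrankS kc) (rank_leq_row c).
  rewrite mxrank_ker mxrank_tr /row_free eqn_leq rank_leq_row /=; lia.
apply/row_subP => i.
have : row i (kermx hatmx^T) *m hatmx^T = 0 by apply/sub_kermxP; exact: row_sub.
move: (row i _) => r Hr.
pose r1 := lsubmx r; pose r2 := (rsubmx r) 0 0.
have rz z : dot a z = b -> dot r1 (z - y) + r2 = 0.
  move=> az; have [w [w1 zE]] : affine_hull q z by rewrite HE.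
  have : r *m (hat z)^T = 0.
    by rewrite (hat_hull w1 zE) trmx_mul mulmxA Hr mul0mx.
  move/matrixP => /(_ 0 0); rewrite mxE [RHS]mxE big_split_ord /= big_ord1 => <-.
  congr (_ + _); last by rewrite [X in _ * X]mxE hatr /r2 mxE mulr1.
  by apply: eq_bigr => j _; rewrite [X in _ = _ * X]mxE hatl !mxE.
pose z0 := (b / dot a a) *: a.
have az0 : dot a z0 = b by rewrite dotZ divfK.
pose l := dot r1 a / dot a a.
have r1E : r1 = l *: a.
  pose u := r1 - l *: a.
  have au : dot a u = 0.
    by rewrite /u -scaleNr dotD dotZ /l (dotC a r1); field.
  have r1u : dot r1 u = 0.
    have h1 := rz _ az0; have h2 : dot r1 (z0 + u - y) + r2 = 0.
      by apply: rz; rewrite dotD az0 au addr0.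
    by move: h1 h2; rewrite addrAC !dotD; lra.
  apply/eqP; rewrite -subr_eq0; apply/eqP; apply: dot0.
  by rewrite -/u {2}/u -scaleNr dotD dotZ (dotC u r1) (dotC u a) r1u au mulr0 addr0.
have r2E : r2 = l * (dot a y - b).
  have := rz _ az0; rewrite r1E dotC dotZ -scaleN1r dotC dotD dotC.
  by rewrite dotZ -[dot z0 a]dotC az0 -/(dot _ _) => H; lra.
apply/sub_rVP; exists l; rewrite -[r]hsubmxK -/r1 r1E scale_row_mx; congr row_mx.
by apply/rowP => j; rewrite (ord1 j) -/r2 !mxE eqxx r2E.
Qed.

Lemma hyperplane_normal : (0 < d)%N -> is_hyperplane (affine_hull q) ->
  0 < normal_sq.
Proof.
move=> d0 [a [b [na HE]]]; have rf := hatmx_row_free na HE.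
rewrite lt0r sumr_ge0 ?andbT => [|i _]; last exact: sqr_ge0.
apply/eqP => /sumsq_eq0 H.
have off0 : offset = 0.
  have := plane_form_hull (mem_hull (Ordinal d0)).
  by rewrite plane_form_hat big1 ?add0r // => m _; rewrite H mul0r.
have pf0 x : plane_form x = 0.
  rewrite plane_formE big_split_ord /= big_ord1 -/offset off0 mulr0 addr0.
  by rewrite big1 // => m _; rewrite H mulr0.
pose c : 'rV[R]_(d + 1) := row_mx a (\sum_j a 0 j * y 0 j - b)%:M.
have Mc : hatmx *m c^T = 0.
  apply/colP => i; rewrite !mxE big_split_ord /= big_ord1.
  have : affine_hull q (q i) by apply: mem_hull.
  rewrite HE /= => E.
  rewrite hatmxE hatr [c^T _ _]mxE /c row_mxEr mxE eqxx mul1r.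
  rewrite -E (eq_bigr (fun j => a 0 j * q i 0 j - a 0 j * y 0 j)).
    by rewrite sumrB addrA subrK subrr.
  by move=> j _; rewrite hatmxE hatl [(row_mx _ _)^T _ _]mxE row_mxEl; ring.
have c0 : c *m c^T != 0.
  apply: contra na => /eqP /matrixP /(_ 0 0); rewrite !mxE => E.
  apply/eqP/rowP => j; rewrite mxE.
  have -> : a 0 j = c 0 (lshift 1 j) by rewrite row_mxEl.
  apply: (@sumsq_eq0 _ (fun j => c 0 j)); rewrite -[RHS]E; apply: eq_bigr => i _.
  by rewrite [c^T _ _]mxE expr2.
have /eqP/det0P[v v0] := pf0 c; rewrite -[v]hsubmxK mul_row_col => E.
have v20 : rsubmx v = 0.
  have := congr1 (fun A => A *m c^T) E.
  rewrite mulmxDl -mulmxA Mc mulmx0 add0r mul0mx -mulmxA [c *m c^T]mx11_scalar.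
  rewrite mul_mx_scalar => /eqP; rewrite scaler_eq0 => /orP[/eqP h|/eqP //].
  by move: c0; rewrite [c *m c^T]mx11_scalar h raddf0 eqxx.
move: E; rewrite v20 mul0mx addr0 => /eqP; rewrite mulmx_free_eq0 // => /eqP v10.
by move: v0; rewrite -[v]hsubmxK v10 v20 row_mx0 eqxx.
Qed.

Lemma hullE : 0 < normal_sq -> affine_hull q =
  [set z | \sum_(m < d) plane_coef (lshift 1 m) * (z 0 m - y 0 m) + offset = 0].
Proof.
move=> A0.
have [m hm] : exists m, plane_form (delta_mx 0 m) != 0.
  apply: contrapT => H; move: A0; rewrite /normal_sq big1 ?ltxx // => m _.
  have [-> |n0] := eqVneq (plane_coef (lshift 1 m)) 0; first by rewrite expr0n.
  by case: H; exists (lshift 1 m).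
apply/seteqP; split => z /= hz; first by rewrite -plane_form_hat plane_form_hull.
by apply: (hull_plane_form hm); rewrite plane_form_hat.
Qed.

Lemma normal_hyperplane : 0 < normal_sq -> is_hyperplane (affine_hull q).
Proof.
move=> A0; pose a : 'rV[R]_d := \row_m plane_coef (lshift 1 m).
exists a, (\sum_j a 0 j * y 0 j - offset); split.
  apply: contraTneq A0 => a0; rewrite /normal_sq big1 ?ltxx // => m _.
  by have /rowP/(_ m) := a0; rewrite !mxE => ->; rewrite expr0n.
have E z : \sum_(m < d) plane_coef (lshift 1 m) * (z 0 m - y 0 m) =
    \sum_j a 0 j * z 0 j - \sum_j a 0 j * y 0 j.
  by rewrite -sumrB; apply: eq_bigr => j _; rewrite !mxE mulrBr.
by rewrite hullE //; apply/seteqP; split => z /=; rewrite E => H; lra.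
Qed.

Lemma dist_hull : 0 < normal_sq ->
  dist_to_set y (affine_hull q) = Num.sqrt (offset ^+ 2 / normal_sq).
Proof.
move=> A0; rewrite /dist_to_set; set S := [set _ | _ in _].
set v := Num.sqrt _; pose l := - offset / normal_sq.
have An := lt0r_neq0 A0.
have Sv : S v.
  exists (\row_m (y 0 m + l * plane_coef (lshift 1 m))).
    rewrite hullE //= (eq_bigr (fun m : 'I_d => l * plane_coef (lshift 1 m) ^+ 2)).
      by rewrite -mulr_sumr -/normal_sq /l; field.
    by move=> m _; rewrite mxE; ring.
  rewrite /euclid_dist /v; congr Num.sqrt.
  rewrite (eq_bigr (fun m : 'I_d => l ^+ 2 * plane_coef (lshift 1 m) ^+ 2)).
    by rewrite -mulr_sumr -/normal_sq /l; field.
  by move=> m _; rewrite mxE; ring.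
have lbv : lbound S v.
  move=> _ [z Hz <-]; rewrite /euclid_dist /v ler_wsqrtr //.
  move: Hz; rewrite hullE //= => Hz.
  have : 0 <= \sum_(j < d) (z 0 j - y 0 j - l * plane_coef (lshift 1 j)) ^+ 2.
    by apply: sumr_ge0 => j _; apply: sqr_ge0.
  rewrite (eq_bigr (fun j : 'I_d => (y 0 j - z 0 j) ^+ 2 +
     ((- 2 * l) * (plane_coef (lshift 1 j) * (z 0 j - y 0 j))
      + l ^+ 2 * plane_coef (lshift 1 j) ^+ 2))); last by move=> j _; ring.
  rewrite big_split /= big_split /= -!mulr_sumr -/normal_sq.
  have -> : \sum_(m < d) plane_coef (lshift 1 m) * (z 0 m - y 0 m) = - offset by lra.
  have -> : - 2 * l * - offset + l ^+ 2 * normal_sq = - (offset ^+ 2 / normal_sq).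
    by rewrite /l; field.
  by rewrite subr_ge0.
apply/eqP; rewrite eq_le; apply/andP; split; last by apply: lb_le_inf => //; exists v.
by apply: ge_inf => //; exists v.
Qed.

End Hyperplane.

(** * Determinants with prescribed rows *)

Section RowDeterminants.
Variable R : realType.
Implicit Types x y z : nat -> R.

Definition rdet (N : nat) (f : nat -> nat -> R) : R :=
  \det (\matrix_(i < N, j < N) f i j).

Lemma eq_rdet N f g : (forall i j, (i < N)%N -> (j < N)%N -> f i j = g i j) ->
  rdet N f = rdet N g.
Proof. by move=> E; congr (\det _); apply/matrixP => i j; rewrite !mxE E. Qed.

Definition basis (m c : nat) : R := (c == m)%:R.

Definition rows k (t : nat -> nat -> R) x y z (i : nat) : nat -> R :=
  if (i < k)%N then t i else if i == k then x else if i == k.+1 then y else z.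

Definition form k t x y z : R := rdet (k + 3) (rows k t x y z).

Definition det3 (u v w : R * R * R) : R :=
  u.1.1 * (v.1.2 * w.2 - v.2 * w.1.2) - u.1.2 * (v.1.1 * w.2 - v.2 * w.1.1)
  + u.2 * (v.1.1 * w.1.2 - v.1.2 * w.1.1).

Lemma det_mx33 (M : 'M[R]_3) :
  let c (i : 'I_3) := (M i 0, M i 1, M i (inord 2)) in
  \det M = det3 (c 0) (c 1) (c (inord 2)).
Proof.
have E2 : inord 2 = lift 0 (lift 0 0) :> 'I_3 by apply: val_inj; rewrite /= inordK.
have E1 : (1 : 'I_3) = lift 0 0 by apply: val_inj.
rewrite /= (expand_det_row _ 0) !big_ord_recl big_ord0 /cofactor.
rewrite !(expand_det_row _ (0 : 'I_2)) !big_ord_recl !big_ord0 /cofactor.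
rewrite !det_mx11 !mxE E2 E1 /det3 /=.
have L1 : lift (lift 0 0) 0 = 0 :> 'I_3 by apply: val_inj.
have L2 : lift (lift 0 0) (lift 0 0) = lift 0 (lift 0 0) :> 'I_3 by apply: val_inj.
have L3 : lift (lift 0 (lift 0 0)) 0 = 0 :> 'I_3 by apply: val_inj.
have L4 : lift (lift 0 (lift 0 0)) (lift 0 0) = lift 0 0 :> 'I_3 by apply: val_inj.
have L5 : lift (lift 0 0) 0 = 0 :> 'I_2 by apply: val_inj.
rewrite ?L1 ?L2 ?L3 ?L4 ?L5 ?L1 ?L2 ?L3 ?L4 ?L5 /bump /=; ring.
Qed.

Lemma form_coord k t e g h : form k t e g h != 0 ->
  exists (w0 : R) (c : (nat -> R) -> R * R * R),
    [/\ w0 != 0, forall x y z, form k t x y z = w0 * det3 (c x) (c y) (c z),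
        c e = (1, 0, 0), c g = (0, 1, 0) & c h = (0, 0, 1)].
Proof.
pose T : 'M[R]_(k, k + 3) := \matrix_(i, j) t i j.
pose rv x : 'rV[R]_(k + 3) := \row_j x j.
pose X3 x y z : 'M[R]_(3, k + 3) :=
  \matrix_(i, j) (if i == 0 :> nat then x j else if i == 1%N :> nat then y j else z j).
have E x y z : form k t x y z = \det (col_mx T (X3 x y z)).
  congr (\det _); apply/matrixP => i j; rewrite !mxE /rows.
  case: (splitP i) => l El; first by rewrite El mxE.
  rewrite El mxE -[X in _ == X]addn0 -[X in _ == X.+1]addn0 -addnS !eqn_add2l.
  by case: ifP => // _; case: ifP.
rewrite E => n0; set M0 := col_mx T _ in n0 *.
have u0 : M0 \in unitmx by rewrite unitmxE unitfE.
pose cr x : 'rV[R]_3 := rsubmx (rv x *m invmx M0).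
pose c x := (cr x 0 0, cr x 0 1, cr x 0 (inord 2)).
have r3 x y z i : row i (X3 x y z) =
    rv (if i == 0 :> nat then x else if i == 1%N :> nat then y else z).
  by apply/rowP => j; rewrite !mxE; case: ifP => // _; case: ifP.
have FC x y z : form k t x y z = form k t e g h * det3 (c x) (c y) (c z).
  rewrite !E -/M0; pose Y := X3 x y z *m invmx M0.
  have YE : X3 x y z = lsubmx Y *m T + rsubmx Y *m X3 e g h.
    by rewrite -mul_row_col hsubmxK -/M0 /Y mulmxKV.
  have -> : col_mx T (X3 x y z) = block_mx 1%:M 0 (lsubmx Y) (rsubmx Y) *m M0.
    by rewrite /M0 mul_block_col mul1mx mul0mx addr0 -YE.
  rewrite det_mulmx det_lblock det1 mul1r mulrC; congr (_ * _).
  rewrite det_mx33 /=.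
  have Ec i j : (rsubmx Y) i j =
      cr (if i == 0 :> nat then x else if i == 1%N :> nat then y else z) 0 j.
    by rewrite /cr -r3 -row_mul -/Y !mxE.
  by rewrite !Ec /= inordK.
have cM (i : 'I_3) : cr (if i == 0 :> nat then e else if i == 1%N :> nat then g else h)
    = delta_mx 0 i :> 'rV_3.
  rewrite /cr -r3.
  have -> : row i (X3 e g h) = row (rshift k i) M0.
    by apply/rowP => j; rewrite !mxE; case: splitP => l /=;
      [move=> El; have := ltn_ord l; lia
      | move=> /addnI El; rewrite (_ : i = l) ?mxE //; apply: val_inj].
  rewrite -row_mul mulmxV //; apply/rowP => j; rewrite !mxE.
  by rewrite eqxx /= (inj_eq (@rshift_inj _ _)) eq_sym.
exists (\det M0), c; split=> //; first (by move=> *; rewrite FC E); rewrite /c.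
- by have := cM 0; rewrite /= => ->; rewrite !mxE /= -!val_eqE /= inordK.
- by have := cM 1; rewrite /= => ->; rewrite !mxE /= -!val_eqE /= inordK.
- by have := cM (inord 2); rewrite /= inordK //= => ->; rewrite !mxE /= -!val_eqE /= inordK.
Qed.

Lemma rdet_last N (f : nat -> nat -> R) x :
  rdet N.+1 (fun i => if (i < N)%N then f i else x) =
  \sum_(m < N.+1) x m * rdet N.+1 (fun i => if (i < N)%N then f i else basis m).
Proof.
pose cof m := cofactor (\matrix_(i < N.+1, j < N.+1) (if (i < N)%N then f i j else 0)) ord_max m.
have E y : rdet N.+1 (fun i => if (i < N)%N then f i else y) = \sum_(m < N.+1) y m * cof m.
  rewrite /rdet (expand_det_row _ ord_max); apply: eq_bigr => m _.
  rewrite mxE /= ltnn; congr (_ * ((-1) ^+ _ * \det _)); apply/matrixP => i j.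
  by rewrite !mxE !lift_max ltn_ord.
rewrite E; apply: eq_bigr => m _; rewrite E (bigD1 m) //= big1.
  by rewrite /basis eqxx mul1r addr0.
by move=> j nj; rewrite /basis val_eqE (negbTE nj) mul0r.
Qed.

Lemma form_last k t x y z : form k t x y z =
  \sum_(m < k + 3) z m * form k t x y (basis m).
Proof.
have E w : form k t x y w = rdet (k.+2).+1 (fun i => if (i < k.+2)%N then
    (if (i < k)%N then t i else if i == k then x else y) else w).
  rewrite /form addn3; apply: eq_rdet => i j hi hj; rewrite /rows.
  case: ltnP => h; first by rewrite (leqW (leqW h)).
  case: eqP => h1; first by rewrite h1 leqW.
  by case: eqP => [->|h2]; [rewrite ltnSn | rewrite (_ : (i < k.+2)%N = false) //; lia].
rewrite E rdet_last addn3; apply: eq_bigr => m _.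
by rewrite E.
Qed.

(* Swapping rows is a special case of form_coord, except when all values
   involved vanish, where there is nothing to prove. *)
Lemma form_perm k t x y z :
  (form k t y x z = - form k t x y z) * (form k t x z y = - form k t x y z).
Proof.
have aux u v w : form k t u v w != 0 ->
    form k t v u w = - form k t u v w /\ form k t u w v = - form k t u v w.
  move=> /form_coord[w0 [c [_ E cu cv cw]]]; rewrite !E cu cv cw /det3 /=.
  by split; ring.
have [|n0] := eqVneq (form k t x y z) 0; last by have [-> ->] := aux _ _ _ n0.
move=> E; rewrite E oppr0; split; apply/eqP; apply: contraT => nz.
  have [H _] := aux _ _ _ nz; move: H nz; rewrite E => /esym/eqP.
  by rewrite oppr_eq0 => ->.
have [_ H] := aux _ _ _ nz; move: H nz; rewrite E => /esym/eqP.
by rewrite oppr_eq0 => ->.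
Qed.

End RowDeterminants.

(** * The exchange argument *)

Section SlopeKey.
Variable R : realType.
Implicit Types a b : R.

(* A monotone image in ]-1, 1] of the slope b / a, the vertical direction being
   the largest. *)
Definition slope_key a b : R := if a == 0 then 1 else (b / a) / (1 + `|b / a|).

Definition half_sign a b : R := if a == 0 then Num.sg b else Num.sg a.

Lemma squash_lt (p q : R) : (p / (1 + `|p|) < q / (1 + `|q|)) = (p < q).
Proof.
have P x : 0 < 1 + `|x| :> R by have := normr_ge0 x; lra.
rewrite ltr_pdivrMr ?P // mulrAC ltr_pdivlMr ?P //.
by case: (lerP 0 p) => hp; case: (lerP 0 q) => hq;
  rewrite ?(ger0_norm hp) ?(ltr0_norm hp) ?(ger0_norm hq) ?(ltr0_norm hq);
  apply/idP/idP; nra.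
Qed.

Lemma slope_key_lt a1 b1 a2 b2 : (a1, b1) != (0, 0) -> (a2, b2) != (0, 0) ->
  (slope_key a1 b1 < slope_key a2 b2) =
  (0 < half_sign a1 b1 * half_sign a2 b2 * (a1 * b2 - b1 * a2)).
Proof.
have lt1 q : q / (1 + `|q|) < 1 :> R.
  by rewrite ltr_pdivrMr; have := ler_norm q; have := normr_ge0 q; lra.
rewrite !xpair_eqE /slope_key /half_sign.
have [-> /= nb1|na1 _] := eqVneq a1 0; have [-> /= nb2|na2 _] := eqVneq a2 0.
- by rewrite ltxx !mulr0 mul0r subrr mulr0 ltxx.
- rewrite mul0r add0r; apply/idP/idP; first by have := lt1 (b2 / a2); lra.
  by case: (sgrP b1) nb1 => //; case: (sgrP a2) na2 => //; nra.
- rewrite lt1 mulr0 subr0; apply/esym.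
  by case: (sgrP b2) nb2 => //; case: (sgrP a1) na1 => //; nra.
rewrite squash_lt.
have -> : (b1 / a1 < b2 / a2) = (0 < a1 * a2 * (a1 * b2 - b1 * a2)).
  rewrite -subr_gt0 (_ : b2 / a2 - b1 / a1 = (a1 * a2) ^- 2 * (a1 * a2 * (a1 * b2 - b1 * a2))).
    by rewrite pmulr_rgt0 // invr_gt0 exprn_even_gt0 //= mulf_neq0.
  by field; rewrite na1 na2.
move: (a1 * b2 - b1 * a2) => c.
have -> : a1 * a2 * c = `|a1| * `|a2| * (Num.sg a1 * Num.sg a2 * c).
  by rewrite {1}(numEsg a1) {1}(numEsg a2); ring.
by rewrite pmulr_rgt0 // mulr_gt0 // normr_gt0.
Qed.

End SlopeKey.

Section Exchange.
Variables (R : realType) (nb : nat).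
Variables (w0 : R) (cx cy cz : nat -> R) (bx by_ bz : 'I_nb -> R).
Hypothesis w0n0 : w0 != 0.
Hypothesis spany : exists m, (bx m, by_ m, bz m) = (0, 1, 0).
Hypothesis spanz : exists m, (bx m, by_ m, bz m) = (0, 0, 1).

Let w i j m := w0 * det3 (cx i, cy i, cz i) (cx j, cy j, cz j) (bx m, by_ m, bz m).
Let D i j := w0 * (cy i * cz j - cz i * cy j).
Let A i j := \sum_m w i j m ^+ 2.
Let r i m := bz m * cy i - by_ m * cz i.
Let T i j k := w0 * det3 (cx i, cy i, cz i) (cx j, cy j, cz j) (cx k, cy k, cz k).

Lemma A_ge0 i j : 0 <= A i j.
Proof. by apply: sumr_ge0 => m _; apply: sqr_ge0. Qed.

Lemma A_sym i j : A i j = A j i.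
Proof. by apply: eq_bigr => m _; rewrite /w /det3 /=; ring. Qed.

Lemma D_anti i j : D i j = - D j i.
Proof. by rewrite /D; ring. Qed.

Lemma pluckerE i j k m : w i j m * D i k - w i k m * D i j = T i j k * (w0 * r i m).
Proof. by rewrite /w /D /T /r /det3 /=; ring. Qed.

Lemma A_eq0 i j : A i j = 0 -> D i j = 0 ->
  [/\ cx i * cy j = cy i * cx j, cx i * cz j = cz i * cx j
    & cy i * cz j = cz i * cy j].
Proof.
move=> /sumsq_eq0 H; have [m1 [e1 e2 e3]] := spany; have [m2 [f1 f2 f3]] := spanz.
rewrite /D; have := H m1; have := H m2.
rewrite /w e1 e2 e3 f1 f2 f3 /det3 /=.
do 3![move=> /eqP; rewrite mulf_eq0 (negbTE w0n0) /= => /eqP ?].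
by split; lra.
Qed.

Lemma line_convex i j k l : D i j != 0 -> D i k != 0 -> D i l != 0 ->
  (cy i, cz i) != (0, 0) -> T i j k * T i l k * (D i j * D i l) < 0 ->
  D i k ^+ 2 * A i j <= D i j ^+ 2 * A i k ->
  D i k ^+ 2 * A i l <= D i l ^+ 2 * A i k -> False.
Proof.
move=> nij nik nil ni TT.
pose Q := \sum_m (w0 * r i m) ^+ 2; pose P := \sum_m w i k m * (w0 * r i m).
have Q0 : 0 < Q.
  rewrite lt0r sumr_ge0 ?andbT => [|m _]; last exact: sqr_ge0.
  apply: contra ni => /eqP /sumsq_eq0 H; move: spany spanz => [m1 [_ e2 e3]] [m2 [_ f2 f3]].
  have := H m1; have := H m2; rewrite /r e2 e3 f2 f3.
  do 2![move=> /eqP; rewrite mulf_eq0 (negbTE w0n0) /= => /eqP ?].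
  by rewrite xpair_eqE; apply/andP; split; apply/eqP; lra.
have E x : D i k ^+ 2 * A i x = D i x ^+ 2 * A i k
    + (2 * (D i x * T i x k) * P + T i x k ^+ 2 * Q).
  rewrite /A /P /Q !mulr_sumr -!big_split /=; apply: eq_bigr => m _.
  have -> : D i k ^+ 2 * w i x m ^+ 2 = (w i x m * D i k - w i k m * D i x + w i k m * D i x) ^+ 2.
    by ring.
  by rewrite pluckerE; ring.
rewrite !E !gerDl => h1 h2.
have [n1 n2] : T i j k != 0 /\ T i l k != 0.
  by split; apply/eqP => t0; move: TT; rewrite t0 ?mul0r ?mulr0 ?mul0r ltxx.
have p1 : 0 < T i j k ^+ 2 * Q by rewrite pmulr_lgt0 // exprn_even_gt0.
have p2 : 0 < T i l k ^+ 2 * Q by rewrite pmulr_lgt0 // exprn_even_gt0.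
have u1 : (D i j * T i j k) * P < 0 by lra.
have u2 : (D i l * T i l k) * P < 0 by lra.
have : 0 < (D i j * T i j k) * P * ((D i l * T i l k) * P) by rewrite nmulr_rgt0.
have -> : (D i j * T i j k) * P * ((D i l * T i l k) * P) =
  T i j k * T i l k * (D i j * D i l) * P ^+ 2 by ring.
by have := sqr_ge0 P; nra.
Qed.

Let key i := slope_key (w0 * cz i) (- (w0 * cy i)).

Variable L : pred nat.
Hypothesis L_nz : forall i, L i -> (cy i, cz i) != (0, 0).
Variables i0 k0 : nat.
Hypotheses (Li0 : L i0) (Lk0 : L k0) (Dik : D i0 k0 != 0) (Aik : 0 < A i0 k0).
Hypothesis opt : forall x y, L x -> L y ->
  D i0 k0 ^+ 2 * A x y <= D x y ^+ 2 * A i0 k0.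

Let good x y := 0 < A x y /\ D x y ^+ 2 * A i0 k0 <= D i0 k0 ^+ 2 * A x y.

Let sg_ x := half_sign (w0 * cz x) (- (w0 * cy x)).

Lemma nz_scaled x : L x -> (w0 * cz x, - (w0 * cy x)) != (0, 0).
Proof.
move=> /L_nz; rewrite !xpair_eqE oppr_eq0 !mulf_eq0 (negbTE w0n0) /=.
by rewrite andbC.
Qed.

Lemma key_lt x y : L x -> L y ->
  (key x < key y) = (0 < sg_ x * sg_ y * (w0 * D x y)).
Proof.
move=> Lx Ly; rewrite /key slope_key_lt ?nz_scaled //; congr (0 < _ * _).
by rewrite /D; ring.
Qed.

Lemma key_eq x y : L x -> L y -> key x = key y -> D x y = 0.
Proof.
move=> Lx Ly E.
have := key_lt Ly Lx; have := key_lt Lx Ly; rewrite E ltxx => h1 h2.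
have sn z : L z -> sg_ z != 0.
  move=> /nz_scaled; rewrite /sg_ /half_sign xpair_eqE.
  by case: eqP => [_ /=|/eqP n _]; rewrite sgr_eq0.
have p2 : sg_ y * sg_ x * (w0 * D y x) = - (sg_ x * sg_ y * (w0 * D x y)).
  by rewrite (D_anti y x); ring.
rewrite p2 oppr_gt0 in h2.
apply: (mulfI w0n0); apply: (mulfI (mulf_neq0 (sn x Lx) (sn y Ly))).
by rewrite !mulr0; apply/eqP; rewrite eq_le !leNgt -h1 -h2.
Qed.

Lemma par_scale x y : L x -> L y -> key x = key y ->
  exists2 a, a != 0 & [/\ cx y = a * cx x, cy y = a * cy x & cz y = a * cz x].
Proof.
move=> Lx Ly E; have D0 := key_eq Lx Ly E.
have A0 : A x y = 0.
  have := opt Lx Ly; rewrite D0 expr0n mul0r pmulr_rle0 ?exprn_even_gt0 // => h.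
  by apply/eqP; rewrite eq_le h A_ge0.
have [h1 h2 h3] := A_eq0 A0 D0.
have := L_nz Lx; have := L_nz Ly; rewrite !xpair_eqE !negb_and.
have [y0|ny nyz _] := eqVneq (cy x) 0.
  move=> /= ny nz; exists (cz y / cz x); last first.
    split; last by rewrite divfK.
    - by apply: (mulfI nz); rewrite -h2; field.
    - by apply: (mulfI nz); rewrite -h3 y0; field.
  rewrite mulf_neq0 ?invr_eq0 //; apply: contraNneq nz => z0.
  move: h3; rewrite y0 mul0r => /esym/eqP; rewrite mulf_eq0 => /orP[//|].
  by move: ny; rewrite z0 eqxx orbF => /negbTE ->.
exists (cy y / cy x); last first.
  split; first by apply: (mulfI ny); rewrite -h1; field.
  - by rewrite divfK.
  - by apply: (mulfI ny); rewrite h3; field.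
rewrite mulf_neq0 ?invr_eq0 //; apply/eqP => y0; move: nyz; rewrite y0 eqxx /=.
by move: h3; rewrite y0 mulr0 => /eqP; rewrite mulf_eq0 (negbTE ny) /= => ->.
Qed.

Lemma good_scale x x' y : L x -> L x' -> key x = key x' -> good x y -> good x' y.
Proof.
move=> Lx Lx' E [A0 h]; have [a na [ex ey ez]] := par_scale Lx Lx' E.
have a2 : 0 < a ^+ 2 by rewrite exprn_even_gt0.
have EA : A x' y = a ^+ 2 * A x y.
  rewrite /A mulr_sumr; apply: eq_bigr => m _; rewrite /w ex ey ez /det3 /=; ring.
have ED : D x' y ^+ 2 = a ^+ 2 * D x y ^+ 2 by rewrite /D ey ez; ring.
split; rewrite EA; first by rewrite pmulr_rgt0.
by rewrite ED -mulrA [X in _ <= X]mulrCA ler_pM2l.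
Qed.

Lemma good_sym x y : good x y -> good y x.
Proof. by rewrite /good A_sym D_anti sqrrN. Qed.

Lemma good_T i j k : D i j != 0 -> D i k != 0 -> good i k -> T i j k = 0 -> good i j.
Proof.
move=> nij nik [A0 h] T0.
have E : D i k ^+ 2 * A i j = D i j ^+ 2 * A i k.
  rewrite /A !mulr_sumr; apply: eq_bigr => m _; have := pluckerE i j k m.
  rewrite T0 mul0r => /eqP; rewrite subr_eq0 => /eqP E.
  by rewrite -!exprMn mulrC E mulrC.
have p : 0 < D i k ^+ 2 by rewrite exprn_even_gt0.
have p' : 0 < D i j ^+ 2 by rewrite exprn_even_gt0.
split; first by rewrite -(pmulr_rgt0 _ p) E pmulr_rgt0.
by rewrite -(ler_pM2l p) [X in _ <= X]mulrCA E; nra.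
Qed.

(* If key i0 < key j < key k0 and l lies outside this range, then the dual line
   of j separates the one of i0 from the one of k0 on the other side than l
   does, and the vertex (i0, k0) is strictly inside a segment of vertices
   unless one of the lines passes through it. *)
Lemma exchange i j k l : key i0 < key k0 -> L i -> L j -> L k -> L l ->
  key i = key i0 -> key k = key k0 -> key i0 < key j <= key k0 ->
  (key k0 < key l) || (key l <= key i0) ->
  good i j \/ good k l.
Proof.
move=> ltik Li Lj Lk Ll Ei Ek /andP[ij jk] lout.
have g0 : good i0 k0 by split=> //; rewrite mulrC.
suff H : good i0 j \/ good k0 l.
  by case: H => H; [left; apply: (good_scale Li0)|right; apply: (good_scale Lk0)].
have neqD x y : L x -> L y -> key x < key y -> D x y != 0.
  by move=> Lx Ly; rewrite key_lt //; apply: contraTneq => ->; rewrite !mulr0 ltxx.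
have [jk' | njk] := eqVneq (key j) (key k0).
  left; apply: good_sym; apply: (good_scale Lk0) => //; exact: good_sym.
have [li | nl] := eqVneq (key l) (key i0).
  right; apply: good_sym; exact: (good_scale Li0).
have ltjk : key j < key k0 by rewrite lt_neqAle njk.
have {}lout : (key k0 < key l) || (key l < key i0).
  by rewrite [key l < _]lt_neqAle nl.
have Dij := neqD _ _ Li0 Lj ij.
have Djk := neqD _ _ Lj Lk0 ltjk.
have Dil : D i0 l != 0.
  case/orP: lout => h; first exact/neqD/(lt_trans ltik).
  by rewrite D_anti oppr_eq0 neqD.
have Dkl : D k0 l != 0.
  case/orP: lout => h; first exact/neqD.
  by rewrite D_anti oppr_eq0 neqD // (lt_trans h).
have sep : D i0 j * D j k0 * (D i0 l * D l k0) < 0.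
  have p1 := ij; have p2 := ltjk; rewrite !key_lt // in p1 p2.
  have := mulr_gt0 p1 p2.
  have -> : sg_ i0 * sg_ j * (w0 * D i0 j) * (sg_ j * sg_ k0 * (w0 * D j k0)) =
     (sg_ i0 * sg_ k0) * (D i0 j * D j k0) * (sg_ j * w0) ^+ 2 by ring.
  rewrite pmulr_lgt0; last first.
    rewrite exprn_even_gt0 //= mulf_neq0 //; apply: contraTneq p1 => ->.
    by rewrite mulr0 !mul0r ltxx.
  move=> q1.
  have : 0 < - (sg_ i0 * sg_ k0 * (D i0 l * D l k0)).
    case/orP: lout => h.
      have p3 := h; have p4 := lt_trans ltik h; rewrite !key_lt // in p3 p4.
      have := mulr_gt0 p3 p4; rewrite (D_anti l k0).
      have -> : sg_ k0 * sg_ l * (w0 * D k0 l) * (sg_ i0 * sg_ l * (w0 * D i0 l)) =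
        - (sg_ i0 * sg_ k0 * (D i0 l * - D k0 l)) * (sg_ l * w0) ^+ 2 by ring.
      rewrite pmulr_lgt0 // exprn_even_gt0 //= mulf_neq0 //.
      by apply: contraTneq p3 => ->; rewrite mulr0 !mul0r ltxx.
    have p3 := h; have p4 := lt_trans h ltik; rewrite !key_lt // in p3 p4.
    have := mulr_gt0 p3 p4; rewrite (D_anti l i0).
    have -> : sg_ l * sg_ i0 * (w0 * - D i0 l) * (sg_ l * sg_ k0 * (w0 * D l k0)) =
      - (sg_ i0 * sg_ k0 * (D i0 l * D l k0)) * (sg_ l * w0) ^+ 2 by ring.
    rewrite pmulr_lgt0 // exprn_even_gt0 //= mulf_neq0 //.
    by apply: contraTneq p3 => ->; rewrite !mul0r ltxx.
  move=> q2; have := mulr_gt0 q1 q2.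
  have -> : sg_ i0 * sg_ k0 * (D i0 j * D j k0) * - (sg_ i0 * sg_ k0 * (D i0 l * D l k0)) =
    - (D i0 j * D j k0 * (D i0 l * D l k0)) * (sg_ i0 * sg_ k0) ^+ 2 by ring.
  have : 0 <= (sg_ i0 * sg_ k0) ^+ 2 by apply: sqr_ge0.
  by nra.
have [T1|T1] := eqVneq (T i0 j k0) 0; first by left; apply: good_T g0 T1.
have Tkl : T k0 l i0 = - T i0 l k0 by rewrite /T /det3 /=; ring.
have Tkj : T k0 j i0 = - T i0 j k0 by rewrite /T /det3 /=; ring.
have Dki : D k0 i0 != 0 by rewrite D_anti oppr_eq0.
have [T2|T2] := eqVneq (T i0 l k0) 0.
  by right; apply: (good_T Dkl Dki (good_sym g0)); rewrite Tkl T2 oppr0.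
exfalso.
have side i' k' : L i' -> D k' i' ^+ 2 = D i0 k0 ^+ 2 -> A i' k' = A i0 k0 ->
    forall x, L x -> D i' k' ^+ 2 * A i' x <= D i' x ^+ 2 * A i' k'.
  by move=> Li' ED EA x Lx; rewrite EA D_anti sqrrN ED; apply: opt.
have [h|h] := ltP (T i0 j k0 * T i0 l k0 * (D i0 j * D i0 l)) 0.
  apply: (line_convex Dij Dik Dil (L_nz Li0) h); apply: side => //; by rewrite D_anti sqrrN.
have Dkj : D k0 j != 0 by rewrite D_anti oppr_eq0.
apply: (@line_convex k0 j i0 l) => //; first exact: L_nz; last 2 first.
- by apply: side => //; rewrite A_sym.
- by apply: side => //; rewrite A_sym.
rewrite Tkl Tkj (D_anti k0 j) (D_anti k0 l).
have TT : 0 < (T i0 j k0 * T i0 l k0) ^+ 2 by rewrite exprn_even_gt0 //= mulf_neq0.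
have : T i0 j k0 * T i0 l k0 * (D i0 j * D i0 l) *
    (- T i0 j k0 * - T i0 l k0 * (- D j k0 * - D l k0)) < 0.
  have -> : T i0 j k0 * T i0 l k0 * (D i0 j * D i0 l) *
    (- T i0 j k0 * - T i0 l k0 * (- D j k0 * - D l k0)) =
    (T i0 j k0 * T i0 l k0) ^+ 2 * (D i0 j * D j k0 * (D i0 l * D l k0)) by ring.
  by rewrite pmulr_rlt0.
rewrite (D_anti l k0) opprK.
by nra.
Qed.

End Exchange.

(** * Adjacent pairs in slope order *)

Section Candidates.
Variables (R : realType) (k : nat).
Implicit Types (V t : nat -> nat -> R) (s : nat -> nat).

(* hatv lifts v to (v, 1), so that a hyperplane becomes the zero set of a linear
   form; coef lists the coefficients of this form x |-> det (lifted points; x).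
   The squared distance from the origin is Off ^+ 2 / Asq, and Asq = 0 exactly
   when the points of the tuple span no hyperplane. *)
Definition hatv d (v : nat -> R) (c : nat) : R := if (c < d)%N then v c else 1.

Definition coef d V s (m : nat) : R :=
  rdet (d + 1) (fun i => if (i < d)%N then hatv d (V (s i)) else basis R m).

Definition Asq d V s : R := \sum_(m < d) coef d V s m ^+ 2.
Definition Off d V s : R := coef d V s d.

Definition adjacent (l : seq nat) (x y : nat) : Prop :=
  exists2 j, (j < size l)%N &
    x = nth 0%N l (if j == 0%N then (size l).-1 else j.-1) /\ y = nth 0%N l j.

Lemma adjacentS l j : (j.+1 < size l)%N -> adjacent l (nth 0%N l j) (nth 0%N l j.+1).
Proof. by move=> h; exists j.+1. Qed.

Definition tuple_of s x y (r : nat) : nat :=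
  if (r < k)%N then s r else if r == k then x else y.

Variable V : nat -> nat -> R.

Definition om s u v w : R := form k (fun i => hatv k.+2 (V (s i))) u v w.

Let hat i := hatv k.+2 (V i).
Let e : nat -> R := basis R k.+2.

Definition skey s g h i : R :=
  slope_key (om s (hat i) e (basis R g)) (om s (hat i) e (basis R h)).

Definition nzsum s i : R :=
  \sum_(m < k + 3) \sum_(m' < k + 3) om s (hat i) (basis R m) (basis R m') ^+ 2.

Lemma coef_om s m : coef k.+2 V s m = om s (hat (s k)) (hat (s k.+1)) (basis R m).
Proof.
rewrite /coef /om /form (_ : k.+2 + 1 = k + 3)%N; last by lia.
apply: eq_rdet => i j hi hj; rewrite /rows; case: (ltnP i k) => h1.
  by rewrite (leqW (leqW h1)).
have [->|n1] := eqVneq i k; first by rewrite leqW.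
have [->|n2] := eqVneq i k.+1; first by rewrite ltnSn.
by rewrite (_ : (i < k.+2)%N = false) //; lia.
Qed.

Lemma om_tuple s x y u v w : om (tuple_of s x y) u v w = om s u v w.
Proof.
by apply: eq_rdet => i j _ _; rewrite /rows /tuple_of; case: ltnP.
Qed.

Lemma coef_tuple s x y m :
  coef k.+2 V (tuple_of s x y) m = om s (hat x) (hat y) (basis R m).
Proof. by rewrite coef_om om_tuple /tuple_of ltnn eqxx ltnNge leqnSn /= gtn_eqF. Qed.

Lemma eq_coef d s s' m : (forall r, (r < d)%N -> s r = s' r) ->
  coef d V s m = coef d V s' m.
Proof. by move=> E; apply: eq_rdet => i j _ _; case: ltnP => // /E ->. Qed.

Lemma eq_Asq d s s' : (forall r, (r < d)%N -> s r = s' r) -> Asq d V s = Asq d V s'.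
Proof. by move=> E; apply: eq_bigr => m _; rewrite (eq_coef _ E). Qed.

Lemma eq_Off d s s' : (forall r, (r < d)%N -> s r = s' r) -> Off d V s = Off d V s'.
Proof. exact: eq_coef. Qed.

Section FixTuple.
Variable s : nat -> nat.
Local Notation om := (om s).
Implicit Types u v w : nat -> R.

Lemma om_swap12 u v w : om v u w = - om u v w.
Proof. exact: (form_perm _ _ u v w).1. Qed.

Lemma om_swap23 u v w : om u w v = - om u v w.
Proof. exact: (form_perm _ _ u v w).2. Qed.

Lemma om_basis3 u v w : om u v w != 0 ->
  exists2 m, (m < k + 3)%N & om u v (basis R m) != 0.
Proof.
move=> n0; apply: contrapT => H; move: n0; rewrite /Candidates.om form_last big1 ?eqxx // => m _.
have [E|n0] := eqVneq (om u v (basis R m)) 0; last by case: H; exists m.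
by move: E; rewrite /Candidates.om => ->; rewrite mulr0.
Qed.

Lemma om_basis23 u v w : om u v w != 0 ->
  exists m m', [/\ (m < k + 3)%N, (m' < k + 3)%N & om u (basis R m) (basis R m') != 0].
Proof.
move=> /om_basis3[m hm]; rewrite -oppr_eq0 -om_swap23 => /om_basis3[m' hm' n0].
by exists m, m'.
Qed.

Lemma nzsum_gt0 i u v : om (hat i) u v != 0 -> 0 < nzsum s i.
Proof.
move=> /om_basis23[m [m' [hm hm' n0]]].
rewrite /nzsum (bigD1 (Ordinal hm)) //= (bigD1 (Ordinal hm')) //=.
have S (P : pred 'I_(k + 3)) l : 0 <= \sum_(j | P j) om (hat i) (basis R l) (basis R j) ^+ 2.
  by apply: sumr_ge0 => *; apply: sqr_ge0.
have := S (fun j => j != Ordinal hm') m; set x := \sum_(_ | _) _.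
have : 0 <= \sum_(i0 < k + 3 | i0 != Ordinal hm)
   \sum_(m'0 < k + 3) om (hat i) (basis R i0) (basis R m'0) ^+ 2.
  by apply: sumr_ge0 => l _; apply: S.
have : 0 < om (hat i) (basis R m) (basis R m') ^+ 2 by rewrite exprn_even_gt0.
lra.
Qed.

Lemma nzsum_ex i : 0 < nzsum s i -> exists u v, om (hat i) u v != 0.
Proof.
move=> H; apply: contrapT => N; move: H; rewrite /nzsum big1 ?ltxx // => m _.
rewrite big1 // => m' _.
have [->|n0] := eqVneq (om (hat i) (basis R m) (basis R m')) 0; first by rewrite expr0n.
by case: N; exists (basis R m), (basis R m').
Qed.

Definition par u v : Prop := forall w, om u v w = 0.

Lemma par_refl u : par u u.
Proof. by move=> w; have := om_swap12 u u w; lra. Qed.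

Lemma par_sym u v : par u v -> par v u.
Proof. by move=> h w; rewrite om_swap12 h oppr0. Qed.

Lemma par_trans u v w : (exists a b, om v a b != 0) ->
  par u v -> par v w -> par u w.
Proof.
move=> [a [b nv]] uv vw z; apply/eqP; apply: contraT => n0.
have [w0 [c [w0n E cu cw cz]]] := form_coord n0.
have := uv w; have := uv z; have := vw z.
rewrite /Candidates.om !E cu cw cz /det3 /=.
do 3![move=> /eqP; rewrite mulf_eq0 (negbTE w0n) /= => /eqP ?].
move: nv; rewrite /Candidates.om E /det3.
have -> : (c v).1.1 = 0 by lra.
have -> : (c v).1.2 = 0 by lra.
have -> : (c v).2 = 0 by lra.
by rewrite !mul0r subrr addr0 mulr0 eqxx.
Qed.

End FixTuple.

Lemma between_ltn a b j m : (a < m -> b < m -> minn a b <= j < maxn a b -> j.+1 < m)%N.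
Proof. lia. Qed.

Lemma chain (P : nat -> nat -> Prop) a b : (a <= b)%N -> P a a ->
  (forall j, (a <= j < b)%N -> P a j -> P j j.+1 -> P a j.+1) ->
  ~ P a b -> exists2 j, (a <= j < b)%N & ~ P j j.+1.
Proof.
move=> ab Paa tr nab; apply: contrapT => H; apply: nab.
have K j : (a <= j < b)%N -> P j j.+1.
  by move=> hj; apply: contrapT => nj; apply: H; exists j.
elim: b ab tr K {H} => [|b IH] ab tr K; first by move: ab; rewrite leqn0 => /eqP <-.
move: ab; rewrite leq_eqVlt => /orP[/eqP <- //|ab].
have Pb : P a b.
  apply: IH => // j /andP[h1 h2]; [apply: tr | apply: K]; lia.
by apply: tr => //; [lia | apply: K; lia].
Qed.

Lemma sorted_threshold (key : nat -> R) l (th : R) :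
  sorted (fun x y => key x <= key y) l ->
  exists2 a, (a <= size l)%N &
    forall j, (j < size l)%N -> (key (nth 0%N l j) <= th) = (j < a)%N.
Proof.
move=> sl; exists (find (fun x => th < key x) l); first exact: find_size.
move=> j hj; case: ltnP => h.
  by have := before_find 0%N h => /negbT; rewrite -leNgt.
apply/negbTE; rewrite -ltNge.
have hs : has (fun x => th < key x) l by rewrite has_find; apply: leq_ltn_trans hj.
apply: lt_le_trans (nth_find 0%N hs) _.
have tr : transitive (fun x y => key x <= key y) by move=> y x z; apply: le_trans.
have := sorted_leq_nth tr (fun x => lexx (key x)) 0%N sl.
by apply; rewrite ?inE // -has_find.
Qed.

Section Optimal.
Variables (n : nat) (s : nat -> nat).
Local Notation om := (om s).
Hypothesis s_lt : forall r, (r < k.+2)%N -> (s r < n)%N.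
Hypothesis A_gt0 : 0 < Asq k.+2 V s.
Hypothesis s_opt : forall s', (forall r, (r < k.+2)%N -> (s' r < n)%N) ->
  Off k.+2 V s ^+ 2 * Asq k.+2 V s' <= Off k.+2 V s' ^+ 2 * Asq k.+2 V s.
Variable l : nat -> nat -> seq nat.
Hypothesis l_mem : forall g h i, (g < k + 3)%N -> (h < k + 3)%N ->
  (i \in l g h) = (i < n)%N && (0 < nzsum s i).
Hypothesis l_sorted : forall g h, (g < k + 3)%N -> (h < k + 3)%N ->
  sorted (fun x y => skey s g h x <= skey s g h y) (l g h).

Let A x y := Asq k.+2 V (tuple_of s x y).
Let D x y := Off k.+2 V (tuple_of s x y).
Let i0 := s k.
Let k0 := s k.+1.

Lemma AE x y : A x y = \sum_(m < k.+2) om (hat x) (hat y) (basis R m) ^+ 2.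
Proof. by apply: eq_bigr => m _; rewrite coef_tuple. Qed.

Lemma DE x y : D x y = om (hat x) (hat y) e.
Proof. exact: coef_tuple. Qed.

Lemma A0E : A i0 k0 = Asq k.+2 V s.
Proof. by rewrite AE; apply: eq_bigr => m _; rewrite coef_om. Qed.

Lemma D0E : D i0 k0 = Off k.+2 V s.
Proof. by rewrite DE /Off coef_om. Qed.

Lemma opt_pair x y : (x < n)%N -> (y < n)%N ->
  D i0 k0 ^+ 2 * A x y <= D x y ^+ 2 * A i0 k0.
Proof.
move=> hx hy; rewrite A0E D0E; apply: s_opt => r hr; rewrite /tuple_of.
by case: (ltnP r k) => _; [exact: s_lt | case: eqP].
Qed.

Definition conclusion : Prop := exists g h x y,
  [/\ (g < k + 3)%N, (h < k + 3)%N, adjacent (l g h) x y, 0 < A x y &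
      D x y ^+ 2 * A i0 k0 <= D i0 k0 ^+ 2 * A x y].

Lemma nonpar0 : ~ par s (hat i0) (hat k0).
Proof.
move=> H; have := A_gt0; rewrite -A0E AE big1 ?ltxx // => m _.
by rewrite H expr0n.
Qed.

Lemma nz_i0 : exists u v, om (hat i0) u v != 0.
Proof.
apply: contrapT => H; apply: nonpar0 => w; apply/eqP; apply: contraT => n0.
by case: H; exists (hat k0), w.
Qed.

Lemma nz_k0 : exists u v, om (hat k0) u v != 0.
Proof.
apply: contrapT => H; apply: nonpar0 => w; apply/eqP; apply: contraT => n0.
by case: H; exists (hat i0), w; rewrite om_swap12 oppr_eq0.
Qed.

Lemma mem_i0 g h : (g < k + 3)%N -> (h < k + 3)%N -> i0 \in l g h.
Proof.
move=> hg hh; rewrite l_mem // s_lt // /=.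
by have [u [v]] := nz_i0; apply: nzsum_gt0.
Qed.

Lemma mem_k0 g h : (g < k + 3)%N -> (h < k + 3)%N -> k0 \in l g h.
Proof.
move=> hg hh; rewrite l_mem // s_lt // /=.
by have [u [v]] := nz_k0; apply: nzsum_gt0.
Qed.

Lemma A_pos x y : ~ par s (hat x) (hat y) -> D x y = 0 -> 0 < A x y.
Proof.
move=> np D0; rewrite AE lt0r sumr_ge0 ?andbT => [|m _]; last exact: sqr_ge0.
apply: contra_notN np => /eqP /sumsq_eq0 H w; apply/eqP; apply: contraT.
move=> /om_basis3[m hm]; have [hm'|hm'] := ltnP m k.+2.
  by have := H (Ordinal hm') => /= ->; rewrite eqxx.
by rewrite (_ : m = k.+2) ?[om _ _ _](DE x y) ?D0 ?eqxx //; [rewrite -DE D0 eqxx | lia].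
Qed.

Lemma conclude_zero g h x y : (g < k + 3)%N -> (h < k + 3)%N -> D i0 k0 = 0 ->
  adjacent (l g h) x y -> ~ par s (hat x) (hat y) -> D x y = 0 -> conclusion.
Proof.
move=> hg hh D00 ad np D0; exists g, h, x, y; split=> //; first exact: A_pos.
by rewrite D0 D00 expr0n !mul0r.
Qed.

Lemma nth_nz g h j : (g < k + 3)%N -> (h < k + 3)%N -> (j < size (l g h))%N ->
  exists u v, om (hat (nth 0%N (l g h) j)) u v != 0.
Proof.
move=> hg hh hj; have := mem_nth 0%N hj; rewrite l_mem // => /andP[_].
exact: nzsum_ex.
Qed.

Lemma skey_mono g h i j : (g < k + 3)%N -> (h < k + 3)%N ->
  (j < size (l g h))%N -> (i <= j)%N ->
  skey s g h (nth 0%N (l g h) i) <= skey s g h (nth 0%N (l g h) j).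
Proof.
move=> hg hh hj hij.
have tr : transitive (fun x y => skey s g h x <= skey s g h y).
  by move=> y x z; apply: le_trans.
apply: (sorted_leq_nth tr (fun x => lexx (skey s g h x)) 0%N (l_sorted hg hh)) => //.
exact: leq_ltn_trans hj.
Qed.

(* par is transitive on the entries of the list because they are nonzero. *)
Lemma adjacent_nonpar g h a b : (g < k + 3)%N -> (h < k + 3)%N ->
  (a < size (l g h))%N -> (b < size (l g h))%N ->
  let p := nth 0%N (l g h) in ~ par s (hat (p a)) (hat (p b)) ->
  exists2 j, (minn a b <= j < maxn a b)%N & ~ par s (hat (p j)) (hat (p j.+1)).
Proof.
move=> hg hh ha hb p np.
apply: (@chain (fun j j' => par s (hat (p j)) (hat (p j')))) => //; first by lia.
- exact: par_refl.
- move=> j hj; apply: par_trans; apply: nth_nz => //; lia.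
rewrite /minn /maxn; case: ltnP => _ //.
by move=> /par_sym.
Qed.

Lemma null_case : (forall u v, om e u v = 0) -> conclusion.
Proof.
move=> H; have h0 : (0 < k + 3)%N by lia.
have Dz x y : D x y = 0 by rewrite DE om_swap23 om_swap12 H !oppr0.
have := mem_i0 h0 h0; have := mem_k0 h0 h0.
move=> /(nthP 0%N)[b hb Eb] /(nthP 0%N)[a ha Ea].
have [|j hj np] := @adjacent_nonpar 0 0 a b h0 h0 ha hb; first by rewrite Ea Eb; exact: nonpar0.
apply: (conclude_zero h0 h0 (Dz _ _) _ np (Dz _ _)).
exact/adjacentS/(between_ltn ha hb hj).
Qed.

Section Coordinates.
Variables g h : nat.
Hypotheses (hg : (g < k + 3)%N) (hh : (h < k + 3)%N).
Hypothesis ngh : om e (basis R g) (basis R h) != 0.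

Lemma axis_lt : (g < k.+2)%N && (h < k.+2)%N.
Proof.
have [w0 [c [_ _ ce cg ch]]] := form_coord ngh.
have ng : g != k.+2.
  by apply/eqP => Eg; move: cg; rewrite Eg -/e ce => -[] /eqP; rewrite oner_eq0.
have nh : h != k.+2.
  by apply/eqP => Eh; move: ch; rewrite Eh -/e ce => -[] /eqP; rewrite oner_eq0.
lia.
Qed.

Lemma coordinates : exists (w0 : R) (cx cy cz : nat -> R) (bx by_ bz : 'I_k.+2 -> R),
  [/\ w0 != 0, exists m, (bx m, by_ m, bz m) = (0, 1, 0),
      exists m, (bx m, by_ m, bz m) = (0, 0, 1)
    & [/\
      forall x y (m : 'I_k.+2), om (hat x) (hat y) (basis R m) =
        w0 * det3 (cx x, cy x, cz x) (cx y, cy y, cz y) (bx m, by_ m, bz m),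
      forall x y, D x y = w0 * (cy x * cz y - cz x * cy y),
      forall x, skey s g h x = slope_key (w0 * cz x) (- (w0 * cy x)),
      forall x, 0 < nzsum s x -> (cx x, cy x, cz x) != (0, 0, 0)
    & forall x, (cy x, cz x) = (0, 0) -> par s (hat x) e]].
Proof.
have [w0 [c [w0n E ce cg ch]]] := form_coord ngh; have /andP[lg lh] := axis_lt.
exists w0.
exists (fun x => (c (hat x)).1.1), (fun x => (c (hat x)).1.2), (fun x => (c (hat x)).2).
exists (fun m => (c (basis R m)).1.1), (fun m => (c (basis R m)).1.2), (fun m => (c (basis R m)).2).
split=> //; first by exists (Ordinal lg); rewrite cg.
  by exists (Ordinal lh); rewrite ch.
split.
- by move=> x y m; rewrite /Candidates.om E /det3.
- by move=> x y; rewrite DE /Candidates.om E ce /det3 /=; ring.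
- move=> x; rewrite /skey /Candidates.om !E.
  by rewrite ce cg ch /det3 /=; congr slope_key; ring.
- move=> x /nzsum_ex[u [v]]; apply: contraNneq; rewrite /Candidates.om E /det3.
  by move=> [-> -> ->]; rewrite !mul0r subrr addr0 mulr0.
- by move=> x [y0 z0] w; rewrite /Candidates.om E ce /det3 y0 z0 /=; ring.
Qed.

Lemma zero_case : D i0 k0 = 0 -> conclusion.
Proof.
move=> D00.
have := mem_i0 hg hh; have := mem_k0 hg hh.
move=> /(nthP 0%N)[b hb Eb] /(nthP 0%N)[a ha Ea].
set p := nth 0%N (l g h) in Ea Eb *.
have nze : exists u v, om e u v != 0 by exists (basis R g), (basis R h).
pose dg x := par s (hat x) e.
have [[j hj dj]|nodg] := pselect (exists2 j, (j < size (l g h))%N & dg (p j)).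
  (* A listed point lies in the span of the fixed points and the query point. *)
  have [c hc nc] : exists2 c, (c < size (l g h))%N & ~ dg (p c).
    have [da|] := pselect (dg (p a)); last by exists a.
    exists b => // db; apply: nonpar0; rewrite -Ea -Eb.
    by apply: par_trans da (par_sym db).
  have [||||q hq nq] := @chain (fun x y => dg (p x) <-> dg (p y)) (minn j c) (maxn j c).
  - by lia.
  - by [].
  - by move=> q hq; tauto.
  - by rewrite /minn /maxn; case: ltnP => _; tauto.
  have hq1 := between_ltn hj hc hq.
  have nz1 : exists u v, om (hat (p q)) u v != 0 by apply: nth_nz => //; lia.
  have nz2 : exists u v, om (hat (p q.+1)) u v != 0 by apply: nth_nz.
  apply: (conclude_zero hg hh D00 (adjacentS hq1)).
    move=> pq; apply: nq; split=> d1; last by apply: par_trans pq d1.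
    by apply: par_trans (par_sym pq) d1.
  have : dg (p q) \/ dg (p q.+1) by apply: contrapT; tauto.
  rewrite DE -/(p _) -/(p _) => -[d1|d1]; first by rewrite om_swap23 d1 oppr0.
  by rewrite om_swap12 om_swap23 d1 !oppr0.
have [w0 [cx [cy [cz [bx [by_ [bz [w0n sy sz [EW ED Ekey Enz Epar]]]]]]]]] := coordinates.
pose L x := x \in l g h.
have Lnz x : L x -> (cy x, cz x) != (0, 0).
  move=> /(nthP 0%N)[j hj Ej]; apply/eqP => /Epar H; apply: nodg; exists j => //.
  by rewrite /dg /p Ej.
have Lp j : (j < size (l g h))%N -> L (p j) by move=> hj; apply: mem_nth.
have klt x y : L x -> L y -> skey s g h x < skey s g h y -> D x y != 0.
  move=> Lx Ly; rewrite !Ekey (key_lt w0n Lnz Lx Ly) -ED.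
  by apply: contraTneq => ->; rewrite !mulr0 ltxx.
have keq x y : L x -> L y -> skey s g h x = skey s g h y -> D x y = 0.
  by move=> Lx Ly; rewrite !Ekey ED; apply: (key_eq w0n Lnz Lx Ly).
have Li : L i0 by rewrite -Ea; apply: Lp.
have Lk : L k0 by rewrite -Eb; apply: Lp.
have Dki : D k0 i0 = 0 by rewrite DE om_swap12 -DE D00 oppr0.
have Eik : skey s g h i0 = skey s g h k0.
  case: (ltgtP (skey s g h i0) (skey s g h k0)) => // H.
    by move: (klt _ _ Li Lk H); rewrite D00 eqxx.
  by move: (klt _ _ Lk Li H); rewrite Dki eqxx.
have mono i j := @skey_mono g h i j hg hh.
have [|j hj np] := adjacent_nonpar hg hh ha hb; first by rewrite -/p Ea Eb; exact: nonpar0.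
have hj1 := between_ltn ha hb hj.
have hmax : (maxn a b < size (l g h))%N by rewrite gtn_max ha hb.
have hmin : (minn a b < size (l g h))%N by rewrite gtn_min ha.
have kj q : (minn a b <= q <= maxn a b)%N -> skey s g h (p q) = skey s g h i0.
  move=> hq; apply/eqP; rewrite eq_le; apply/andP; split.
    apply: (@le_trans _ _ (skey s g h (p (maxn a b)))).
      by apply: mono => //; case/andP: hq.
    by rewrite /maxn; case: ltnP => _; rewrite ?Ea ?Eb ?Eik.
  apply: (@le_trans _ _ (skey s g h (p (minn a b)))).
    by rewrite /minn; case: ltnP => _; rewrite ?Ea ?Eb ?Eik.
  by case/andP: hq => h1 h2; apply: mono => //; apply: leq_ltn_trans hmax.
apply: (conclude_zero hg hh D00 (adjacentS hj1) np).
by apply: keq; rewrite ?Lp ?kj //; lia.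
Qed.

Lemma nonzero_case : D i0 k0 != 0 -> conclusion.
Proof.
move=> D0.
have [w0 [cx [cy [cz [bx [by_ [bz [w0n sy sz [EW ED Ekey Enz Epar]]]]]]]]] := coordinates.
pose L x := x \in l g h.
have EA x y : A x y = \sum_m (w0 * det3 (cx x, cy x, cz x) (cx y, cy y, cz y)
    (bx m, by_ m, bz m)) ^+ 2.
  by rewrite AE; apply: eq_bigr => m _; rewrite EW.
have Aik : 0 < A i0 k0 by rewrite A0E.
have Ln x : L x -> (x < n)%N by rewrite /L l_mem // => /andP[].
have Li : L i0 by apply: mem_i0.
have Lk : L k0 by apply: mem_k0.
have A0 x y : L x -> L y -> D x y = 0 -> A x y = 0.
  move=> Lx Ly Dxy; have := opt_pair (Ln x Lx) (Ln y Ly).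
  rewrite Dxy expr0n mul0r pmulr_rle0 ?exprn_even_gt0 // => H.
  by apply/eqP; rewrite eq_le H AE sumr_ge0 // => m _; apply: sqr_ge0.
have Lnz x : L x -> (cy x, cz x) != (0, 0).
  move=> Lx; apply/eqP => yz.
  have nx : cx x != 0.
    have /andP[_ /Enz] : (x < n)%N && (0 < nzsum s x) by rewrite -(l_mem x hg hh).
    by apply: contraNneq => x0; move: yz => [-> ->]; rewrite x0.
  have z0 y : L y -> (cy y, cz y) = (0, 0).
    move=> Ly; have Dxy : D x y = 0 by move: yz => [y0 z0]; rewrite ED y0 z0; ring.
    have := A0 x y Lx Ly Dxy; rewrite EA => HA.
    have := A_eq0 w0n sy sz HA; rewrite -ED => /(_ Dxy) [h1 h2 _].
    move: yz h1 h2 => [-> ->] /eqP; rewrite mul0r mulf_eq0 (negbTE nx) => /eqP ->.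
    by move=> /eqP; rewrite mulf_eq0 (negbTE nx) => /eqP ->.
  by move: D0; rewrite ED; move: (z0 _ Li) => [-> ->]; rewrite !mul0r subrr mulr0 eqxx.
have mono i j := @skey_mono g h i j hg hh.
have monoL := fun th => @sorted_threshold _ _ th (l_sorted hg hh).
have main i1 k1 : L i1 -> L k1 -> D i1 k1 != 0 -> 0 < A i1 k1 ->
    (forall x y, L x -> L y -> D i1 k1 ^+ 2 * A x y <= D x y ^+ 2 * A i1 k1) ->
    skey s g h i1 < skey s g h k1 ->
    exists x y, [/\ adjacent (l g h) x y, 0 < A x y &
      D x y ^+ 2 * A i1 k1 <= D i1 k1 ^+ 2 * A x y].
  move=> Li1 Lk1 D1 A1 opt1 ltik.
  have /(nthP 0%N)[pi hpi Epi] := Li1; have /(nthP 0%N)[pk hpk Epk] := Lk1.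
  have [a ha Ha] := monoL (skey s g h i1); have [b hb Hb] := monoL (skey s g h k1).
  set p := nth 0%N (l g h) in Epi Epk Ha Hb mono *.
  have pia : (pi < a)%N by rewrite -Ha // Epi.
  have apk : (a <= pk)%N by rewrite leqNgt -Ha // Epk -ltNge.
  have pkb : (pk < b)%N by rewrite -Hb // Epk.
  have hL j : (j < size (l g h))%N -> L (p j) by move=> ?; apply: mem_nth.
  pose l' := if (b < size (l g h))%N then b else 0%N.
  have hl' : (l' < size (l g h))%N.
    by rewrite /l'; case: ifP => // _; exact: leq_ltn_trans hpk.
  have a0 : (0 < a)%N by exact: leq_ltn_trans pia.
  have b0 : (0 < b)%N by exact: leq_ltn_trans pkb.
  have pa : (a.-1 < a)%N by rewrite prednK.
  have pb : (b.-1 < b)%N by rewrite prednK.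
  have sa : (a < size (l g h))%N by exact: leq_ltn_trans hpk.
  have sa1 : (a.-1 < size (l g h))%N by exact: ltn_trans sa.
  have sb1 : (b.-1 < size (l g h))%N by exact: leq_trans hb.
  have [|H|H] : [\/ False,
      0 < A (p a.-1) (p a) /\ D (p a.-1) (p a) ^+ 2 * A i1 k1 <= D i1 k1 ^+ 2 * A (p a.-1) (p a)
    | 0 < A (p b.-1) (p l') /\ D (p b.-1) (p l') ^+ 2 * A i1 k1 <= D i1 k1 ^+ 2 * A (p b.-1) (p l')].
  - have Ei : skey s g h (p a.-1) = skey s g h i1.
      apply/eqP; rewrite eq_le Ha // pa -Epi.
      by apply: mono => //; rewrite -ltnS prednK.
    have Ek : skey s g h (p b.-1) = skey s g h k1.
      apply/eqP; rewrite eq_le Hb // pb -Epk.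
      by apply: mono => //; rewrite -ltnS prednK.
    have Ej : skey s g h i1 < skey s g h (p a) <= skey s g h k1.
      by rewrite ltNge Ha // ltnn /= -Epk; apply: mono.
    have El : (skey s g h k1 < skey s g h (p l')) || (skey s g h (p l') <= skey s g h i1).
      rewrite /l'; case: (ltnP b (size (l g h))) => h1.
        by rewrite ltNge Hb ?ltnn.
      by apply/orP; right; rewrite -Epi; apply: mono.
    rewrite !Ekey in ltik Ei Ek Ej El.
    rewrite !ED !EA.
    have := @exchange R k.+2 w0 cx cy cz bx by_ bz w0n sy sz L Lnz i1 k1 Li1 Lk1.
    rewrite -ED -EA => /(_ D1 A1).
    have X x y : L x -> L y -> D i1 k1 ^+ 2 *
      \sum_m (w0 * det3 (cx x, cy x, cz x) (cx y, cy y, cz y) (bx m, by_ m, bz m)) ^+ 2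
       <= (w0 * (cy x * cz y - cz x * cy y)) ^+ 2 * A i1 k1.
      by rewrite -EA -ED; apply: opt1.
    have La := hL _ sa1; have La' := hL _ sa; have Lb := hL _ sb1.
    move=> /(_ X (p a.-1) (p a) (p b.-1) (p l') ltik La La' Lb (hL _ hl') Ei Ek Ej El).
    by case=> H; [apply: Or32 | apply: Or33].
  - by [].
  - exists (p a.-1), (p a); case: H => H1 H2; split=> //.
    by exists a => //; rewrite eqn0Ngt a0.
  - exists (p b.-1), (p l'); case: H => H1 H2; split=> //.
    exists l' => //; split=> //; rewrite /l'; case: ltnP => h1.
      by rewrite eqn0Ngt b0.
    by rewrite eqxx; congr (p _.-1); apply/eqP; rewrite eqn_leq hb.
have Dsym x y : D y x ^+ 2 = D x y ^+ 2 by rewrite !DE om_swap12 sqrrN.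
have Asym x y : A y x = A x y.
  by rewrite !AE; apply: eq_bigr => m _; rewrite om_swap12 sqrrN.
have opt1 x y : L x -> L y -> D i0 k0 ^+ 2 * A x y <= D x y ^+ 2 * A i0 k0.
  by move=> /Ln hx /Ln hy; apply: opt_pair.
case: (ltgtP (skey s g h i0) (skey s g h k0)) => H.
- have [x [y [h1 h2 h3]]] := main _ _ Li Lk D0 Aik opt1 H.
  by exists g, h, x, y.
- have [|||x [y [h1 h2 h3]]] := main _ _ Lk Li _ _ _ H.
  + by rewrite -sqrf_eq0 (Dsym i0 k0) sqrf_eq0.
  + by rewrite (Asym i0 k0).
  + by move=> x y Lx Ly; rewrite (Dsym i0 k0) (Asym i0 k0); apply: opt1.
  + by exists g, h, x, y; split=> //; rewrite -(Asym i0 k0) -(Dsym i0 k0).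
- move: D0; rewrite ED; move: H; rewrite !Ekey => H.
  by rewrite (key_eq w0n Lnz Li Lk H) eqxx.
Qed.

End Coordinates.

Lemma candidates_suffice : conclusion.
Proof.
have [[u [v n0]]|H] := pselect (exists u v, om e u v != 0).
  have [g [h [hg hh ngh]]] := om_basis23 n0.
  have [D0|D0] := eqVneq (D i0 k0) 0; first exact: zero_case hg hh ngh D0.
  exact: nonzero_case hg hh ngh D0.
apply: null_case => u v; apply/eqP; apply: contraT => n0; case: H.
by exists u, v.
Qed.

End Optimal.
End Candidates.

Section Optimum.
Variables (R : realType) (d n : nat) (V : nat -> nat -> R).

Definition in_range (s : nat -> nat) : Prop := forall r, (r < d)%N -> (s r < n)%N.

Definition optimal (s : nat -> nat) : Prop := [/\ in_range s, 0 < Asq d V s &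
  forall s', in_range s' -> Off d V s ^+ 2 * Asq d V s' <= Off d V s' ^+ 2 * Asq d V s].

Lemma Asq_ge0 s : 0 <= Asq d V s.
Proof. by apply: sumr_ge0 => *; apply: sqr_ge0. Qed.

Lemma optimal_exists s : in_range s -> 0 < Asq d V s -> exists s0, optimal s0.
Proof.
move=> rs As.
pose ext (f : {ffun 'I_d -> 'I_n}) r : nat := oapp (fun i => val (f i)) 0%N (insub r).
have extr f : in_range (ext f).
  by move=> r hr; rewrite /ext insubT /=.
have surj s' : in_range s' -> exists f, forall r, (r < d)%N -> ext f r = s' r.
  move=> rs'; exists [ffun i : 'I_d => Ordinal (rs' _ (ltn_ord i))] => r hr.
  by rewrite /ext insubT /= ffunE.
have [f0 E0] := surj s rs.
have A0 : 0 < Asq d V (ext f0) by rewrite (eq_Asq V E0).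
pose F f := Off d V (ext f) ^+ 2 / Asq d V (ext f).
case: (@Order.TotalTheory.arg_minP _ _ _ f0 (fun f => 0 < Asq d V (ext f)) F A0).
move=> f Af fmin; exists (ext f); split=> // s' rs'.
have [f' E'] := surj s' rs'; rewrite -(eq_Asq V E') -(eq_Off V E').
have := Asq_ge0 (ext f'); rewrite le_eqVlt => /orP[/eqP <-|A'].
  by rewrite mulr0 mulr_ge0 ?sqr_ge0 // ltW.
have := fmin _ A'; rewrite /F ler_pdivrMr // mulrAC ler_pdivlMr //.
Qed.

(* bA and bD are the normalizing factor and the squared offset of the best
   candidate b so far; (0, 1) stands for the absence of a candidate. *)
Definition best (C : (nat -> nat) -> Prop) (b : nat -> nat) (bA bD : R) : Prop :=
  (bA = 0 /\ bD = 1 \/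
   [/\ in_range b, 0 < bA, bA = Asq d V b & bD = Off d V b ^+ 2])
  /\ forall s, C s -> bD * Asq d V s <= Off d V s ^+ 2 * bA.

Lemma best_optimal C b bA bD s : best C b bA bD -> in_range s -> 0 < Asq d V s ->
  (forall s0, optimal s0 -> exists2 s', C s' & 0 < Asq d V s' /\
     Off d V s' ^+ 2 * Asq d V s0 <= Off d V s0 ^+ 2 * Asq d V s') ->
  optimal b.
Proof.
move=> [Hb HC] rs As H; have [s0 o0] := optimal_exists rs As.
have [s' Cs' [A' h']] := H _ o0; have h1 := HC _ Cs'.
have [r0 A0 h0] := o0.
case: Hb => [[bA0 bD1]|[rb bA_gt0 EA ED]].
  by move: h1; rewrite bA0 bD1 mulr0 mul1r leNgt A'.
split=> // [|s2 rs2]; first by rewrite -EA.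
rewrite -EA -ED.
have h2 : bD * Asq d V s0 <= Off d V s0 ^+ 2 * bA.
  rewrite -(ler_pM2r A') mulrAC (le_trans (ler_wpM2r (ltW A0) h1)) //.
  by rewrite mulrAC [X in _ <= X]mulrAC; apply: ler_wpM2r => //; apply: ltW.
have h3 := h0 _ rs2.
rewrite -(ler_pM2r A0) mulrAC (le_trans (ler_wpM2r (Asq_ge0 s2) h2)) //.
by rewrite mulrAC [X in _ <= X]mulrAC; apply: ler_wpM2r => //; apply: ltW.
Qed.

End Optimum.

Section Bridge.
Variables (R : realType) (d n : nat) (p : 'I_n -> 'rV[R]_d) (y : 'rV[R]_d).
Variable V : nat -> nat -> R.
Hypothesis VE : forall (i : 'I_n) (c : 'I_d), V i c = p i 0 c - y 0 c.
Hypothesis d_gt0 : (0 < d)%N.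
Implicit Types s : 'I_d -> 'I_n.

Lemma plane_coefE s (s' : nat -> nat) m : (forall i : 'I_d, s' i = s i) ->
  plane_coef (p \o s) y m = coef d V s' m.
Proof.
move=> E; congr (\det _); apply/matrixP => i j.
case: (split_ordP i) => l ->.
  rewrite col_mxEu hatmxE [RHS]mxE /= ltn_ord E.
  case: (split_ordP j) => c ->.
    by rewrite hatl /hatv /= ltn_ord VE.
  by rewrite hatr /hatv /= ltnNge leq_addr.
by rewrite col_mxEd !mxE /= ltnNge leq_addr /= (ord1 l) eqxx.
Qed.

Lemma normal_sqE s (s' : nat -> nat) : (forall i : 'I_d, s' i = s i) ->
  normal_sq (p \o s) y = Asq d V s'.
Proof. by move=> E; apply: eq_bigr => m _; rewrite (plane_coefE _ E). Qed.

Lemma offsetE s (s' : nat -> nat) : (forall i : 'I_d, s' i = s i) ->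
  offset (p \o s) y = Off d V s'.
Proof. by move=> E; rewrite /offset (plane_coefE _ E) /= addn0. Qed.

Lemma induces_Asq s (s' : nat -> nat) : (forall i : 'I_d, s' i = s i) ->
  induces_hyperplane p s <-> 0 < Asq d V s'.
Proof.
move=> E; split=> [[_ /(hyperplane_normal y d_gt0)]|]; rewrite -(normal_sqE E) //.
move=> A0; split; last exact: normal_hyperplane A0.
move=> i j Eij; apply/eqP; apply: contraLR A0 => nij.
rewrite -leNgt /normal_sq big1 // => m _; rewrite /plane_coef /plane_form.
rewrite (@determinant_alternate _ _ _ (lshift 1 i) (lshift 1 j)) ?expr0n //.
by move=> c; rewrite !col_mxEu !hatmxE /= Eij.
Qed.

Lemma optimal_nearest s (s' : nat -> nat) : (forall i : 'I_d, s' i = s i) ->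
  optimal d n V s' -> nearest_induced_hyperplane p y s.
Proof.
move=> E [_ A0 opt]; split=> [|s2 H2]; first exact/(induces_Asq E).
pose s2' r : nat := oapp (fun i => val (s2 i)) 0%N (insub r).
have E2 (i : 'I_d) : s2' i = s2 i by rewrite /s2' valK.
have A2 : 0 < Asq d V s2' by apply/(induces_Asq E2).
rewrite !dist_hull ?(normal_sqE E) ?(normal_sqE E2) //.
rewrite (offsetE E) (offsetE E2) ler_wsqrtr // ler_pdivrMr // mulrAC ler_pdivlMr //.
by apply: opt => r hr; rewrite -[r]/(val (Ordinal hr)) E2.
Qed.

End Bridge.

(** * Evaluating a tuple *)

Fixpoint eSum (es : seq expr) : expr := if es is e :: es' then EAdd e (eSum es') else EInt 0.
Fixpoint eProd (es : seq expr) : expr := if es is e :: es' then EMul e (eProd es') else EInt 1.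

Definition eSq e := EMul e e.

Definition eDet N (M : nat -> nat -> expr) : expr :=
  eSum [seq EMul (EInt ((-1) ^+ odd_perm s)) (eProd [seq M i (s i) | i : 'I_N <- enum 'I_N])
       | s <- enum {perm 'I_N}].

(* Register allocation.  Naturals: 0 holds n, 1 the constant 1, 2 an address,
   [ix r] and [bx r] the r-th index of the current and of the best tuple; [ix d]
   is always n, so that slot d is the query point.  Reals: 0 and 1 hold the data of the
   best tuple, [xr d r c] the c-th coordinate of the point in slot r. *)
Definition ix r := (20 + r.*2)%N.
Definition bx r := (21 + r.*2)%N.
Definition xr d r c := (9 + (r * d + c))%N.

Definition hseqs (cs : seq hcom) : hcom := foldr HSeq HSkip cs.

Definition hmov i j := HSeq (HConst i 0) (HAdd i i j).

Definition load1 d r c : hcom :=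
  HSeq (HConst 2 c) (HSeq (iter d (HSeq (HAdd 2 2 (ix r))) HSkip) (HIn (xr d r c) 2)).

Definition load d : hcom :=
  hseqs [seq load1 d rc.1 rc.2 | rc <- [seq (r, c) | r <- iota 0 d.+1, c <- iota 0 d]].

Definition ehat d r c : expr :=
  if (c < d)%N then ESub (EVar (xr d r c)) (EVar (xr d d c)) else EInt 1.
Definition ebas (m c : nat) : expr := EInt ((c == m)%:R).

Definition eCoef d m : expr :=
  eDet (d + 1) (fun i => if (i < d)%N then ehat d i else ebas m).
Definition eAsq d : expr := eSum [seq eSq (eCoef d m) | m <- iota 0 d].

Definition eOm k (u v w : nat -> expr) : expr :=
  eDet (k + 3) (fun i => if (i < k)%N then ehat k.+2 i
                         else if i == k then u else if i == k.+1 then v else w).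
Definition eNz k : expr := eSum [seq
  eSum [seq eSq (eOm k (ehat k.+2 k) (ebas m) (ebas m')) | m' <- iota 0 (k + 3)]
  | m <- iota 0 (k + 3)].
Definition eAlpha k g : expr := eOm k (ehat k.+2 k) (ebas k.+2) (ebas g).

Definition save_best d : hcom :=
  HSeq (HExp 0 (EVar 2)) (HSeq (HExp 1 (EVar 3))
    (hseqs [seq hmov (bx r) (ix r) | r <- iota 0 d])).

Definition try_tuple d : hcom :=
  HSeq (load d) (HSeq (HExp 2 (eAsq d)) (HSeq (HExp 3 (eSq (eCoef d d)))
    (HSeq (HExp 4 (EMul (EVar 3) (EVar 0))) (HSeq (HExp 5 (EMul (EVar 1) (EVar 2)))
      (HIf (XLt 4 5) (save_best d) HSkip))))).

Definition point_to k u : hcom := HSeq (hmov (ix k) u) (load k.+2).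

Definition key_code k g h u dst : hcom :=
  HSeq (point_to k u) (HSeq (HExp 4 (eAlpha k g)) (HSeq (HExp 5 (eAlpha k h))
   (HSeq (HExp 8 (EDiv (EVar 5) (EVar 4))) (HSeq (HExp 4 (eSq (EVar 4)))
    (HSeq (HExp 5 (EInt 0)) (HSeq (HExp dst (EInt 1))
     (HIf (XLt 5 4)
       (HIf (XLt 8 5) (HExp dst (EDiv (EVar 8) (ESub (EInt 1) (EVar 8))))
                      (HExp dst (EDiv (EVar 8) (EAdd (EInt 1) (EVar 8)))))
       HSkip))))))).

Arguments load1 : simpl never.
Arguments load : simpl never.
Arguments eDet : simpl never.
Arguments try_tuple : simpl never.
Arguments point_to : simpl never.
Arguments key_code : simpl never.
Arguments ix : simpl never.
Arguments bx : simpl never.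
Arguments xr : simpl never.

Lemma iota0S m : iota 0 m.+1 = rcons (iota 0 m) m.
Proof. by rewrite -addn1 iotaD cats1. Qed.

Lemma neq_ix j r : (j < 20)%N -> (j == ix r) = false.
Proof. by rewrite /ix; lia. Qed.

Section Blocks.
Variables (R : realType) (inp : nat -> R).
Notation hst := (hst R).
Implicit Type st : hst.
Local Notation ev := (@eval R).
Local Notation hexec := (hexec inp).

(* Rewriting with these two equations is much cheaper for the kernel than
   computing hexec on large programs. *)
Lemma hexec_seq c1 c2 st : hexec (HSeq c1 c2) st = hexec c2 (hexec c1 st).
Proof. by []. Qed.

Lemma hexec_if b c1 c2 st : hexec (HIf b c1 c2) st =
  if test_holds b (nv st) (xv st) then hexec c1 st else hexec c2 st.
Proof. by []. Qed.

Lemma eval_eSum X es : ev X (eSum es) = \sum_(e <- es) ev X e.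
Proof. by elim: es => [|e es IH] /=; rewrite ?big_nil // big_cons IH. Qed.

Lemma eval_eProd X es : ev X (eProd es) = \prod_(e <- es) ev X e.
Proof. by elim: es => [|e es IH] /=; rewrite ?big_nil // big_cons IH. Qed.

Lemma eval_eDet X N M : ev X (eDet N M) = rdet N (fun i j => ev X (M i j)).
Proof.
rewrite eval_eSum big_map big_enum /=; apply: eq_bigr => s _ /=.
rewrite eval_eProd big_map big_enum /=; congr (_ * _).
  by rewrite rmorphXn rmorphN1.
by apply: eq_bigr => i _; rewrite mxE.
Qed.

Lemma hexec_hseqs cs st : hexec (hseqs cs) st = foldl (fun s c => hexec c s) st cs.
Proof. by elim: cs st => //= c cs IH st; rewrite IH. Qed.

Lemma loopfree_hseqs T (f : T -> hcom) (l : seq T) : (forall x, loopfree (f x)) ->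
  loopfree (hseqs [seq f x | x <- l]).
Proof. by move=> H; elim: l => //= x l ->; rewrite H. Qed.

Variables d n : nat.

Definition pt i c : R := inp (c + d * i)%N - inp (c + d * n)%N.

Definition idx st r : nat := nv st (ix r).

Definition loaded st : Prop := forall r c, (r <= d)%N -> (c < d)%N ->
  xv st (xr d r c) = inp (c + d * nv st (ix r))%N.

Lemma loopfree_load : loopfree (load d).
Proof.
by apply: loopfree_hseqs => rc; rewrite /load1 /= andbT; elim: d.
Qed.

Lemma load1_spec st r c : hexec (load1 d r c) st =
  HS (upd (nv st) 2 (c + d * nv st (ix r))%N)
     (upd (xv st) (xr d r c) (inp (c + d * nv st (ix r))%N)) (ar st).
Proof.
have E m s : hexec (iter m (HSeq (HAdd 2 2 (ix r))) HSkip) s =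
    HS (if m == 0%N then nv s else upd (nv s) 2 (nv s 2 + m * nv s (ix r))%N) (xv s) (ar s).
  elim: m s => [|m IH] s; first by case: s.
  rewrite iterS [LHS]/= IH /=; congr HS.
  apply/funext => i; rewrite /upd /=; case: m {IH} => [|m] /=; rewrite ?mul1n //.
  by case: eqP => // _; lia.
rewrite /load1 /= E /=; congr HS.
  apply/funext => i; rewrite /upd; case: (d) => [|d'] /=; last by case: eqP.
  by rewrite addn0.
by rewrite /upd; case: (d) => [|d'] //=; rewrite addn0.
Qed.

Lemma xr_inj r c r' c' : (c < d)%N -> (c' < d)%N -> xr d r c = xr d r' c' ->
  r = r' /\ c = c'.
Proof.
move=> hc hc' /eqP; rewrite /xr eqn_add2l => /eqP E.
have d0 : (0 < d)%N by apply: leq_ltn_trans hc.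
split.
  by have := congr1 (divn^~ d) E; rewrite !divnMDl // !divn_small // !addn0.
by have := congr1 (modn^~ d) E; rewrite !modnMDl !modn_small.
Qed.

Lemma load_spec st : let st' := hexec (load d) st in
  [/\ loaded st', forall i, i != 2%N -> nv st' i = nv st i, ar st' = ar st
    & forall i, (i < 9)%N -> xv st' i = xv st i].
Proof.
move=> st'; rewrite {}/st' /load hexec_hseqs.
pose val (rc : nat * nat) : R := inp (rc.2 + d * nv st (ix rc.1))%N.
pose ok (rc : nat * nat) := (rc.2 < d)%N.
set ps := [seq (r, c) | r <- iota 0 d.+1, c <- iota 0 d].
have okps : all ok ps.
  by apply/allP => rc /allpairsP[[r c] [_ /= hc ->]]; move: hc; rewrite mem_iota.
have H : forall s, (forall i, i != 2%N -> nv s i = nv st i) ->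
  let s' := foldl (fun s c => hexec c s) s [seq load1 d rc.1 rc.2 | rc <- ps] in
  [/\ forall rc, ok rc -> (rc \in ps) || (xv s (xr d rc.1 rc.2) == val rc) ->
        xv s' (xr d rc.1 rc.2) = val rc,
      forall i, i != 2%N -> nv s' i = nv st i, ar s' = ar s
    & forall i, (i < 9)%N -> xv s' i = xv s i].
  elim: ps okps => [_|p ps IH okpps] s Hs; first by split=> // rc _ /eqP.
  have /andP[okp okps] : ok p && all ok ps by exact: okpps.
  cbn [map foldl]; rewrite load1_spec; set s1 := HS _ _ _.
  have Hs1 i : i != 2%N -> nv s1 i = nv st i.
    by move=> ni; rewrite /s1 /= /upd (negbTE ni) Hs.
  have [h1 h2 h3 h4] := IH okps s1 Hs1; split=> //.
    move=> rc okrc; rewrite inE => hrc; apply: h1 => //.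
    have [//|/= nps] := boolP (rc \in ps); apply/eqP.
    rewrite /= /upd; case: (xr _ _ _ =P _) => [/(xr_inj okrc okp)[e1 e2]|ne].
      by rewrite /val e1 e2 Hs.
    by move: hrc; rewrite (negbTE nps) orbF => /orP[/eqP e|/eqP //]; case: ne; rewrite e.
  by move=> i hi; rewrite h4 //= /upd (_ : (i == _) = false) // /xr; lia.
have [h1 h2 h3 h4] := H st (fun _ _ => erefl); split=> // r c hr hc.
rewrite (h1 (r, c)) //; first by rewrite /val /= h2.
apply/orP; left; apply/allpairsP; exists (r, c); by split; rewrite ?mem_iota.
Qed.

Lemma eval_ehat st r c : loaded st -> nv st (ix d) = n -> (r <= d)%N ->
  ev (xv st) (ehat d r c) = hatv d (pt (idx st r)) c.
Proof.
move=> L hn hr; rewrite /ehat /hatv; case: ltnP => // hc /=.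
by rewrite !L ?hn.
Qed.

Lemma eval_ebas X m c : ev X (ebas m c) = basis R m c.
Proof. by rewrite /= /basis; case: eqP. Qed.

Lemma eval_eCoef st m : loaded st -> nv st (ix d) = n ->
  ev (xv st) (eCoef d m) = coef d pt (idx st) m.
Proof.
move=> L hn; rewrite eval_eDet; apply: eq_rdet => i j _ _.
by case: ltnP => hi; rewrite ?eval_ebas // eval_ehat // ltnW.
Qed.

Lemma eval_eAsq st : loaded st -> nv st (ix d) = n ->
  ev (xv st) (eAsq d) = Asq d pt (idx st).
Proof.
move=> L hn; rewrite eval_eSum big_map /Asq -(big_mkord predT (fun m => coef d pt (idx st) m ^+ 2)).
by rewrite /index_iota subn0; apply: eq_bigr => m _ /=; rewrite eval_eCoef.
Qed.

Lemma xv_setx_frame st i v : (i < 9)%N -> loaded st -> loaded (setx st i v).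
Proof.
move=> hi L r c hr hc /=; rewrite /upd (_ : (_ == i) = false) ?L //.
by rewrite /xr; lia.
Qed.

Definition kept (i : nat) : Prop := i != 2%N /\ forall r, i != bx r.

Lemma kept_lt i : (i < 20)%N -> i != 2%N -> kept i.
Proof. by move=> hi ni; split=> // r; rewrite /bx; lia. Qed.

Lemma kept_ix r : kept (ix r).
Proof. by split=> [|q]; rewrite /ix /bx; lia. Qed.

Definition inv (C : (nat -> nat) -> Prop) st : Prop :=
  [/\ nv st 0 = n, nv st 1 = 1%N, nv st (ix d) = n
    & best d n pt C (fun r => nv st (bx r)) (xv st 0) (xv st 1)].

Lemma hmovs_spec m st : let st' := hexec (hseqs [seq hmov (bx r) (ix r) | r <- iota 0 m]) st in
  [/\ forall r, (r < m)%N -> nv st' (bx r) = nv st (ix r),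
      forall i, (forall r, i != bx r) -> nv st' i = nv st i, xv st' = xv st & ar st' = ar st].
Proof.
rewrite /= hexec_hseqs; elim: m => [|m]; first by split.
rewrite iota0S map_rcons foldl_rcons /=.
move: (foldl _ _ _) => s [h1 h2 h3 h4]; split=> //.
- move=> r hr; rewrite /= /upd eqxx; case: eqP => [E|/eqP nE].
    rewrite (_ : (ix m == bx m) = false); last by rewrite /ix /bx; lia.
    rewrite h2; last by move=> q; rewrite /ix /bx; lia.
    by rewrite add0n; congr (nv st (ix _)); move: E; rewrite /bx; lia.
  by rewrite h1 //; move: nE; rewrite /bx; lia.
- by move=> i hi /=; rewrite /upd (negbTE (hi m)) h2.
Qed.

Lemma loopfree_try : loopfree (try_tuple d).
Proof.
by rewrite /try_tuple /= loopfree_load /= andbT; apply: loopfree_hseqs.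
Qed.

Lemma inv_try C st : inv C st -> in_range d n (idx st) ->
  let st' := hexec (try_tuple d) st in
  [/\ inv (fun s => C s \/ s = idx st) st', forall i, kept i -> nv st' i = nv st i
    & ar st' = ar st].
Proof.
move=> [i0 i1 id [Hb HC]] rg.
rewrite [try_tuple d]/try_tuple; set upd_code := save_best d.
cbn [hexec]; have := load_spec st; move: (hexec (load d) st) => s1 [L1 n1 a1 x1].
have ids r : nv s1 (ix r) = nv st (ix r) by rewrite n1.
have idE : idx s1 = idx st by apply/funext => r; exact: ids.
have idn : nv s1 (ix d) = n by rewrite ids.
set A := Asq d pt (idx st); set D2 := Off d pt (idx st) ^+ 2.
set s5 := setx (setx _ _ _) 5 _.
have E : s5 = setx (setx (setx (setx s1 2 A) 3 D2) 4 (D2 * xv st 0)) 5 (xv st 1 * A).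
  rewrite /s5 eval_eAsq // idE -/A; cbn [eSq eval].
  have L2 : loaded (setx s1 2 A) by apply: xv_setx_frame.
  rewrite (eval_eCoef d L2 idn).
  by rewrite -expr2 /= /upd /= !x1 // /idx /= -/(idx s1) idE.
have A0 : 0 <= A by apply: Asq_ge0.
have D0 : 0 <= D2 by apply: sqr_ge0.
have nvE i : nv s5 i = nv s1 i by rewrite E.
have arE : ar s5 = ar st by rewrite E /= a1.
have x50 : xv s5 0 = xv st 0 by rewrite E /= /upd /= x1.
have x51 : xv s5 1 = xv st 1 by rewrite E /= /upd /= x1.
have x52 : xv s5 2 = A by rewrite E.
have x53 : xv s5 3 = D2 by rewrite E.
have x54 : xv s5 4 = D2 * xv st 0 by rewrite E.
have x55 : xv s5 5 = xv st 1 * A by rewrite E.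
have bxn i : kept i -> nv s5 i = nv st i by case=> ni _; rewrite nvE n1.
have k0 := kept_lt (isT : 0 < 20)%N isT; have k1 := kept_lt (isT : 1 < 20)%N isT.
have kd := kept_ix d.
move: {E} (s5) nvE arE x50 x51 x52 x53 x54 x55 bxn => s nvE arE x0 x1' x2 x3 x4 x5 frs.
cbn [test_holds]; rewrite x4 x5; case: ltP => hlt; last first.
  split=> //; split; [by rewrite frs | by rewrite frs | by rewrite frs | split].
    case: Hb => [H|[rb b1 b2 b3]]; [left; by rewrite x0 x1' | right].
    have EB r : nv s (bx r) = nv st (bx r) by rewrite nvE n1.
    by rewrite x0 x1'; split=> //; rewrite ?(eq_Asq _ (fun r _ => EB r)) ?(eq_Off _ (fun r _ => EB r)) // => r hr; rewrite EB rb.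
  move=> t [Ct|->]; rewrite x0 x1'; first exact: HC.
  by rewrite -/A -/D2.
have Ap : 0 < A.
  rewrite lt0r A0 andbT; apply/eqP => Az; move: hlt; rewrite Az mulr0.
  case: Hb => [[-> _]|[_ p _ _]]; first by rewrite mulr0 ltxx.
  by rewrite ltNge mulr_ge0 // ltW.
rewrite /upd_code /save_best; cbn [hexec].
have := hmovs_spec d (setx (setx s 0 (ev (xv s) (EVar 2))) 1
   (ev (xv (setx s 0 (ev (xv s) (EVar 2)))) (EVar 3))).
move: (hexec (hseqs _) _) => s' /= [h1 h2 h3 h4].
have kp i : kept i -> nv s' i = nv st i by move=> ki; rewrite h2 ?frs //; case: ki.
have EB r : (r < d)%N -> nv s' (bx r) = idx st r by move=> hr; rewrite h1 // nvE ids.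
have X0 : xv s' 0 = A by rewrite h3 /upd /= x2.
have X1 : xv s' 1 = D2 by rewrite h3 /upd /= x3.
split=> //; last by rewrite h4.
split; [by rewrite kp | by rewrite kp | by rewrite kp | rewrite X0 X1; split].
  right; rewrite (eq_Asq _ EB) (eq_Off _ EB); split=> // r hr; rewrite EB //; exact: rg.
move=> t [Ct|->]; last by rewrite mulrC.
have := HC _ Ct; have At := Asq_ge0 d pt t.
case: Hb => [[b0 b1]|[_ p _ _]] hCt.
  rewrite b0 b1 mulr0 mul1r in hCt.
  have -> : Asq d pt t = 0 by apply/eqP; rewrite eq_le hCt.
  by rewrite mulr0 mulr_ge0 ?sqr_ge0.
rewrite -(ler_pM2r p) mulrAC; apply: le_trans (ler_wpM2r At (ltW hlt)) _.
by rewrite mulrAC [X in _ <= X]mulrAC; apply: ler_wpM2r.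
Qed.

End Blocks.

(** * Sorting by slope *)

Definition keep_code k : hcom :=
  HSeq (point_to k 4) (HSeq (HExp 2 (eNz k)) (HSeq (HExp 3 (EInt 0))
    (HIf (XLt 3 2) (HSeq (HSt false 3 4) (HSeq (HSt true 3 3) (HAdd 3 3 1))) HSkip))).

Definition filter_code k : hcom :=
  HSeq (HConst 3 0) (for_ 4 0 1 (keep_code k)).

(* Array false receives the sorted runs one after the other, array true their
   starting positions. *)
Definition take_code i u : hcom :=
  HSeq (HLd false u i) (HSeq (HSt false 8 u) (HSeq (HAdd i i 1) (HAdd 8 8 1))).

Definition merge_code k g h : hcom :=
  HIf (NLt 9 11)
    (HIf (NLt 10 12)
      (HSeq (HLd false 14 9) (HSeq (HLd false 15 10)
        (HSeq (key_code k g h 14 6) (HSeq (key_code k g h 15 7)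
          (HIf (XLt 7 6) (take_code 10 15) (take_code 9 14))))))
      (take_code 9 14))
    (take_code 10 15).

Arguments keep_code : simpl never.
Arguments take_code : simpl never.
Arguments merge_code : simpl never.

Section SortCode.
Variables (R : realType) (inp : nat -> R) (n k : nat).
Notation hst := (hst R).
Implicit Type st : hst.
Local Notation hexec := (hexec inp).
Local Notation pt := (pt inp k.+2 n).
Local Notation idx := (@idx R).
Local Notation loaded := (loaded inp k.+2).

Lemma eq_om (s s' : nat -> nat) u v w : (forall r, (r < k)%N -> s r = s' r) ->
  om k pt s u v w = om k pt s' u v w.
Proof.
by move=> E; apply: eq_rdet => i j _ _; rewrite /rows; case: ltnP => // /E ->.
Qed.

Lemma eval_eOm st eu ev ew u v w : loaded st -> nv st (ix k.+2) = n ->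
  (forall j, eval (xv st) (eu j) = u j) -> (forall j, eval (xv st) (ev j) = v j) ->
  (forall j, eval (xv st) (ew j) = w j) ->
  eval (xv st) (eOm k eu ev ew) = om k pt (idx st) u v w.
Proof.
move=> L hn Eu Ev Ew; rewrite eval_eDet; apply: eq_rdet => i j _ _; rewrite /rows.
case: ltnP => hi; first by rewrite (eval_ehat _ L hn) //; lia.
by case: eqP => // _; case: eqP.
Qed.

Lemma eval_point st j : loaded st -> nv st (ix k.+2) = n ->
  eval (xv st) (ehat k.+2 k j) = hatv k.+2 (pt (nv st (ix k))) j.
Proof. by move=> L hn; rewrite (eval_ehat _ L hn) //; lia. Qed.

Lemma eval_eNz st : loaded st -> nv st (ix k.+2) = n ->
  eval (xv st) (eNz k) = nzsum k pt (idx st) (nv st (ix k)).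
Proof.
move=> L hn; rewrite eval_eSum big_map /nzsum.
rewrite -(big_mkord predT (fun m => \sum_(m' < k + 3) om k pt (idx st)
   (hatv k.+2 (pt (nv st (ix k)))) (basis R m) (basis R m') ^+ 2)).
rewrite /index_iota subn0; apply: eq_bigr => m _.
rewrite eval_eSum big_map -(big_mkord predT (fun m' => om k pt (idx st)
   (hatv k.+2 (pt (nv st (ix k)))) (basis R m) (basis R m') ^+ 2)).
rewrite /index_iota subn0; apply: eq_bigr => m' _.
rewrite /eSq; cbn [eval].
rewrite (eval_eOm (u := hatv k.+2 (pt (nv st (ix k)))) (v := basis R m) (w := basis R m')) //.
- by move=> j; apply: eval_point.
- by move=> j; apply: eval_ebas.
- by move=> j; apply: eval_ebas.
Qed.

Lemma eval_eAlpha st g : loaded st -> nv st (ix k.+2) = n ->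
  eval (xv st) (eAlpha k g) =
    om k pt (idx st) (hatv k.+2 (pt (nv st (ix k)))) (basis R k.+2) (basis R g).
Proof.
move=> L hn; apply: eval_eOm => // j; by [apply: eval_point | apply: eval_ebas].
Qed.

Lemma point_to_spec st u : (u < 20)%N -> u != 2%N ->
  let st' := hexec (point_to k u) st in
  [/\ loaded st', nv st' (ix k) = nv st u,
      forall i, i != 2%N -> i != ix k -> nv st' i = nv st i, ar st' = ar st
    & forall i, (i < 9)%N -> xv st' i = xv st i].
Proof.
move=> hu nu; rewrite /point_to; cbn [hexec].
have nuk : (u == ix k) = false by rewrite /ix; lia.
have nk2 : ix k != 2%N by rewrite /ix.
have := load_spec inp k.+2 (hexec (hmov (ix k) u) st).
move: (hexec (load _) _) => st' [h1 h2 h3 h4]; split=> //.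
- by rewrite h2 // /= /upd eqxx nuk.
- by move=> i n2 ni; rewrite h2 //= /upd (negbTE ni).
Qed.

Lemma idx_point st st' : (forall i, i != 2%N -> i != ix k -> nv st' i = nv st i) ->
  forall r, (r < k)%N -> idx st' r = idx st r.
Proof. by move=> H r hr; apply: H; rewrite /ix; lia. Qed.

Lemma key_spec st g h u dst : nv st (ix k.+2) = n -> (u < 20)%N -> u != 2%N ->
  dst \in [:: 6%N; 7%N] ->
  let st' := hexec (key_code k g h u dst) st in
  [/\ xv st' dst = skey k pt (idx st) g h (nv st u),
      forall i, i != 2%N -> i != ix k -> nv st' i = nv st i, ar st' = ar st
    & forall i, i \notin [:: 4; 5; 8; dst]%N -> (i < 9)%N -> xv st' i = xv st i].
Proof.
move=> hn hu nu hd; rewrite /key_code; cbn [hexec].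
have := point_to_spec st hu nu; move: (hexec (point_to k u) st) => s1 [L1 e1 n1 a1 x1].
have hn1 : nv s1 (ix k.+2) = n by rewrite n1 // /ix; lia.
set al := fun g => om k pt (idx st) (hatv k.+2 (pt (nv st u))) (basis R k.+2) (basis R g).
have Eal s g' : loaded s -> nv s = nv s1 -> eval (xv s) (eAlpha k g') = al g'.
  move=> L En; rewrite eval_eAlpha ?En // e1 /al.
  apply: eq_om => r hr; rewrite -(idx_point n1 hr) /idx En //.
have L4 v : loaded (setx s1 4 v) by apply: xv_setx_frame.
rewrite !Eal //; set s8 := setx (setx _ 5 _) dst _.
have E8 : s8 = setx (setx (setx (setx (setx (setx s1 4 (al g)) 5 (al h)) 8 (al h / al g))
    4 (al g * al g)) 5 0) dst 1.
  by rewrite /s8 /=; congr HS.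
have [nd4 nd5 nd8 nd9] : [/\ dst != 4%N, dst != 5%N, dst != 8%N & (dst < 9)%N].
  by move: hd; rewrite !inE => /orP[] /eqP ->.
have x4 : xv s8 4 = al g * al g.
  by rewrite E8 /= /upd /= eq_sym (negbTE nd4).
have x5 : xv s8 5 = 0 by rewrite E8 /= /upd /= eq_sym (negbTE nd5).
have x8 : xv s8 8 = al h / al g by rewrite E8 /= /upd /= eq_sym (negbTE nd8).
have xd : xv s8 dst = 1 by rewrite E8 /= /upd eqxx.
have xo i : i \notin [:: 4; 5; 8; dst]%N -> (i < 9)%N -> xv s8 i = xv st i.
  rewrite !inE !negb_or => /and4P[i4 i5 i8 id] i9.
  by rewrite E8 /= /upd (negbTE i4) (negbTE i5) (negbTE i8) (negbTE id) x1.
have ns8 : nv s8 = nv s1 by rewrite E8.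
have as8 : ar s8 = ar st by rewrite E8 /= a1.
move: (s8) x4 x5 x8 xd xo ns8 as8 => {E8} {}s8 x4 x5 x8 xd xo ns8 as8.
cbn [test_holds]; rewrite x4 x5 x8.
have key_eq : skey k pt (idx st) g h (nv st u) = slope_key (al g) (al h) by [].
have sq : (0 < al g * al g) = (al g != 0) by rewrite -expr2 exprn_even_gt0.
rewrite sq key_eq /slope_key; case: eqVneq => [a0|na]; cbn [negb].
  by split=> // i ni nk; rewrite ns8 n1.
case: ltP => hq; split=> /=; rewrite ?as8 //.
- by rewrite /upd eqxx x8 ltr0_norm.
- by move=> i ni nk; rewrite ns8 n1.
- by move=> i hi h9; rewrite /upd; move: (hi); rewrite !inE !negb_or => /and4P[_ _ _ /negbTE ->]; apply: xo.
- by rewrite /upd eqxx x8 ger0_norm.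
- by move=> i ni nk; rewrite ns8 n1.
- by move=> i hi h9; rewrite /upd; move: (hi); rewrite !inE !negb_or => /and4P[_ _ _ /negbTE ->]; apply: xo.
Qed.

Variable T : nat -> nat.

Definition tinv (C : (nat -> nat) -> Prop) st : Prop :=
  inv inp k.+2 n C st /\ forall r, (r < k)%N -> nv st (ix r) = T r.

(* What the code for a fixed tuple may change without affecting tinv. *)
Definition frame st st' : Prop :=
  [/\ nv st' 0 = nv st 0, nv st' 1 = nv st 1,
      forall i, (20 <= i)%N -> i != ix k -> i != ix k.+1 -> nv st' i = nv st i,
      xv st' 0 = xv st 0 & xv st' 1 = xv st 1].

Lemma tinv_frame C st st' : frame st st' -> tinv C st -> tinv C st'.
Proof.
move=> [f0 f1 f20 x0 x1] [[i0 i1 id ib] it]; split; last first.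
  by move=> r hr; rewrite f20 ?it // /ix; lia.
split; rewrite ?f0 ?f1 //.
  by rewrite f20 // /ix; lia.
rewrite x0 x1 (_ : (fun r => nv st' (bx r)) = (fun r => nv st (bx r))) //.
by apply/funext => r; rewrite f20 // /bx /ix; lia.
Qed.

Lemma frame_point st st' : (forall i, i != 2%N -> i != ix k -> nv st' i = nv st i) ->
  xv st' 0 = xv st 0 -> xv st' 1 = xv st 1 -> frame st st'.
Proof.
move=> H x0 x1; split=> //; rewrite ?H // => i hi n1 n2; apply: H => //.
by apply: contraTneq hi => ->.
Qed.

Lemma tinv_idx C st i : tinv C st -> nzsum k pt (idx st) i = nzsum k pt T i.
Proof.
move=> [_ it]; apply: eq_bigr => m _; apply: eq_bigr => m' _.
by congr (_ ^+ 2); apply: eq_om.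
Qed.

Lemma tinv_key C st g h i : tinv C st -> skey k pt (idx st) g h i = skey k pt T g h i.
Proof. by move=> [_ it]; congr slope_key; apply: eq_om. Qed.

Definition nzlist m : seq nat := [seq i <- iota 0 m | 0 < nzsum k pt T i].

Definition holds (A : nat -> nat) (l : seq nat) : Prop :=
  forall j, (j < size l)%N -> A j = nth 0%N l j.

Lemma holds_rcons A l v : holds A l -> holds (upd A (size l) v) (rcons l v).
Proof.
move=> H j; rewrite size_rcons ltnS leq_eqVlt nth_rcons /upd => /orP[/eqP ->|hj].
  by rewrite ltnn eqxx.
by rewrite hj (ltn_eqF hj) H.
Qed.

Lemma loopfree_keep : loopfree (keep_code k).
Proof. by rewrite /keep_code /point_to /hmov; cbn [loopfree]; rewrite loopfree_load. Qed.

Lemma keep_spec C st m : tinv C st -> nv st 4 = m -> (m < n)%N ->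
  nv st 3 = size (nzlist m) -> holds (ar st false) (nzlist m) ->
  holds (ar st true) (iota 0 (size (nzlist m))) ->
  let st' := hexec (keep_code k) st in
  [/\ tinv C st', nv st' 4 = m, nv st' 3 = size (nzlist m.+1),
      holds (ar st' false) (nzlist m.+1)
    & holds (ar st' true) (iota 0 (size (nzlist m.+1)))].
Proof.
move=> Q e4 hm e3 H1 H2; rewrite /keep_code; cbn [hexec].
have := point_to_spec st (isT : 4 < 20)%N isT; move: (hexec (point_to k 4) st) => s1 [L1 p1 n1 a1 x1].
have Q1 : tinv C s1 by apply: (tinv_frame _ Q); apply: frame_point; rewrite ?x1.
have hn1 : nv s1 (ix k.+2) = n by case: Q1 => -[].
rewrite eval_eNz // p1 e4 (tinv_idx _ Q1) /=.
have El : nzlist m.+1 = if 0 < nzsum k pt T m then rcons (nzlist m) m else nzlist m.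
  by rewrite /nzlist iota0S filter_rcons.
have n3 : nv s1 3 = size (nzlist m) by rewrite n1.
have n4 : nv s1 4 = m by rewrite n1.
have n_1 : nv s1 1 = 1%N by case: Q1 => -[].
rewrite {1}/upd /= {1}/upd /= El; case: ifP => _.
  split=> //=.
  - by rewrite /upd /= n3 n_1 size_rcons addn1.
  - by rewrite a1 n3 n4; apply: holds_rcons.
  - rewrite a1 n3 size_rcons iota0S -{1}(size_iota 0 (size (nzlist m))).
    exact: holds_rcons.
by split=> //=; rewrite ?a1.
Qed.

Lemma filter_spec C st t Q : tinv C st ->
  (forall st', tinv C st' -> nv st' 3 = size (nzlist n) ->
     holds (ar st' false) (nzlist n) -> holds (ar st' true) (iota 0 (size (nzlist n))) ->
     Q st') ->
  (1 + (n * (hcost (keep_code k) + 3) + 3) <= t)%N ->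
  htri inp (filter_code k) st t Q.
Proof.
move=> Q0 HQ ht.
apply: htri_weaken (ht) (fun _ x => x); apply: htri_seq; apply: htri_loopfree => //=.
pose I m st' := [/\ tinv C st', nv st' 3 = size (nzlist m),
  holds (ar st' false) (nzlist m) & holds (ar st' true) (iota 0 (size (nzlist m)))].
have Q1 : tinv C (setn st 3 0) by [].
have [[i0 i1 _ _] _] := Q1.
apply: (@htri_for R inp 4 0 1 (keep_code k) _ n (hcost (keep_code k)) I) => //.
- move=> m st' hm [Qm e3 H1 H2] e4 e0 e1; apply: htri_loopfree; first exact: loopfree_keep.
  have [q1 q2 q3 q4 q5] := keep_spec Qm e4 hm e3 H1 H2.
  have [[j0 j1 _ _] _] := q1.
  by split.
- by move=> st' _ _ _ [q1 q2 q3 q4]; apply: HQ.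
Qed.

End SortCode.

Definition sort_start : hcom :=
  HSeq (HSt true 3 3) (HSeq (HConst 5 0) (HSeq (HConst 6 1)
    (HSeq (hmov 7 3) (hmov 8 3)))).

Definition merge_start : hcom :=
  HSeq (HLd true 9 5) (HSeq (HLd true 10 6) (HSeq (hmov 11 10)
    (HSeq (HAdd 12 6 1) (HSeq (HLd true 12 12)
      (HSeq (HSub 13 12 9) (HAdd 13 13 8)))))).

Definition merge_end : hcom :=
  HSeq (HAdd 7 7 1) (HSeq (HSt true 7 8) (HSeq (HAdd 5 6 1) (HAdd 6 5 1))).

Definition sort_code k g h : hcom :=
  HSeq sort_start (HWhile (NLt 6 7)
    (HSeq merge_start (HSeq (HWhile (NLt 8 13) (merge_code k g h)) merge_end))).

Section Potential.
Local Open Scope nat_scope.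

Fixpoint pot (c : nat) (ps : seq (seq nat)) : nat :=
  if ps is a :: ps' then size a * trunc_log 2 c + pot c.-1 ps' else 0.

Lemma pot_rcons c ps x :
  pot c (rcons ps x) = pot c ps + size x * trunc_log 2 (c - size ps).
Proof.
elim: ps c => [|a ps IH] c /=; first by rewrite subn0 addn0 add0n.
by rewrite IH addnA; congr (_ + _ * trunc_log 2 _); lia.
Qed.

(* The run at position j among L pending runs has depth log (2L - 1 - j) in the
   tree of merges, whose nodes are numbered from the root as in a heap. *)
Definition potential ps := pot (2 * size ps).-1 ps.

Lemma potential_merge a b ps x : size x = size a + size b ->
  potential (rcons ps x) + size x <= potential [:: a, b & ps].
Proof.
move=> sx; rewrite /potential size_rcons pot_rcons; cbn [pot size].
have -> : (2 * (size ps).+2).-1.-1.-1 = (2 * (size ps).+1).-1 by lia.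
have -> : (2 * (size ps).+1).-1 - size ps = (size ps).+1 by lia.
have L1 : trunc_log 2 (2 * (size ps).+2).-1.-1 = (trunc_log 2 (size ps).+1).+1.
  have -> : (2 * (size ps).+2).-1.-1 = (size ps).+1.*2 by lia.
  exact: trunc_log2_double.
have L2 : trunc_log 2 (2 * (size ps).+2).-1.-1 <= trunc_log 2 (2 * (size ps).+2).-1.
  by apply: leq_trunc_log; lia.
rewrite L1 in L2 *; move: L2; set u := trunc_log 2 _; set v := trunc_log 2 _ => L2.
have : size a * u.+1 <= size a * v by rewrite leq_mul2l L2 orbT.
rewrite sx; lia.
Qed.

Lemma potential_le ps : potential ps <= size (flatten ps) * trunc_log 2 (2 * size ps).
Proof.
have H c : pot c ps <= size (flatten ps) * trunc_log 2 c.
  elim: ps c => [|a ps IH] c //=; rewrite size_cat mulnDl leq_add2l.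
  by apply: leq_trans (IH _) _; rewrite leq_mul2l leq_trunc_log ?orbT // leq_pred.
apply: leq_trans (H _) _; rewrite leq_mul2l leq_trunc_log ?orbT //; exact: leq_pred.
Qed.

End Potential.

Section MergeSort.
Variables (R : realType) (inp : nat -> R) (n k : nat).
Notation hst := (hst R).
Implicit Type st : hst.
Local Notation hexec := (hexec inp).
Local Notation pt := (pt inp k.+2 n).
Variables (T : nat -> nat) (g h : nat).
Local Notation tinv := (tinv inp n k T).
Let key i := skey k pt T g h i.
Let le x y := key x <= key y.

Lemma slope_le_total : total le.
Proof. by move=> x y; apply: le_total. Qed.

Lemma take_spec C st i u F v : (i, u) \in [:: (9, 14); (10, 15)]%N ->
  tinv C st -> holds (ar st false) F -> nv st 8 = size F ->
  ar st false (nv st i) = v ->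
  let st' := hexec (take_code i u) st in
  [/\ tinv C st', holds (ar st' false) (rcons F v), ar st' true = ar st true,
      nv st' i = (nv st i).+1 &
      nv st' 8 = (nv st 8).+1 /\ forall j, j \notin [:: i; u; 8]%N -> nv st' j = nv st j].
Proof.
move=> hiu Q H e8 Ev; have e1 : nv st 1 = 1%N by case: Q => -[].
move: hiu Ev; rewrite !inE !xpair_eqE => /orP[] /andP[/eqP -> /eqP ->] Ev; rewrite /take_code /=.
all: split=> //=; rewrite /upd /= ?e1 ?addn1 ?Ev ?e8 //; try exact: holds_rcons.
all: split=> // j; rewrite !inE !negb_or => /and3P[/negbTE -> /negbTE -> /negbTE ->] //.
Qed.

Definition minv C pre a b post (S0 : nat -> nat) q w st : Prop :=
  exists a1 a' b1 b' dn, let F0 := pre ++ a ++ b ++ post in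
  [/\ a = a1 ++ a', b = b1 ++ b', size dn = (size a1 + size b1)%N,
      dn ++ merge le a' b' = merge le a b &
  [/\ tinv C st, holds (ar st false) (F0 ++ dn), ar st true = S0,
   [/\ nv st 9 = (size pre + size a1)%N, nv st 11 = (size pre + size a)%N,
       nv st 10 = (size pre + size a + size b1)%N,
       nv st 12 = (size pre + size a + size b)%N & nv st 8 = (size F0 + size dn)%N]
   & [/\ nv st 13 = (size F0 + (size a + size b))%N, nv st 5 = q, nv st 6 = q.+1
       & nv st 7 = w]]].

Lemma loopfree_key u dst : loopfree (key_code k g h u dst).
Proof.
by rewrite /key_code /point_to /hmov; cbn [loopfree]; rewrite loopfree_load.
Qed.

Lemma loopfree_merge : loopfree (merge_code k g h).
Proof. by rewrite /merge_code; cbn [loopfree]; rewrite !loopfree_key. Qed.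

Lemma merge_take_left C pre a b post S0 q w st a1 x a' b1 b' dn :
  let F0 := pre ++ a ++ b ++ post in
  a = a1 ++ x :: a' -> b = b1 ++ b' -> size dn = (size a1 + size b1)%N ->
  dn ++ x :: merge le a' b' = merge le a b ->
  [/\ tinv C st, holds (ar st false) (F0 ++ dn), ar st true = S0,
   [/\ nv st 9 = (size pre + size a1)%N, nv st 11 = (size pre + size a)%N,
       nv st 10 = (size pre + size a + size b1)%N,
       nv st 12 = (size pre + size a + size b)%N & nv st 8 = (size F0 + size dn)%N]
   & [/\ nv st 13 = (size F0 + (size a + size b))%N, nv st 5 = q, nv st 6 = q.+1
       & nv st 7 = w]] ->
  minv C pre a b post S0 q w (hexec (take_code 9 14) st) /\
  nv (hexec (take_code 9 14) st) 8 = (nv st 8).+1.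
Proof.
move=> F0 Ea Eb sd Ed [Q H HS0 [e9 e11 e10 e12 e8] [e13 e5 e6 e7]].
have Ev : ar st false (nv st 9) = x.
  rewrite H e9; last by rewrite /F0 !size_cat Ea size_cat /=; lia.
  by rewrite /F0 Ea -!catA nth_cat ltnNge leq_addr /= addKn nth_cat ltnn subnn.
have e8' : nv st 8 = size (F0 ++ dn) by rewrite size_cat.
have [] := @take_spec C st 9 14 _ x isT Q H e8' Ev.
move: (hexec _ st) => st' Q' H' HS' e9' [e8'' ke]; split=> //.
exists (a1 ++ [:: x]), a', b1, b', (rcons dn x); split=> //.
- by rewrite -catA.
- by rewrite size_rcons size_cat sd /=; lia.
- by rewrite cat_rcons.
split=> //; first by rewrite -rcons_cat.
- by rewrite HS'.
- split; rewrite ?e9' ?e9 ?e8'' ?e8 ?ke // ?size_rcons ?size_cat /=; lia.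
- by split; rewrite ke.
Qed.

Lemma merge_take_right C pre a b post S0 q w st a1 a' b1 x b' dn :
  let F0 := pre ++ a ++ b ++ post in
  a = a1 ++ a' -> b = b1 ++ x :: b' -> size dn = (size a1 + size b1)%N ->
  dn ++ x :: merge le a' b' = merge le a b ->
  [/\ tinv C st, holds (ar st false) (F0 ++ dn), ar st true = S0,
   [/\ nv st 9 = (size pre + size a1)%N, nv st 11 = (size pre + size a)%N,
       nv st 10 = (size pre + size a + size b1)%N,
       nv st 12 = (size pre + size a + size b)%N & nv st 8 = (size F0 + size dn)%N]
   & [/\ nv st 13 = (size F0 + (size a + size b))%N, nv st 5 = q, nv st 6 = q.+1
       & nv st 7 = w]] ->
  minv C pre a b post S0 q w (hexec (take_code 10 15) st) /\
  nv (hexec (take_code 10 15) st) 8 = (nv st 8).+1.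
Proof.
move=> F0 Ea Eb sd Ed [Q H HS0 [e9 e11 e10 e12 e8] [e13 e5 e6 e7]].
have Ev : ar st false (nv st 10) = x.
  rewrite H e10; last by rewrite /F0 !size_cat Eb size_cat /=; lia.
  rewrite /F0 Eb -!catA -addnA nth_cat ltnNge leq_addr /= addKn nth_cat ltnNge leq_addr /= addKn.
  by rewrite nth_cat ltnn subnn.
have e8' : nv st 8 = size (F0 ++ dn) by rewrite size_cat.
have [] := @take_spec C st 10 15 _ x isT Q H e8' Ev.
move: (hexec _ st) => st' Q' H' HS' e10' [e8'' ke]; split=> //.
exists a1, a', (b1 ++ [:: x]), b', (rcons dn x); split=> //.
- by rewrite -catA.
- by rewrite size_rcons size_cat sd /=; lia.
- by rewrite cat_rcons.
split=> //; first by rewrite -rcons_cat.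
- by rewrite HS'.
- split; rewrite ?e10' ?e10 ?e8'' ?e8 ?ke // ?size_rcons ?size_cat /=; lia.
- by split; rewrite ke.
Qed.

Lemma merge_step C pre a b post S0 q w st : minv C pre a b post S0 q w st ->
  (nv st 8 < nv st 13)%N ->
  let st' := hexec (merge_code k g h) st in
  minv C pre a b post S0 q w st' /\ nv st' 8 = (nv st 8).+1.
Proof.
move=> [a1 [a' [b1 [b' [dn [Ea Eb sd Ed Hst]]]]]] hlt.
have [Q H HS0 [e9 e11 e10 e12 e8] [e13 e5 e6 e7]] := Hst.
have sa : size a = (size a1 + size a')%N by rewrite Ea size_cat.
have sb : size b = (size b1 + size b')%N by rewrite Eb size_cat.
move=> st'; rewrite {}/st' /merge_code hexec_if [test_holds _ _ _]/=.
case: a' Ea Ed sa => [|x a'] Ea Ed sa.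
  rewrite (_ : (nv st 9 < nv st 11)%N = false); last by rewrite e9 e11 sa /=; lia.
  case: b' Eb Ed sb => [|y b'] Eb Ed sb.
    by move: hlt; rewrite e8 e13 sd sa sb /=; lia.
  apply: (merge_take_right Ea Eb sd _ Hst).
  by rewrite -Ed.
rewrite (_ : (nv st 9 < nv st 11)%N); last by rewrite e9 e11 sa /=; lia.
rewrite hexec_if [test_holds _ _ _]/=.
case: b' Eb Ed sb => [|y b'] Eb Ed sb.
  rewrite (_ : (nv st 10 < nv st 12)%N = false); last by rewrite e10 e12 sb /=; lia.
  apply: (merge_take_left Ea Eb sd _ Hst).
  by rewrite -Ed; case: (a').
rewrite (_ : (nv st 10 < nv st 12)%N); last by rewrite e10 e12 sb /=; lia.
have Ex : ar st false (nv st 9) = x.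
  rewrite H e9; last by rewrite !size_cat sa /=; lia.
  by rewrite Ea -!catA nth_cat ltnNge leq_addr /= addKn nth_cat ltnn subnn.
have Ey : ar st false (nv st 10) = y.
  rewrite H e10; last by rewrite !size_cat sb /=; lia.
  rewrite Eb -!catA -addnA nth_cat ltnNge leq_addr /= addKn nth_cat ltnNge leq_addr /= addKn.
  by rewrite nth_cat ltnn subnn.
rewrite hexec_seq hexec_seq hexec_seq hexec_seq hexec_if.
set s1 := hexec (HLd false 15 10) _.
have E1 : s1 = setn (setn st 14 x) 15 y by rewrite /s1 /= {1}/upd /= Ex Ey.
have Q1 : tinv C s1 by rewrite E1.
have a_1 : ar s1 = ar st by rewrite E1.
have n14 : nv s1 14 = x by rewrite E1.
have n15 : nv s1 15 = y by rewrite E1.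
have n1 j : j \notin [:: 14; 15]%N -> nv s1 j = nv st j.
  by rewrite E1 !inE negb_or => /andP[h1 h2]; rewrite /= /upd (negbTE h1) (negbTE h2).
move: {E1} (s1) Q1 a_1 n14 n15 n1 => {}s1 Q1 a_1 n14 n15 n1.
have hn1 : nv s1 (ix k.+2) = n by case: Q1 => -[].
have := key_spec inp g h hn1 (isT : 14 < 20)%N isT (isT : 6%N \in [:: 6%N; 7%N]).
move: (hexec (key_code k g h 14 6) s1) => s2 [x6 n2 a_2 o2].
have Q2 : tinv C s2.
  by apply: (tinv_frame _ Q1); apply: frame_point => //; rewrite o2.
have hn2 : nv s2 (ix k.+2) = n by case: Q2 => -[].
have := key_spec inp g h hn2 (isT : 15 < 20)%N isT (isT : 7%N \in [:: 6%N; 7%N]).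
move: (hexec (key_code k g h 15 7) s2) => s3 [x7 n3 a_3 o3].
have Q3 : tinv C s3.
  by apply: (tinv_frame _ Q2); apply: frame_point => //; rewrite o3.
have nn j : (j < 14)%N -> j != 2%N -> nv s3 j = nv st j.
  move=> j14 j2; have jk : j != ix k by rewrite /ix; lia.
  by rewrite n3 // n2 // n1 // !inE; lia.
have H3 : [/\ tinv C s3, holds (ar s3 false) ((pre ++ a ++ b ++ post) ++ dn), ar s3 true = S0,
   [/\ nv s3 9 = (size pre + size a1)%N, nv s3 11 = (size pre + size a)%N,
       nv s3 10 = (size pre + size a + size b1)%N,
       nv s3 12 = (size pre + size a + size b)%N
     & nv s3 8 = (size (pre ++ a ++ b ++ post) + size dn)%N]
   & [/\ nv s3 13 = (size (pre ++ a ++ b ++ post) + (size a + size b))%N, nv s3 5 = q,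
         nv s3 6 = q.+1 & nv s3 7 = w]].
  by split; rewrite ?a_3 ?a_2 ?a_1 //; split; rewrite nn.
rewrite [test_holds _ _ _]/= x7 o3 // x6 (tinv_key g h _ Q2) (tinv_key g h _ Q1) n14.
have -> : nv s2 15 = y by rewrite n2 // /ix; lia.
have e8s : nv s3 8 = nv st 8 by rewrite nn.
have Edm : dn ++ (if le x y then x :: merge le a' (y :: b') else y :: merge le (x :: a') b')
   = merge le a b by rewrite -Ed.
rewrite -/(key x) -/(key y) -e8s; case: ltP => hxy.
  apply: (merge_take_right Ea Eb sd _ H3).
  by move: Edm; rewrite /le leNgt hxy.
apply: (merge_take_left Ea Eb sd _ H3).
by move: Edm; rewrite /le hxy.
Qed.

Let km := (hcost (merge_code k g h) + 2)%N.

Lemma merge_loop C pre a b post S0 q w st t Q : minv C pre a b post S0 q w st ->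
  (forall st', minv C pre a b post S0 q w st' -> nv st' 13 = nv st' 8 -> Q st') ->
  (km * (nv st 13 - nv st 8) + 2 <= t)%N ->
  htri inp (HWhile (NLt 8 13) (merge_code k g h)) st t Q.
Proof.
move=> Hst HQ ht.
pose I t st' := minv C pre a b post S0 q w st' /\ (km * (nv st' 13 - nv st' 8) + 2 <= t)%N.
apply: (@htri_while _ _ _ _ I) => // {st t Hst ht} t st [Hst ht] /=.
have e13 st' : minv C pre a b post S0 q w st' ->
    nv st' 13 = (size (pre ++ a ++ b ++ post) + (size a + size b))%N.
  by move=> [a1 [a' [b1 [b' [dn [_ _ _ _ [_ _ _ _ []]]]]]]].
case: ltnP => hlt.
  have [H1 H2] := merge_step Hst hlt.
  exists (hcost (merge_code k g h)), (km * (nv st 13 - nv st 8).-1 + 2)%N; split.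
    apply: leq_trans ht; rewrite -{2}(prednK (_ : 0 < nv st 13 - nv st 8)%N) ?subn_gt0 //.
    by rewrite mulnS /km; lia.
  apply: htri_loopfree; first exact: loopfree_merge.
  split=> //; rewrite H2 (e13 _ H1) (e13 _ Hst); rewrite leq_add2r leq_mul2l; lia.
split; first by lia.
apply: HQ => //; apply/eqP; rewrite eqn_leq hlt /=.
move: Hst => [a1 [a' [b1 [b' [dn [Ea Eb sd _ [_ _ _ [_ _ _ _ ->] [-> _ _ _]]]]]]]].
by rewrite leq_add2l sd Ea Eb !size_cat; lia.
Qed.

Variable l0 : seq nat.

Definition sinv C rs q st : Prop :=
  [/\ tinv C st, holds (ar st false) (flatten rs),
      forall j, (j <= size rs)%N -> ar st true j = size (flatten (take j rs)),
      [/\ (q <= size rs)%N, all (sorted le) (drop q rs) & perm_eq (flatten (drop q rs)) l0]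
    & [/\ nv st 5 = q, nv st 6 = q.+1, nv st 7 = size rs & nv st 8 = size (flatten rs)]].

Definition sorted_in (st : hst) (l : seq nat) : Prop :=
  [/\ sorted le l, perm_eq l l0, nv st 8 = (ar st true (nv st 5) + size l)%N
    & forall j, (j < size l)%N -> ar st false (ar st true (nv st 5) + j)%N = nth 0%N l j].

Let kp := (hcost merge_start + hcost merge_end + 4)%N.

Lemma sort_loop C rs q st t Q : sinv C rs q st ->
  (forall st' l, tinv C st' -> sorted_in st' l -> Q st') ->
  (km * potential (drop q rs) + kp * size (drop q rs) + 2 <= t)%N ->
  htri inp (HWhile (NLt 6 7)
    (HSeq merge_start (HSeq (HWhile (NLt 8 13) (merge_code k g h)) merge_end))) st t Q.
Proof.
move=> H0 HQ ht.
pose I t st' := exists rs q, sinv C rs q st' /\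
  (km * potential (drop q rs) + kp * size (drop q rs) + 2 <= t)%N.
apply: (@htri_while _ _ _ _ I); last by exists rs, q.
move=> {H0 ht} {}t {}st [{}rs [{}q [Hst ht]]] /=.
have [Qt H HS [hq hsort hperm] [e5 e6 e7 e8]] := Hst.
rewrite e6 e7; case: ltnP => hlt; last first.
  split; first by lia.
  have Erun : flatten (drop q rs) = nth [::] (drop q rs) 0.
    have : (size (drop q rs) <= 1)%N by rewrite size_drop; lia.
    by case: (drop q rs) => [|r [|]] //= _; rewrite cats0.
  have Ecat : flatten rs = flatten (take q rs) ++ flatten (drop q rs).
    by rewrite -flatten_cat cat_take_drop.
  apply: (HQ _ (flatten (drop q rs)) Qt); split.
  - rewrite Erun; have : all (sorted le) (drop q rs) by [].
    by case: (drop q rs) => //= r ? /andP[].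
  - by [].
  - by rewrite e8 e5 HS // Ecat size_cat.
  - move=> j hj; rewrite e5 HS // H; last by rewrite Ecat size_cat ltn_add2l.
    by rewrite Ecat nth_cat ltnNge leq_addr /= addKn.
have [a [b [ps Eps]]] : exists a b ps, drop q rs = [:: a, b & ps].
  have : (1 < size (drop q rs))%N by rewrite size_drop; lia.
  by case: (drop q rs) => [|a [|b ps]] // _; exists a, b, ps.
have d1 : drop q.+1 rs = b :: ps by rewrite -[q.+1]add1n -drop_drop Eps /= ?drop0.
have d2 : drop q.+2 rs = ps by rewrite -[q.+2]add1n -drop_drop d1 /= ?drop0.
have Ers : rs = take q rs ++ [:: a, b & ps] by rewrite -Eps cat_take_drop.
have t1 : take q.+1 rs = rcons (take q rs) a.
  by rewrite -[q.+1]addn1 takeD Eps /= ?take0 cats1.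
have t2 : take q.+2 rs = rcons (rcons (take q rs) a) b.
  by rewrite -[q.+2]addn1 takeD t1 d1 /= ?take0 cats1.
set pre := flatten (take q rs); set post := flatten ps.
have EF : flatten rs = pre ++ a ++ b ++ post by rewrite {1}Ers flatten_cat.
have S1 : ar st true q.+1 = (size pre + size a)%N.
  by rewrite HS ?(ltnW hlt) // t1 flatten_rcons size_cat.
have S2 : ar st true q.+2 = (size pre + size a + size b)%N.
  by rewrite HS // t2 !flatten_rcons !size_cat.
have sorta : sorted le a by move: hsort; rewrite Eps /= => /and3P[].
have sortb : sorted le b by move: hsort; rewrite Eps /= => /and3P[].
have sortps : all (sorted le) ps by move: hsort; rewrite Eps /= => /and3P[].
set M := merge le a b.
have sM : size M = (size a + size b)%N by rewrite size_merge size_cat.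
have Edrop : drop q.+2 (rcons rs M) = rcons ps M by rewrite drop_rcons ?d2.
exists (hcost merge_start + ((km * (size a + size b) + 2) + hcost merge_end))%N.
exists (km * potential (rcons ps M) + kp * size (rcons ps M) + 2)%N; split.
  apply: leq_trans ht; rewrite Eps size_rcons.
  have := leq_mul (leqnn km) (potential_merge ps sM); rewrite mulnDr sM.
  have : kp = (hcost merge_start + hcost merge_end + 4)%N by [].
  cbn [size]; rewrite [(kp * _.+2)%N]mulnS.
  move: (hcost merge_start) (hcost merge_end) (potential _) (potential _) kp km.
  by clear; lia.
apply: htri_seq; apply: htri_loopfree => //=; apply: htri_seq.
rewrite /merge_start /hmov /=; set st1 := setn _ _ _.
have e1 : nv st 1 = 1%N by case: Qt => -[].
have M1 : minv C pre a b post (ar st true) q (size rs) st1.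
  exists [::], a, [::], b, [::]; split=> //; split=> //=.
  - by rewrite cats0 -EF.
  - rewrite /upd /= ?e5 ?e6 ?e1 ?addn1 ?S1 ?S2 ?HS // ?add0n -?/pre ?e8 ?EF ?addn0; split=> //.
  - rewrite /upd /= ?e5 ?e6 ?e1 ?addn1 ?S2 ?HS // -/pre e8 EF; split=> //; lia.
have e13 : (nv st1 13 - nv st1 8 = size a + size b)%N.
  move: M1 => [? [? [? [? [? [_ _ _ _ [_ _ _ [_ _ _ _ _] [E13 _ _ _]]]]]]]].
  by rewrite E13 /st1 /= /upd /= e8 EF; lia.
apply: (merge_loop M1); last by rewrite e13.
move=> st2 [a1 [a' [b1 [b' [dn [Ea Eb sd Ed [Q2 H2 HS2 [f9 f11 f10 f12 f8] [f13 f5 f6 f7]]]]]]]] E13.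
have [a'0 b'0] : a' = [::] /\ b' = [::].
  have sa := congr1 size Ea; have sb := congr1 size Eb; rewrite !size_cat in sa sb.
  by split; apply: size0nil; lia.
have Edn : dn = M by rewrite /M -Ed a'0 b'0 /= cats0.
apply: htri_loopfree => //; exists (rcons rs M), q.+2; rewrite Edrop; split=> //.
have g1 : nv st2 1 = 1%N by case: Q2 => -[].
have EFr : flatten (rcons rs M) = flatten rs ++ M.
  exact: flatten_rcons.
rewrite /merge_end /=; split=> //=.
- by rewrite EFr EF -Edn.
- move=> j; rewrite size_rcons HS2 /upd /= f7 g1 addn1 leq_eqVlt => /orP[/eqP ->|hj].
    by rewrite eqxx take_oversize ?size_rcons // EFr size_cat f8 EF Edn.
  by rewrite (ltn_eqF hj) HS // -cats1 takel_cat.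
- rewrite size_rcons; split; first by lia.
    by rewrite Edrop all_rcons sortps andbT merge_sorted //; exact: slope_le_total.
  rewrite Edrop flatten_rcons.
  apply: perm_trans hperm; rewrite Eps /= catA perm_catC perm_cat2r perm_merge.
  exact: perm_refl.
- rewrite /upd /= f6 g1 f7 f8 size_rcons EFr EF -Edn !size_cat !addn1.
  by split.
Qed.

Lemma sort_spec C st m t Q : tinv C st -> size l0 = m -> nv st 3 = m ->
  holds (ar st false) l0 -> holds (ar st true) (iota 0 m) ->
  (forall st' l, tinv C st' -> sorted_in st' l -> Q st') ->
  (hcost sort_start + (km * (m * trunc_log 2 (2 * m)) + kp * m + 2) <= t)%N ->
  htri inp (sort_code k g h) st t Q.
Proof.
move=> Qt sl e3 H1 H2 HQ ht; apply: htri_weaken (ht) (fun _ x => x).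
apply: htri_seq; apply: htri_loopfree => //.
have Efl : flatten [seq [:: x] | x <- l0] = l0 by elim: (l0) => //= x l ->.
apply: (@sort_loop C [seq [:: x] | x <- l0] 0) => //.
  rewrite /sort_start /=; split=> //=.
  - by rewrite Efl.
  - move=> j; rewrite size_map sl -map_take => hj.
    have -> : size (flatten [seq [:: x] | x <- take j l0]) = j.
      rewrite (_ : flatten _ = take j l0) ?size_takel ?sl //.
      by elim: (take j l0) => //= x l ->.
    rewrite /upd e3; case: eqP => [-> //|/eqP nj].
    by rewrite H2 ?size_iota ?nth_iota //; lia.
  - rewrite drop0 Efl perm_refl; split=> //.
    by elim: (l0) => //= x l ->.
  - by rewrite /upd /= e3 Efl size_map sl.
rewrite drop0 size_map sl !leq_add2r leq_mul2l.
by have := potential_le [seq [:: x] | x <- l0]; rewrite Efl size_map sl => ->; rewrite orbT.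
Qed.

End MergeSort.

(** * The whole program *)

Definition pairs_start : hcom :=
  HSeq (HLd true 9 5) (HSeq (HSub 16 8 1) (HLd false 16 16)).

Definition pair_code k : hcom :=
  HSeq (HSeq (HLd false 18 9) (HSeq (hmov (ix k) 16) (hmov (ix k.+1) 18)))
    (HSeq (try_tuple k.+2) (HSeq (hmov 16 18) (HAdd 9 9 1))).

Definition gh_code k g h : hcom :=
  HSeq (filter_code k) (HSeq (sort_code k g h)
    (HSeq pairs_start (HWhile (NLt 9 8) (pair_code k)))).

Definition axes k := [seq (g, h) | g <- iota 0 (k + 3), h <- iota 0 (k + 3)].

Definition tuple_code k : hcom := hseqs [seq gh_code k gh.1 gh.2 | gh <- axes k].

Section PairLoop.
Variables (R : realType) (inp : nat -> R) (n k : nat).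
Notation hst := (hst R).
Implicit Type st : hst.
Implicit Type C : (nat -> nat) -> Prop.
Local Notation hexec := (hexec inp).
Local Notation pt := (pt inp k.+2 n).
Variable T : nat -> nat.
Hypothesis T_lt : forall r, (r < k)%N -> (T r < n)%N.
Local Notation tinv := (tinv inp n k T).

Definition tried C x y : Prop :=
  exists2 s, C s & forall r, (r < k.+2)%N -> s r = tuple_of k T x y r.

Lemma loopfree_pair : loopfree (pair_code k).
Proof.
by rewrite /pair_code /hmov; cbn [loopfree]; rewrite loopfree_try.
Qed.

Lemma pair_step C st x y : tinv C st -> ar st false (nv st 9) = y ->
  nv st 16 = x -> (x < n)%N -> (y < n)%N ->
  let st' := hexec (pair_code k) st in
  exists2 C', (forall s, C s -> C' s) &
    [/\ tinv C' st', tried C' x y, ar st' = ar st, nv st' 9 = (nv st 9).+1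
      & [/\ nv st' 8 = nv st 8 & nv st' 16 = y]].
Proof.
move=> Q Ey Ex hx hy st'; rewrite {}/st' /pair_code hexec_seq.
set s1 := hexec (HSeq _ _) st.
have E1 j : nv s1 j = if j == ix k.+1 then y else if j == ix k then x
    else if j == 18%N then y else nv st j.
  rewrite /s1 /= /upd !eqxx.
  rewrite !(neq_ix _ (isT : 18 < 20)%N) !(neq_ix _ (isT : 16 < 20)%N) /= ?add0n Ey Ex.
  by case: eqP => // _; case: eqP.
have xs1 : xv s1 = xv st by [].
have as1 : ar s1 = ar st by [].
move: (s1) E1 xs1 as1 => {}s1 E1 xs1 as1.
have Q1 : tinv C s1.
  apply: (tinv_frame _ Q); split; rewrite ?xs1 // ?E1 // => i hi /negbTE n1 /negbTE n2.
  by rewrite E1 n2 n1 (_ : (i == 18) = false) //; lia.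
have [i1 it] := Q1.
have Ek : nv s1 (ix k) = x by rewrite E1 eqxx (_ : (ix k == ix k.+1) = false) // /ix; lia.
have Ek1 : nv s1 (ix k.+1) = y by rewrite E1 eqxx.
have tup r : (r < k.+2)%N -> idx s1 r = tuple_of k T x y r.
  rewrite /tuple_of => hr; case: ltnP => h1; first by rewrite -it.
  case: eqP => [-> //|h2]; rewrite (_ : r = k.+1) //; lia.
have rg : in_range k.+2 n (idx s1).
  move=> r hr; rewrite tup // /tuple_of; case: (ltnP r k) => h1; first exact: T_lt.
  by case: eqP.
have [i2 kp a2] := inv_try i1 rg; rewrite hexec_seq.
move: (hexec (try_tuple k.+2) s1) i2 kp a2 => s2 i2 kp a2.
exists (fun s => C s \/ s = idx s1); first by left.
have n18 : nv s2 18 = y.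
  by rewrite kp; [rewrite E1 !neq_ix | apply: kept_lt].
have lo j : (j < 18)%N -> j != 2%N -> nv s2 j = nv st j.
  move=> hj nj; have h20 : (j < 20)%N by apply: ltn_trans hj _.
  by rewrite kp; [rewrite E1 !neq_ix // (ltn_eqF hj) | apply: kept_lt].
have e1 : nv s2 1 = 1%N by case: i2.
split=> /=; rewrite ?a2 ?as1 //.
- split=> /=.
    have [h0 h1 h2 h3] := i2; by split.
  by move=> r hr; rewrite /upd /= kp ?it //; apply: kept_ix.
- by exists (idx s1); [right | exact: tup].
- by rewrite /upd /= lo // e1 addn1.
- by rewrite /upd /= n18 lo.
Qed.

Variables g h : nat.
Let key i := skey k pt T g h i.
Local Notation nzl := (nzlist inp n k T n).

Definition list_tried C : Prop := exists l : seq nat,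
  [/\ forall i, (i \in l) = (i < n)%N && (0 < nzsum k pt T i),
      sorted (fun x y => key x <= key y) l
    & forall x y, adjacent l x y -> tried C x y].

Let cp := hcost (pair_code k).

Lemma pairs_loop C st l t (Q : hst -> Prop) : tinv C st ->
  sorted_in inp n k T g h nzl st l ->
  (forall C' st', (forall s, C s -> C' s) -> tinv C' st' -> list_tried C' -> Q st') ->
  (hcost pairs_start + ((cp + 2) * n + 2) <= t)%N ->
  htri inp (HSeq pairs_start (HWhile (NLt 9 8) (pair_code k))) st t Q.
Proof.
move=> Qt [sl pl e8 El] HQ ht; apply: htri_weaken (ht) (fun _ x => x).
set base := ar st true (nv st 5) in e8 El *.
have ml i : (i \in l) = (i < n)%N && (0 < nzsum k pt T i).
  by rewrite (perm_mem pl) mem_filter mem_iota add0n andbC.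
have szl : (size l <= n)%N.
  by rewrite (perm_size pl) size_filter -[X in (_ <= X)%N](size_iota 0) count_size.
have lt_n j : (j < size l)%N -> (nth 0%N l j < n)%N.
  by move=> /(mem_nth 0%N); rewrite ml => /andP[].
pose pv j := nth 0%N l (if j == 0%N then (size l).-1 else j.-1).
pose I t st' := exists j C', [/\ (j <= size l)%N, forall s, C s -> C' s, tinv C' st',
  [/\ nv st' 9 = (base + j)%N, nv st' 8 = (base + size l)%N,
      (j < size l)%N -> nv st' 16 = pv j &
      forall i, (i < size l)%N -> ar st' false (base + i)%N = nth 0%N l i]
  & (forall i, (i < j)%N -> tried C' (pv i) (nth 0%N l i)) /\
    ((cp + 2) * (size l - j) + 2 <= t)%N].
apply: htri_seq; apply: htri_loopfree => //; apply: (@htri_while _ _ _ _ I).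
  move=> {ht Qt e8 El} t1 st1 [j [C' [hj sub Qt [e9 e8 e16 El] [tr ht]]]] /=.
  rewrite e9 e8 ltn_add2l; case: ltnP => hlt.
    have Ey : ar st1 false (nv st1 9) = nth 0%N l j by rewrite e9 El.
    have pvl : (pv j < n)%N by apply: lt_n; case: (j == 0%N); lia.
    have [C2 sub2 [Q2 tr2 a2 f9 [f8 f16]]] := pair_step Qt Ey (e16 hlt) pvl (lt_n _ hlt).
    exists cp, ((cp + 2) * (size l - j.+1) + 2)%N; split.
      by apply: leq_trans ht; rewrite -(subnSK hlt) mulnS; lia.
    apply: htri_loopfree; first exact: loopfree_pair.
    exists j.+1, C2; split=> //; first by move=> s /sub /sub2.
      by split; rewrite ?f9 ?f8 ?a2 ?e9 ?addnS.
    split=> // i; rewrite ltnS leq_eqVlt => /orP[/eqP -> //|/tr [s Cs Es]].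
    by exists s => //; apply: sub2.
  split; first by lia.
  apply: (HQ C' st1 sub Qt); exists l; split=> // x y [i hi [-> ->]].
  by apply: tr; apply: leq_trans hlt.
have e1 : nv st 1 = 1%N by case: Qt => -[].
exists 0%N, C; rewrite /pairs_start /=; split=> //.
  split=> //=; rewrite /upd /=; first by rewrite addn0.
  move=> h0; rewrite e8 e1 -/base (_ : (base + size l - 1 = base + (size l).-1)%N); last by lia.
  by rewrite El //; lia.
by split=> //; rewrite leq_add2r subn0 leq_mul2l szl orbT.
Qed.

Definition gh_time : nat :=
  ((1 + (n * (hcost (keep_code k) + 3) + 3)) +
  ((hcost sort_start + ((hcost (merge_code k g h) + 2) * (n * trunc_log 2 (2 * n))
     + (hcost merge_start + hcost merge_end + 4) * n + 2)) +
   (hcost pairs_start + ((cp + 2) * n + 2))))%N.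

Lemma gh_spec C st : tinv C st -> htri inp (gh_code k g h) st gh_time
  (fun st' => exists2 C', (forall s, C s -> C' s) & tinv C' st' /\ list_tried C').
Proof.
move=> Qt; apply: htri_seq; apply: (filter_spec Qt) => // st1 Q1 e3 H1 H2.
have szn : (size nzl <= n)%N.
  by rewrite size_filter -[X in (_ <= X)%N](size_iota 0) count_size.
apply: htri_seq; apply: (sort_spec Q1 erefl e3 H1 H2).
  move=> st2 l Q2 sl; apply: (pairs_loop Q2 sl) => // C' st' sub Q' lt.
  by exists C'.
rewrite leq_add2l leq_add2r leq_add //; last by rewrite leq_mul2l szn orbT.
rewrite leq_mul2l; apply/orP; right; apply: leq_mul => //.
by apply: leq_trunc_log; rewrite leq_mul2l szn.
Qed.

End PairLoop.

Fixpoint for_tuples j c : hcom :=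
  if j is j'.+1 then for_ (ix j') 0 1 (for_tuples j' c) else c.

Fixpoint nest_time n t0 j : nat :=
  if j is j'.+1 then (n * (nest_time n t0 j' + 3) + 3)%N else t0.

Definition main_init d : hcom :=
  HSeq (HConst 1 1) (HSeq (hmov (ix d) 0) (HSeq (HExp 0 (EInt 0)) (HExp 1 (EInt 1)))).

Definition main_output d : hcom := hseqs [seq hmov r (bx r) | r <- iota 0 d].

Definition main_code d K c : hcom :=
  HSeq (main_init d) (HSeq (for_tuples K c) (main_output d)).

Section AllTuples.
Variables (R : realType) (inp : nat -> R) (n : nat).
Notation hst := (hst R).
Implicit Type st : hst.
Implicit Type C : (nat -> nat) -> Prop.
Local Notation hexec := (hexec inp).

Lemma list_tried_sub k T g h C C' : (forall s, C s -> C' s) ->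
  list_tried inp n k T g h C -> list_tried inp n k T g h C'.
Proof.
move=> sub [l [h1 h2 h3]]; exists l; split=> // x y /h3[s Cs Es].
by exists s => //; apply: sub.
Qed.

Definition tuple_time k : nat := sumn [seq gh_time n k gh.1 gh.2 | gh <- axes k].

Definition lists_tried k s C : Prop := forall g h, (g < k + 3)%N -> (h < k + 3)%N ->
  list_tried inp n k s g h C.

Lemma tuple_spec k C st : inv inp k.+2 n C st -> in_range k n (idx st) ->
  htri inp (tuple_code k) st (tuple_time k)
  (fun st' => exists2 C', (forall s, C s -> C' s) & [/\ inv inp k.+2 n C' st',
    forall r, (r < k)%N -> nv st' (ix r) = nv st (ix r) & lists_tried k (idx st) C']).
Proof.
move=> i0 T_lt; pose T := idx st.
have Q0 : tinv inp n k T C st by split.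
suff H : forall (l : seq (nat * nat)) C1 st1, tinv inp n k T C1 st1 ->
    htri inp (hseqs [seq gh_code k gh.1 gh.2 | gh <- l]) st1
    (sumn [seq gh_time n k gh.1 gh.2 | gh <- l])
    (fun st' => exists2 C', (forall s, C1 s -> C' s) & tinv inp n k T C' st' /\
      forall gh, gh \in l -> list_tried inp n k T gh.1 gh.2 C').
  apply: htri_weaken (H (axes k) _ _ Q0) (leqnn _) _ => st' [C' sub [[i' it] tr]].
  exists C' => //; split=> // g h hg hh; apply: (tr (g, h)).
  by apply/allpairsP; exists (g, h); rewrite !mem_iota.
elim=> [|gh l IH] C1 st1 Q1.
  by apply: (@htri_loopfree _ _ HSkip) => //; exists C1.
have Hgh := @gh_spec _ _ _ _ _ T_lt gh.1 gh.2 _ _ Q1.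
apply: (@htri_seq _ _ _ _ _ (gh_time n k gh.1 gh.2)).
apply: htri_weaken Hgh (leqnn _) _.
move=> st2 [C2 sub2 [Q2 tr2]].
apply: htri_weaken (IH _ _ Q2) (leqnn _) _ => st3 [C3 sub3 [Q3 tr3]].
exists C3; first by move=> s /sub2 /sub3.
split=> // gh'; rewrite inE => /orP[/eqP ->|/tr3 //].
exact: list_tried_sub tr2.
Qed.

Section Nest.
Variables (d K t0 : nat) (c : hcom) (Cov : (nat -> nat) -> ((nat -> nat) -> Prop) -> Prop).
Hypothesis K_le : (K <= d)%N.
Hypothesis Cov_sub : forall s C C', (forall s, C s -> C' s) -> Cov s C -> Cov s C'.
Hypothesis Cov_ext : forall s s' C, (forall r, (r < K)%N -> s r = s' r) -> Cov s C -> Cov s' C.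
Hypothesis c_spec : forall C st, inv inp d n C st -> in_range K n (idx st) ->
  htri inp c st t0 (fun st' => exists2 C', (forall s, C s -> C' s) & [/\ inv inp d n C' st',
    forall r, (r < K)%N -> nv st' (ix r) = nv st (ix r) & Cov (idx st) C']).

Lemma nest_spec j C st : (j <= K)%N -> inv inp d n C st ->
  (forall r, (j <= r < K)%N -> (nv st (ix r) < n)%N) ->
  htri inp (for_tuples j c) st (nest_time n t0 j)
  (fun st' => exists2 C', (forall s, C s -> C' s) & [/\ inv inp d n C' st',
    forall r, (j <= r < K)%N -> nv st' (ix r) = nv st (ix r) &
    forall s, in_range K n s -> (forall r, (j <= r < K)%N -> s r = nv st (ix r)) -> Cov s C']).
Proof.
elim: j C st => [|j IH] C st hj i0 hlt.
  apply: htri_weaken (c_spec i0 _) (leqnn _) _ => // st' [C' sub [i' e' cov]].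
  exists C' => //; split=> // s _ Es; apply: Cov_ext cov => r hr.
  by rewrite Es.
have njd : ix d != ix j by rewrite /ix; lia.
have inv_set C1 st1 v : inv inp d n C1 st1 -> inv inp d n C1 (setn st1 (ix j) v).
  move=> [h0 h1 h2 h3].
  have E : (fun r => nv (setn st1 (ix j) v) (bx r)) = (fun r => nv st1 (bx r)).
    apply/funext => r; rewrite /= /upd (_ : (bx r == ix j) = false) //.
    by rewrite /bx /ix; lia.
  split; [by rewrite /= /upd neq_ix | by rewrite /= /upd neq_ix | | by rewrite E].
  by rewrite /= /upd (negbTE njd).
pose I m st' := exists C', [/\ forall s, C s -> C' s, inv inp d n C' st',
  forall r, (j.+1 <= r < K)%N -> nv st' (ix r) = nv st (ix r) &
  forall s, in_range K n s -> (s j < m)%N ->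
    (forall r, (j.+1 <= r < K)%N -> s r = nv st (ix r)) -> Cov s C'].
have ixj r : (j < r)%N -> (ix r == ix j) = false by rewrite /ix; lia.
have [g0 g1 _ _] := i0.
apply: (@htri_for _ _ (ix j) 0 1 (for_tuples j c) st n (nest_time n t0 j) I) => //.
- exists C; split=> //; first exact: inv_set.
  by move=> r /andP[hr _]; rewrite /= /upd ixj.
- move=> m st1 hm [C1 [sub1 i1 e1 cov1]] em _ _.
  have hlt1 r : (j <= r < K)%N -> (nv st1 (ix r) < n)%N.
    rewrite leq_eqVlt => /andP[/orP[/eqP <- _|h1 h2]]; first by rewrite em.
    by rewrite e1 ?h1 // hlt ?h1.
  apply: htri_weaken (IH _ _ (ltnW hj) i1 hlt1) (leqnn _) _.
  move=> st2 [C2 sub2 [i2 e2 cov2]]; have [f0 f1 _ _] := i2.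
  have e2j : nv st2 (ix j) = m by rewrite e2 ?em // leqnn.
  split=> //; exists C2; split; first by move=> s /sub1 /sub2.
  + exact: inv_set.
  + move=> r /andP[h1 h2]; rewrite /= /upd ixj // e2 ?e1 ?h1 //.
    by rewrite ltnW.
  + move=> s rs; rewrite ltnS leq_eqVlt => /orP[/eqP Ej|hs] Es.
      apply: cov2 => // r; rewrite leq_eqVlt => /andP[/orP[/eqP <- _|h1 h2]].
        by rewrite Ej em.
      by rewrite Es ?h1 // e1 ?h1.
    by apply: Cov_sub sub2 _; apply: cov1.
- move=> st' _ _ _ [C' [sub i' e' cov]]; exists C' => //; split=> // s rs Es.
  by apply: cov => //; apply: rs.
Qed.

Hypothesis Cov_good : forall C s0, (forall s, in_range K n s -> Cov s C) ->
  optimal d n (pt inp d n) s0 -> exists2 s', C s' & 0 < Asq d (pt inp d n) s' /\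
     Off d (pt inp d n) s' ^+ 2 * Asq d (pt inp d n) s0
       <= Off d (pt inp d n) s0 ^+ 2 * Asq d (pt inp d n) s'.

Definition main_time : nat :=
  (hcost (main_init d) + (nest_time n t0 K + hcost (main_output d)))%N.

Lemma main_spec st : nv st 0 = n ->
  htri inp (main_code d K c) st main_time (fun st' =>
    forall s, in_range d n s -> 0 < Asq d (pt inp d n) s ->
    exists2 b, optimal d n (pt inp d n) b & forall r, (r < d)%N -> nv st' r = b r).
Proof.
move=> e0; apply: htri_seq; apply: htri_loopfree => //; set st1 := hexec _ st.
have n1 i : (i < 20)%N -> nv st1 i = if i == 1%N then 1%N else nv st i.
  by move=> hi; rewrite /st1 /= /upd !neq_ix.
have i1 : inv inp d n (fun _ => False) st1.
  split; [by rewrite n1 | by rewrite n1 | | ].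
    by rewrite /st1 /= /upd eqxx /= ?neq_ix //= ?add0n.
  by split=> //; left; rewrite /st1 /= /upd /=.
apply: htri_seq; apply: htri_weaken (nest_spec (leqnn K) i1 _) (leqnn _) _.
  by move=> r hr; lia.
move=> st2 [C _ [i2 _ cov]]; have [_ _ _ Hb] := i2.
apply: htri_loopfree; first exact: loopfree_hseqs.
move=> s rs As; exists (fun r => nv st2 (bx r)).
  apply: best_optimal Hb rs As _ => s0 o0; apply: (Cov_good _ o0) => s' rs'.
  by apply: cov => // r; lia.
have H m : let st' := hexec (main_output m) st2 in
    (forall r, (r < m)%N -> nv st' r = nv st2 (bx r)) /\
    (forall i, (m <= i)%N -> nv st' i = nv st2 i).
  rewrite /= /main_output hexec_hseqs; elim: m => [|m [IH1 IH2]] //.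
  rewrite iota0S map_rcons foldl_rcons /=.
  have hm : (bx m == m) = false by rewrite /bx; lia.
  move: (foldl _ _ _) IH1 IH2 => st' IH1 IH2; split=> [r|i hi]; rewrite /upd ?eqxx ?hm.
    rewrite ltnS leq_eqVlt => /orP[/eqP ->|hr]; last by rewrite (ltn_eqF hr) IH1.
    by rewrite eqxx add0n IH2 // /bx; lia.
  by rewrite (gtn_eqF hi) IH2 // ltnW.
by have [H1 _] := H d.
Qed.

End Nest.

End AllTuples.

(* For d = 1 every point is a candidate; for d = k + 2 the pairs adjacent in
   slope order complete every k-tuple. *)
Definition depth d : nat := if d is k.+2 then k else 1.
Definition body d : hcom := if d is k.+2 then tuple_code k else try_tuple d.
Definition body_time d n : nat := if d is k.+2 then tuple_time n k else hcost (try_tuple d).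

Lemma solve_spec (R : realType) (inp : nat -> R) n d st : (0 < d)%N -> nv st 0 = n ->
  htri inp (main_code d (depth d) (body d)) st (main_time n d (depth d) (body_time d n))
  (fun st' =>
    forall s, in_range d n s -> 0 < Asq d (pt inp d n) s ->
    exists2 b, optimal d n (pt inp d n) b & forall r, (r < d)%N -> nv st' r = b r).
Proof.
case: d => [//|[|k]] _ e0.
- apply: (@main_spec _ _ _ _ _ _ _
    (fun s C => exists2 s', C s' & forall r, (r < 1)%N -> s' r = s r)) => //.
  + by move=> s C C' sub [s' Cs Es]; exists s' => //; apply: sub.
  + by move=> s s' C E [s1 Cs Es]; exists s1 => // r hr; rewrite Es ?E.
  + move=> C st1 i1 rg; apply: htri_loopfree; first exact: loopfree_try.
    have [i2 k2 _] := inv_try i1 rg.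
    exists (fun s => C s \/ s = idx st1); first by left.
    split=> //; first by move=> r _; apply/k2/kept_ix.
    by exists (idx st1) => //; right.
  + move=> C s0 cov [r0 A0 _]; have [s' Cs Es] := cov s0 r0; exists s' => //.
    by rewrite (eq_Asq _ Es) (eq_Off _ Es).
- apply: (@main_spec _ _ _ _ _ _ _ (lists_tried inp n k)) => //=.
  + exact: leqW (leqnSn k).
  + by move=> s C C' sub H g h hg hh; apply: list_tried_sub (H g h hg hh).
  + move=> s s' C E H g h hg hh; have [l [h1 h2 h3]] := H g h hg hh; exists l.
    have Eom u v w : om k (pt inp k.+2 n) s u v w = om k (pt inp k.+2 n) s' u v w.
      exact: eq_om.
    have Ekey x : skey k (pt inp k.+2 n) s g h x = skey k (pt inp k.+2 n) s' g h x.
      by rewrite /skey !Eom.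
    split=> [i||x y /h3[t Ct Et]].
    * rewrite h1; congr (_ && (0 < _)); apply: eq_bigr => m _; apply: eq_bigr => m' _.
      by rewrite Eom.
    * by rewrite (@eq_sorted _ _ (fun x y => skey k (pt inp k.+2 n) s g h x
         <= skey k (pt inp k.+2 n) s g h y)) // => x y; rewrite !Ekey.
    * exists t => // r hr; rewrite Et // /tuple_of; case: ltnP => // h4; exact: E.
  + by move=> C st1; apply: tuple_spec.
  + move=> C s0 cov [r0 A0 opt0].
    have rk : in_range k n s0 by move=> r hr; apply: r0; lia.
    have {cov} H := cov s0 rk.
    have /choice[l Hl] : forall gh : nat * nat, exists l : seq nat,
        (gh.1 < k + 3)%N -> (gh.2 < k + 3)%N ->
        [/\ forall i, (i \in l) = (i < n)%N && (0 < nzsum k (pt inp k.+2 n) s0 i),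
            sorted (fun x y => skey k (pt inp k.+2 n) s0 gh.1 gh.2 x
                            <= skey k (pt inp k.+2 n) s0 gh.1 gh.2 y) l
          & forall x y, adjacent l x y -> tried k s0 C x y].
      move=> [g h]; have [[hg hh]|nh] := pselect ((g < k + 3)%N /\ (h < k + 3)%N).
        by have [l Hl] := H g h hg hh; exists l.
      by exists [::] => /= hg hh; case: nh.
    have [g [h [x [y [hg hh ad Axy Dxy]]]]] := @candidates_suffice R k (pt inp k.+2 n) n s0
      r0 A0 opt0 (fun g h => l (g, h))
      (fun g h i hg hh => let: And3 p _ _ := Hl (g, h) hg hh in p i)
      (fun g h hg hh => let: And3 _ p _ := Hl (g, h) hg hh in p).
    have [_ _ tr] := Hl (g, h) hg hh; have [s Cs Es] := tr _ _ ad.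
    exists s => //; rewrite (eq_Asq _ Es) (eq_Off _ Es); split=> //.
    by move: Dxy; rewrite A0E D0E.
Qed.

(* Copies the input above all registers and scratch cells, whose addresses it
   initially occupies: first the 2B lowest cells, by straight-line code, and
   then the others. *)
Definition copy_low B : com :=
  foldr CSeq CSkip [seq CSeq (CInstr (NConst 5 c))
    (CSeq (CInstr (NAdd 5 5 B.+1)) (CInstr (RStore 5 c))) | c <- iota 0 B.*2].

Definition copy_high B : com :=
  CSeq (CInstr (NConst 5 B.*2)) (CSeq (CInstr (NConst 6 1))
    (CWhile (NLt 5 2) (CSeq (CInstr (RLoad 0 5)) (CSeq (CInstr (NAdd 7 5 B.+1))
      (CSeq (CInstr (RStore 7 0)) (CInstr (NAdd 5 5 6))))))).

Definition prologue B d : com :=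
  CSeq (iter d (CSeq (CInstr (NAdd 2 2 0))) CSkip)
    (CSeq (CInstr (NConst 3 d)) (CSeq (CInstr (NAdd 2 2 3))
      (CSeq (CInstr (NConst 4 B.*2)) (CSeq (CInstr (NAdd B.+1 2 4))
        (CSeq (copy_low B) (copy_high B)))))).

Section Prologue.
Variables (R : realType) (n d B : nat) (X0 : nat -> R).
Hypothesis B_ge : (8 <= B)%N.
Let len := (n * d + d)%N.
Hypothesis X0_out : forall i, (len <= i)%N -> X0 i = 0.
Let F := (len + B.*2)%N.
Implicit Types (N : nat -> nat) (X : nat -> R).

Definition copied m (N : nat -> nat) (X : nat -> R) : Prop :=
  [/\ N 0 = n, N 2 = len, N B.+1 = F &
     forall c, (0 < c)%N -> X c = if (F <= c < F + m)%N then X0 (c - F)%N else X0 c].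

Lemma copied_add m N X : copied m N X -> (m < F)%N ->
  copied m.+1 N (fun c => if c == (F + m)%N then X0 m else X c).
Proof.
move=> [h0 h2 hB hX] hm; split=> // c c0; case: eqP => [->|/eqP nc].
  by rewrite leq_addr ltn_add2l ltnSn addKn.
by rewrite hX // addnS ltnS (leq_eqVlt c) (negbTE nc).
Qed.

Lemma sum_n_spec j N X (Q : mem_pred R) : N 0 = n ->
  (forall N', N' 0 = n -> N' 2 = (N 2 + n * j)%N -> Q N' X) ->
  tri (iter j (CSeq (CInstr (NAdd 2 2 0))) CSkip) N X j Q.
Proof.
elim: j N => [|j IH] N h0 HQ; first by apply: tri_skip; apply: HQ; rewrite ?muln0 ?addn0.
apply: (@tri_seq _ _ _ _ _ 1 j); apply: tri_instr => //=.
by apply: IH => // N' h0' h2'; apply: HQ => //; rewrite h2' /= h0 mulnS; lia.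
Qed.

Lemma copy_low_spec N X (Q : mem_pred R) : copied 0 N X -> X 0 = X0 0 ->
  (forall N' X', copied B.*2 N' X' -> Q N' X') ->
  tri (copy_low B) N X (3 * B.*2) Q.
Proof.
rewrite /copy_low.
suff H : forall j m N X, (m + j = B.*2)%N -> copied m N X -> X 0 = X0 0 ->
    (forall N' X', copied B.*2 N' X' -> Q N' X') ->
    tri (foldr CSeq CSkip [seq CSeq (CInstr (NConst 5 c))
      (CSeq (CInstr (NAdd 5 5 B.+1)) (CInstr (RStore 5 c))) | c <- iota m j]) N X (3 * j) Q.
  exact: H.
elim=> [|j IH] m {}N {}X Em H HX HQ.
  by apply: tri_skip; apply: HQ; rewrite -Em addn0.
rewrite mulnS; apply: tri_seq; apply: (@tri_seq _ _ _ _ _ 1 2); apply: tri_instr => //=.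
apply: (@tri_seq _ _ _ _ _ 1 1); apply: tri_instr => //=; apply: tri_instr => //=.
have [h0 h2 hB hX] := H.
have EB : (B.+1 == 5) = false by lia.
rewrite EB hB [(m + F)%N]addnC.
have Xm : X m = X0 m.
  case: (posnP m) => [-> //|m0]; rewrite hX //.
  by rewrite (_ : (F <= m < _)%N = false) // /F; lia.
apply: IH => //; first by rewrite addSnnS.
  have := copied_add H (_ : (m < F)%N); rewrite /F; move=> /(_ ltac:(lia)) [k0 k2 kB kX].
  split=> //=; first by rewrite EB.
  by move=> c c0; rewrite -kX // Xm.
by move=> /=; case: eqP => // E; exfalso; move: E; rewrite /F; lia.
Qed.

Lemma copy_high_spec N X (Q : mem_pred R) : copied B.*2 N X ->
  (forall N' X', N' 0 = n -> N' B.+1 = F -> (forall i, X' (F + i)%N = X0 i) -> Q N' X') ->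
  tri (copy_high B) N X (1 + (1 + (6 * len + 2))) Q.
Proof.
move=> H HQ; apply: tri_seq; apply: tri_instr => //=; apply: tri_seq; apply: tri_instr => //=.
pose I t (N' : nat -> nat) (X' : nat -> R) := exists m,
  [/\ (B.*2 <= m)%N, copied m N' X', N' 5 = m, N' 6 = 1%N & (6 * (len - m) + 2 <= t)%N].
have EB i : (i < 8)%N -> (B.+1 == i) = false by lia.
apply: (@tri_while _ _ _ I).
  move=> t N' X' [m [hm Hc e5 e6 ht]] /=; have [h0 h2 hB hX] := Hc.
  rewrite e5 h2; case: ltnP => hlt.
    exists 4%N, (6 * (len - m.+1) + 2)%N; split; first by lia.
    apply: (@tri_seq _ _ _ _ _ 1 3); apply: tri_instr => //=.
    apply: (@tri_seq _ _ _ _ _ 1 2); apply: tri_instr => //=.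
    apply: (@tri_seq _ _ _ _ _ 1 1); apply: tri_instr => //=; apply: tri_instr => //=.
    exists m.+1; rewrite e5 e6 addn1 hB; split=> //=; first by apply: leq_trans hm _.
    have m0 : (0 < m)%N by lia.
    have Xm : X' m = X0 m by rewrite hX // (_ : (F <= m < _)%N = false) // /F; lia.
    have := copied_add Hc (_ : (m < F)%N); rewrite /F; move=> /(_ ltac:(lia)) [k0 k2 kB kX].
    split=> //=; first by rewrite !EB.
    move=> c c0; rewrite -kX // [(m + _)%N]addnC Xm; case: eqP => // _.
    by rewrite (_ : (c == 0) = false) //; lia.
  split; first by lia.
  apply: HQ => // i; rewrite hX; last by rewrite /F; lia.
  rewrite addKn leq_addr ltn_add2l /=; case: ltnP => // hi.
  by rewrite !X0_out // /F; lia.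
have [h0 h2 hB hX] := H.
by exists B.*2; split=> //=; [split=> //=; rewrite ?EB | rewrite leq_add2r leq_mul2l leq_subr orbT].
Qed.

Definition prologue_time : nat := (d + (1 + (1 + (1 + (1 + (3 * B.*2 + (1 + (1 + (6 * len + 2)))))))))%N.

Lemma prologue_spec N (Q : mem_pred R) : N 0 = n -> N 2 = 0%N ->
  (forall N' X' h, represents X0 B h N' X' -> nv h 0 = n -> Q N' X') ->
  tri (prologue B d) N X0 prologue_time Q.
Proof.
move=> h0 h2 HQ; apply: tri_seq; apply: sum_n_spec => // N1 e0 e2.
apply: tri_seq; apply: tri_instr => //=; apply: tri_seq; apply: tri_instr => //=.
apply: tri_seq; apply: tri_instr => //=; apply: tri_seq; apply: tri_instr => //=.
have EB i : (i < 8)%N -> (i == B.+1) = false by lia.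
apply: tri_seq; apply: copy_low_spec => //.
  split=> /=; rewrite ?eqxx ?EB ?e2 ?h2 //.
  by move=> c _; rewrite addn0 (_ : (F <= c < F)%N = false) //; lia.
move=> N2 X2 H2; apply: copy_high_spec H2 _ => N3 X3 f0 fB fX.
apply: (HQ N3 X3 (HS N3 X3 (fun a i => N3 (B.+3 + a + i.*2)%N))) => //.
by split=> //; [rewrite fB /F; lia | move=> i; rewrite fB].
Qed.

End Prologue.

Section Asymptotics.
Variable R : realType.

Lemma trunc_log_powR (delta : R) : 0 < delta -> exists2 K : R, 0 <= K &
  forall n, (0 < n)%N -> (trunc_log 2 n)%:R <= K * n%:R `^ delta.
Proof.
move=> d0; have l2 : 0 < ln 2 :> R by rewrite ln_gt0 // ltr1n.
have p0 : 0 < delta * ln 2 by rewrite mulr_gt0.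
exists (delta * ln 2)^-1; first by rewrite invr_ge0 ltW.
move=> n n0; rewrite ler_pdivlMl //.
set u := trunc_log 2 n.
have un : (2 ^ u <= n)%N by apply: trunc_logP.
have : (2 ^ u)%:R `^ delta <= n%:R `^ delta :> R.
  by apply: ge0_ler_powR; rewrite ?nnegrE ?ler0n ?ler_nat // ltW.
apply: le_trans; rewrite /powR pnatr_eq0 expn_eq0 /= natrX lnXn ?ltr0n //.
apply: le_trans (expR_ge1Dx _); lra.
Qed.

End Asymptotics.

Section TimeBounds.
Local Open Scope nat_scope.

Lemma gh_time_le k g h : exists K, forall n,
  gh_time n k g h <= K * (n.+1 * (trunc_log 2 (2 * n)).+1).
Proof.
rewrite /gh_time.
move: (hcost (keep_code k)) (hcost sort_start) (hcost (merge_code k g h))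
  (hcost merge_start) (hcost merge_end) (hcost pairs_start) (hcost (pair_code k)) => a b c e f u v.
exists (a + 3 + b + (c + 2) + (e + f + 4) + u + (v + 2) + 8) => n.
move: (trunc_log _ _) => L; set M := n.+1 * L.+1.
have M1 : 1 <= M by rewrite muln_gt0.
have Mn : n <= M by rewrite -[X in X <= _]muln1 leq_mul.
have MnL : n * L <= M by rewrite leq_mul.
have h1 := leq_mul (leqnn (a + 3)) Mn; have h2 := leq_mul (leqnn (c + 2)) MnL.
have h3 := leq_mul (leqnn (e + f + 4)) Mn; have h4 := leq_mul (leqnn (v + 2)) Mn.
have h5 := leq_mul (leqnn (b + u + 8)) M1; rewrite !mulnDl in h1 h2 h3 h4 h5 *.
move: M h1 h2 h3 h4 h5 {M1 Mn MnL} => M; lia.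
Qed.

Lemma tuple_time_le k : exists K, forall n,
  tuple_time n k <= K * (n.+1 * (trunc_log 2 (2 * n)).+1).
Proof.
rewrite /tuple_time; elim: (axes k) => [|gh l [K HK]]; first by exists 0.
have [K' HK'] := gh_time_le k gh.1 gh.2; exists (K' + K) => n.
by rewrite /= mulnDl leq_add.
Qed.

Lemma nest_time_le n t0 j : nest_time n t0 j + 3 <= n.+1 ^ j * (t0 + 3 + 6 * j).
Proof.
elim: j => [|j IH] /=; first by rewrite expn0 mul1n muln0 addn0.
have p : 0 < n.+1 ^ j.+1 by rewrite expn_gt0.
apply: (@leq_trans (n.+1 * (n.+1 ^ j * (t0 + 3 + 6 * j)) + 6 * n.+1 ^ j.+1)); last first.
  by rewrite mulnA -expnS; move: (n.+1 ^ j.+1); lia.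
have : n * (nest_time n t0 j + 3) <= n.+1 * (n.+1 ^ j * (t0 + 3 + 6 * j)).
  exact: leq_mul (leqnSn n) IH.
by move: (n * _) (n.+1 * _) p; move: (n.+1 ^ j.+1); lia.
Qed.

Definition total_time d B n : nat :=
  prologue_time n d B + main_time n d (depth d) (body_time d n).

Lemma prologue_time_le d B : exists K, forall n, prologue_time n d B <= K * n.+1.
Proof. by exists (d + 8 + 3 * B.*2 + 6 * d) => n; rewrite /prologue_time; nia. Qed.

Lemma total_time1 B : exists K, forall n, total_time 1 B n <= K * n.+1.
Proof.
have [K HK] := prologue_time_le 1 B.
exists (K + hcost (main_init 1) + hcost (main_output 1) + (body_time 1 0 + 9)) => n.
rewrite /total_time /main_time; have := HK n.
rewrite (_ : body_time 1 n = body_time 1 0) // (_ : depth 1 = 1) //.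
have := nest_time_le n (body_time 1 0) 1; rewrite expn1.
move: (nest_time _ _ _) (prologue_time _ _ _) (hcost (main_init 1)) (hcost (main_output 1)).
by move: (body_time 1 0) => t a b c e; nia.
Qed.

Lemma total_time2 k B : exists K, forall n,
  total_time k.+2 B n <= K * (n.+1 ^ k.+1 * (trunc_log 2 (2 * n)).+1).
Proof.
have [K1 H1] := prologue_time_le k.+2 B; have [K2 H2] := tuple_time_le k.
exists (K1 + hcost (main_init k.+2) + hcost (main_output k.+2) + (K2 + 3 + 6 * k)) => n.
rewrite /total_time /main_time [depth _]/= [body_time _ _]/=.
have := H1 n; have := nest_time_le n (tuple_time n k) k; have := H2 n.
move: (nest_time _ _ _) (prologue_time _ _ _) (hcost (main_init _)) (hcost (main_output _)).
move: (tuple_time n k) => t a b c e.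
set L := (trunc_log 2 (2 * n)).+1; set E := n.+1 ^ k => h2 h3 h1.
have L0 : 0 < L by []. have E0 : 0 < E by rewrite expn_gt0.
set M := n.+1 ^ k.+1 * L.
have EM : M = E * (n.+1 * L) by rewrite /M expnSr mulnA.
have nM : n.+1 <= M by rewrite EM mulnCA leq_pmulr // muln_gt0 E0.
have EleM : E <= M by rewrite EM leq_pmulr.
have M0 : 0 < M by apply: leq_trans nM.
have g1 : b <= K1 * M by apply: leq_trans h1 _; rewrite leq_mul2l nM orbT.
have g2 : a <= (K2 + 3 + 6 * k) * M.
  apply: (@leq_trans (E * (t + 3 + 6 * k))); first by apply: leq_trans h3; apply: leq_addr.
  rewrite -addnA mulnDr -addnA mulnDl leq_add //; last by rewrite mulnC leq_mul.
  apply: leq_trans (leq_mul (leqnn E) h2) _.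
  by rewrite EM mulnCA.
have g3 : c <= c * M by apply: leq_pmulr.
have g4 : e <= e * M by apply: leq_pmulr.
by rewrite !(mulnDl _ _ M) in g2 *; move: M g1 g2 g3 g4 {EM nM EleM M0} => M; lia.
Qed.

End TimeBounds.

Lemma total_time_bigO (R : realType) d B (delta : R) : (0 < d)%N -> 0 < delta ->
  (d = 1%N -> 1 <= delta) ->
  (fun n : nat => (total_time d B n)%:R : R^o) =O_\oo
    (fun n : nat => n%:R `^ (d%:R - 1 + delta) : R^o).
Proof.
move=> d0 hdelta hd1.
suff [K K0 HK] : exists2 K : R, 0 < K & forall n, (0 < n)%N ->
    (total_time d B n)%:R <= K * n%:R `^ (d%:R - 1 + delta).
  apply/eqO_exP; exists K => //; near=> n.
  rewrite ger0_norm ?ler0n // ger0_norm ?powR_ge0 //; apply: HK.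
  by near: n; exists 1%N.
have ge1 n : (0 < n)%N -> 1 <= n%:R `^ delta :> R.
  move=> n0; have h : 1 <= n%:R :> R by rewrite ler1n.
  by have := ler_powR h (ltW hdelta); rewrite powRr0.
case: d d0 hd1 => [//|[|k]] _ hd1.
  have [K HK] := total_time1 B; exists (2 * K%:R + 1) => [|n n0].
    by have := ler0n R K; lra.
  rewrite subrr add0r.
  have n1 : n%:R <= n%:R `^ delta :> R.
    have h : 1 <= n%:R :> R by rewrite ler1n.
    by have := ler_powR h (hd1 erefl); rewrite powRr1.
  have : (total_time 1 B n)%:R <= (K * n.+1)%:R :> R by rewrite ler_nat.
  have nn : n.+1%:R <= 2 * n%:R :> R by rewrite -natrM ler_nat; lia.
  have := ler_wpM2l (ler0n R K) nn; have := ler_wpM2l (ler0n R K) n1.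
  by have := ge1 n n0; rewrite natrM; lra.
have [K HK] := total_time2 k B; have [L L0 HL] := trunc_log_powR hdelta.
exists (K%:R * (2 ^ k.+1)%:R * (L + 2) + 1) => [|n n0].
  by have := mulr_ge0 (mulr_ge0 (ler0n R K) (ler0n R (2 ^ k.+1))) (addr_ge0 L0 (ler0n R 2)); lra.
have -> : n%:R `^ (k.+2%:R - 1 + delta) = n%:R ^+ k.+1 * n%:R `^ delta :> R.
  rewrite powRD; last by rewrite pnatr_eq0 -lt0n n0 implybT.
  by rewrite -(natr1 k.+1) addrK powR_mulrn.
have H1 : (total_time k.+2 B n)%:R <= K%:R * ((n.+1 ^ k.+1)%:R * (trunc_log 2 (2 * n)).+1%:R) :> R.
  by rewrite -!natrM ler_nat.
have H2 : (n.+1 ^ k.+1)%:R <= (2 ^ k.+1)%:R * n%:R ^+ k.+1 :> R.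
  rewrite -natrX -natrM ler_nat -expnMn leq_exp2r // mul2n -addnn; lia.
have H3 : (trunc_log 2 (2 * n)).+1%:R <= (L + 2) * n%:R `^ delta :> R.
  rewrite mul2n trunc_log2_double // -addn2 natrD.
  by have := HL n n0; have := ge1 n n0; lra.
apply: le_trans H1 _; rewrite mulrDl mul1r.
apply: (@le_trans _ _ (K%:R * ((2 ^ k.+1)%:R * n%:R ^+ k.+1 * ((L + 2) * n%:R `^ delta)))).
  by apply: ler_wpM2l => //; apply: ler_pM => //; apply: ler0n.
rewrite (_ : K%:R * _ = K%:R * (2 ^ k.+1)%:R * (L + 2) * (n%:R ^+ k.+1 * n%:R `^ delta)); last by ring.
by rewrite lerDl mulr_ge0 ?powR_ge0 ?exprn_ge0.
Unshelve. all: by end_near.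
Qed.

Section Input.
Variables (R : realType) (d n : nat) (p : 'I_n -> 'rV[R]_d) (y : 'rV[R]_d).

Definition input : seq R := flatten [seq coords (p i) | i <- enum 'I_n] ++ coords y.

Lemma size_coords (v : 'rV[R]_d) : size (coords v) = d.
Proof. by rewrite size_map size_enum_ord. Qed.

Lemma nth_coords (v : 'rV[R]_d) (c : 'I_d) : nth 0 (coords v) c = v 0 c.
Proof. by rewrite (nth_map c) ?size_enum_ord // nth_ord_enum. Qed.

Lemma nth_flatten_uniform (ss : seq (seq R)) i c : all (fun s => size s == d) ss ->
  (i < size ss)%N -> (c < d)%N -> nth 0 (flatten ss) (c + d * i) = nth 0 (nth [::] ss i) c.
Proof.
elim: ss i => //= s ss IH [|i] /andP[/eqP sd H] hi hc.
  by rewrite muln0 addn0 nth_cat sd hc.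
rewrite nth_cat sd ltnNge mulnS addnCA leq_addr /= addKn; exact: IH.
Qed.

Lemma uniform_points : all (fun s => size s == d) [seq coords (p i) | i <- enum 'I_n].
Proof. by rewrite all_map; apply/allP => i _ /=; rewrite size_coords. Qed.

Lemma size_points : size (flatten [seq coords (p i) | i <- enum 'I_n]) = (d * n)%N.
Proof.
have H (ss : seq (seq R)) : all (fun s => size s == d) ss -> size (flatten ss) = (d * size ss)%N.
  by elim: ss => [_|s ss IH /= /andP[/eqP sd /IH E]]; rewrite ?muln0 // size_cat sd E mulnS.
by rewrite (H _ uniform_points) size_map size_enum_ord.
Qed.

Lemma input_point (i : 'I_n) (c : 'I_d) : nth 0 input (c + d * i)%N = p i 0 c.
Proof.
have lt : (c + d * i < d * n)%N.
  by apply: (@leq_trans (d * i.+1)); [rewrite mulnS ltn_add2r | rewrite leq_mul2l ltn_ord orbT].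
rewrite nth_cat size_points lt (nth_flatten_uniform uniform_points _ (ltn_ord c)); last first.
  by rewrite size_map size_enum_ord.
by rewrite (nth_map i) ?size_enum_ord // nth_ord_enum nth_coords.
Qed.

Lemma input_query (c : 'I_d) : nth 0 input (c + d * n)%N = y 0 c.
Proof. by rewrite nth_cat size_points ltnNge leq_addl /= addnK nth_coords. Qed.

Lemma input_out i : (n * d + d <= i)%N -> nth 0 input i = 0.
Proof. by move=> h; rewrite nth_default // size_cat size_points size_coords mulnC. Qed.

End Input.

Lemma iter_step_halted (R : realType) P (st : state R) m :
  halted P st -> iter m (step P) st = st.
Proof.
move=> H; have E : step P st = st by rewrite /step onth_default.
by elim: m => //= m ->.
Qed.

Definition solver_size d := maxn 8 (bound (main_code d (depth d) (body d))).

Definition solver d : program := compile (CSeq (prologue (solver_size d) d)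
  (lower (solver_size d) (main_code d (depth d) (body d)))) 0.

Lemma bound_main d K c : (d <= bound (main_code d K c))%N.
Proof.
suff H m : (m <= bound (hseqs [seq hmov r (bx r) | r <- iota 0 m]))%N.
  by rewrite /main_code /=; apply: leq_trans (H d) _; rewrite !leq_max leqnn !orbT.
have HS cs c' : (bound c' <= bound (hseqs (rcons cs c')))%N.
  elim: cs => [|c1 cs IH] /=; first exact: leq_maxl.
  by apply: leq_trans IH _; apply: leq_maxr.
case: m => // m; rewrite iota0S map_rcons; apply: leq_trans (HS _ _) => /=.
exact: leq_maxl.
Qed.

Lemma solver_correct (R : realType) d : (0 < d)%N ->
  solves_nearest_hyperplane R d (solver d) (total_time d (solver_size d)).
Proof.
move=> d0 n p y _; set st := iter _ _ _.
set c := main_code d (depth d) (body d); set B := solver_size d.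
set X0 := nth 0 (input p y).
have B8 : (8 <= B)%N by apply: leq_maxl.
have Bc : (bound c <= B)%N by apply: leq_maxr.
pose N0 : nat -> nat := [eta (fun=> 0%N) with 0%N |-> n].
have VE (i : 'I_n) (j : 'I_d) : pt X0 d n i j = p i 0 j - y 0 j.
  by rewrite /pt /X0 input_point input_query.
have : tri (CSeq (prologue B d) (lower B c)) N0 X0 (total_time d B n) (fun N' X' =>
    forall s, in_range d n s -> 0 < Asq d (pt X0 d n) s ->
    exists2 b, optimal d n (pt X0 d n) b & forall r, (r < d)%N -> N' r = b r).
  apply: tri_seq; apply: prologue_spec => // [i|N' X' h hrel h0]; first exact: input_out.
  have Hs := @solve_spec R X0 n d h d0 h0.
  apply: tri_weaken (Hs B N' X' Bc hrel) (leqnn _) _ => N2 X2 [h2 r2 H2] s rs As.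
  have [b ob Eb] := H2 s rs As; exists b => // r hr.
  have [rN _ _ _ _] := r2; rewrite rN ?Eb //.
  by apply: leq_trans Bc; apply: leq_trans hr _; apply: bound_main.
move=> /(_ [::] [::]) [k [N' [X' [hk E H]]]].
have Est : st = State (csize (CSeq (prologue B d) (lower B c))) N' X'.
  rewrite /st -(subnK hk) iterD; move: E; rewrite !cat0s cats0 add0n => E.
  rewrite (_ : iter k _ _ = State (csize (CSeq (prologue B d) (lower B c))) N' X') //.
  by apply: iter_step_halted; rewrite /halted size_compile.
split; first by rewrite Est /halted size_compile.
move=> [s Hs].
pose s1 r : nat := oapp (fun i => val (s i)) 0%N (insub r).
have E1 (i : 'I_d) : s1 i = s i by rewrite /s1 valK.
have r1 : in_range d n s1 by move=> r hr; rewrite -[r]/(val (Ordinal hr)) E1.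
have A1 : 0 < Asq d (pt X0 d n) s1 by apply/(induces_Asq VE d0 E1).
have [b ob Eb] := H s1 r1 A1; have [rb _ _] := ob.
exists (fun i => Ordinal (rb _ (ltn_ord i))); split.
  by move=> i; rewrite Est /= Eb.
exact: (@optimal_nearest _ _ _ p y _ VE d0 _ b).
Qed.

(* For d = 1 and delta < 1 the bound n^delta is sublinear and no algorithm can
   even read the input; hd1 excludes exactly this case and is void for d >= 2. *)
Theorem theorem3 (R : realType) (d : nat) (hd : (0 < d)%N)
    (delta : R) (hdelta : 0 < delta) (hd1 : d = 1%N -> 1 <= delta) :
  exists (P : program) (T : nat -> nat),
    solves_nearest_hyperplane R d P T /\
    (fun n : nat => (T n)%:R : R^o) =O_\oo
      (fun n : nat => n%:R `^ (d%:R - 1 + delta) : R^o).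
Proof.
exists (solver d), (total_time d (solver_size d)); split.
  exact: solver_correct.
exact: total_time_bigO.
Qed.
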